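(* Let $G_V$ be a graph product group over a finite simple graph with vertex set $V$ and let $v\in V$ be a vertex. For each $v'\in V$ let $X_{v'}$ be an inverse-closed generating set for the vertex group $G_{v'}$. For each subset $S\subseteq V$ let $X_S=\bigcup_{v'\in S}X_{v'}$ be the generating set for the subgraph product $G_S$ on the subgraph induced by $S$, let $\tilde\sigma_S$ be the spherical conjugacy growth series of $G_S$ with respect to $X_S$, and let $\sigma_S$ be the spherical growth series of $G_S$ with respect to $X_S$. Then the spherical conjugacy growth series of $G_V$ is given by \[ \tilde\sigma_V=\tilde\sigma_{V\setminus\{v\}}+\tilde\sigma_{\mathsf{Lk}(v)}\,(\tilde\sigma_{\{v\}}-1)+\sum_{S\subseteq \mathsf{Lk}(v)}\tilde\sigma^{\mathcal M}_S\;\mathsf{N}\!\left(\left(\frac{\sigma_{\mathsf{Lk}(S)\setminus\{v\}}}{\sigma_{\mathsf{Lk}(v)\cap \mathsf{Lk}(S)}}-1\right)(\sigma_{\{v\}}-1)\right),\] where $\tilde\sigma^{\mathcal M}_S=\sum_{S'\subseteq S}(-1)^{|S|-|S'|}\tilde\sigma_{S'}$. Moreover, if $\{v\}\cup \mathsf{Lk}(v)=V$, then $\tilde\sigma_V=\tilde\sigma_{\mathsf{Lk}(v)}\,\tilde\sigma_{\{v\}}$.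
   Context: All groups are finitely generated and all generating sets are finite and inverse-closed. Let $\Gamma=(V,E)$ be a finite simple graph (no loops or multiple edges) and for each $v\in V$ let $G_v$ be a nontrivial group. The graph product $G_V$ is the quotient of the free product of the $G_v$ by the normal closure of all commutators $[g_v,g_w]$ with $g_v\in G_v$, $g_w\in G_w$, $\{v,w\}\in E$. For $S\subseteq V$, the subgraph product is $G_S=\langle G_{v'}\mid v'\in S\rangle\le G_V$ (it is isomorphic to the graph product on the induced subgraph on $S$; $G_\emptyset$ is trivial). Links: $\mathsf{Lk}(v)=\{w\in V:\{v,w\}\in E\}$; for nonempty $S\subseteq V$, $\mathsf{Lk}(S)=\bigcap_{w\in S}\mathsf{Lk}(w)$; $\mathsf{Lk}(\emptyset)=V$. Growth series: for a group $G$ with finite inverse-closed generating set $X$, the length $\|g\|$ of $g\in G$ is the length of a shortest word over $X$ representing $g$. The spherical (standard) growth series is $\sigma(z)=\sum_{n\ge 0}a_nz^n$, where $a_n$ is the number of elements of $G$ of length $n$. The spherical conjugacy growth series is $\tilde\sigma(z)=\sum_{n\ge0}\tilde a_nz^n$, where $\tilde a_n$ is the number of conjugacy classes of $G$ whose minimal-length elements have length $n$. The operator $\mathsf N$: for a power series $f$ with integer coefficients and zero constant term, \[\mathsf N(f)(z)=\sum_{k=1}^\infty\sum_{l=1}^\infty\frac{\phi(k)}{kl}\big(f(z^k)\big)^l,\] where $\phi$ is the Euler totient function. *)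

(* Defs.v *)
From HB Require Import structures.
From mathcomp Require Import all_boot all_order all_algebra finmap.
From mathcomp Require Import boolp classical_sets functions cardinality.

Set Implicit Arguments.
Unset Strict Implicit.
Unset Printing Implicit Defensive.

Import GRing.Theory.
Local Open Scope quotient_scope.
Local Open Scope classical_set_scope.

Section PowerSeries.
Local Open Scope ring_scope.

(* A record rather than an alias of [nat -> rat], so that [*] cannot be       *)
(* confused with the pointwise product of functions.                          *)
Record fps := Fps { coef_fps :> nat -> rat }.

HB.instance Definition _ := gen_eqMixin fps.
HB.instance Definition _ := gen_choiceMixin fps.

Implicit Types f g h : fps.

Lemma fpsP f g : f =1 g -> f = g.
Proof. by case: f => f; case: g => g /= /funext ->. Qed.

Definition fps0 := Fps (fun=> 0).
Definition fps1 := Fps (fun n => (n == 0%N)%:R).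
Definition fps_opp f := Fps (fun n => - f n).
Definition fps_add f g := Fps (fun n => f n + g n).
Definition fps_mul f g := Fps (fun n => \sum_(i < n.+1) f i * g (n - i)%N).

Lemma fps_addA : associative fps_add.
Proof. by move=> f g h; apply: fpsP => n /=; rewrite addrA. Qed.
Lemma fps_addC : commutative fps_add.
Proof. by move=> f g; apply: fpsP => n /=; rewrite addrC. Qed.
Lemma fps_add0 : left_id fps0 fps_add.
Proof. by move=> f; apply: fpsP => n /=; rewrite add0r. Qed.
Lemma fps_addN : left_inverse fps0 fps_opp fps_add.
Proof. by move=> f; apply: fpsP => n /=; rewrite addNr. Qed.

HB.instance Definition _ :=
  GRing.isZmodule.Build fps fps_addA fps_addC fps_add0 fps_addN.

Local Definition trunc N f : {poly rat} := \poly_(i < N) f i.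

Local Lemma truncM N f g n : (n < N)%N -> fps_mul f g n = (trunc N f * trunc N g)`_n.
Proof.
move=> nN; rewrite coefM; apply: eq_bigr => i _; rewrite !coef_poly.
by rewrite (leq_ltn_trans _ nN) ?(leq_ltn_trans _ nN) ?leq_subr // -ltnS.
Qed.

Lemma fps_mulC : commutative fps_mul.
Proof. by move=> f g; apply: fpsP => n; rewrite !(truncM _ _ (ltnSn n)) mulrC. Qed.

Lemma fps_mulA : associative fps_mul.
Proof.
move=> f g h; apply: fpsP => n.
have lt_in (i : 'I_n.+1) : (i < n.+1)%N by [].
have lt_ni (i : 'I_n.+1) : (n - i < n.+1)%N by rewrite ltnS leq_subr.
transitivity ((trunc n.+1 f * (trunc n.+1 g * trunc n.+1 h))`_n).
  rewrite coefM; apply: eq_bigr => i _.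
  by rewrite coef_poly lt_in (truncM _ _ (lt_ni i)).
rewrite mulrA coefM; apply: eq_bigr => i _.
by rewrite coef_poly lt_ni (truncM _ _ (lt_in i)).
Qed.

Lemma fps_mul1 : left_id fps1 fps_mul.
Proof.
move=> f; apply: fpsP => n /=; rewrite big_ord_recl /= subn0 mul1r.
by rewrite big1 ?addr0 // => i _; rewrite mul0r.
Qed.

Lemma fps_mulD : left_distributive fps_mul fps_add.
Proof.
move=> f g h; apply: fpsP => n /=; rewrite -big_split /=.
by apply: eq_bigr => i _; rewrite mulrDl.
Qed.

Lemma fps_1neq0 : fps1 != 0.
Proof.
apply/eqP => /(congr1 (fun f : fps => f 0%N)) /= /eqP.
by rewrite oner_eq0.
Qed.

HB.instance Definition _ := GRing.Zmodule_isComNzRing.Build fps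
  fps_mulA fps_mulC fps_mul1 fps_mulD fps_1neq0.

(* [fps_invs f n] lists the coefficients of index < n of the inverse of f.    *)
Fixpoint fps_invs f n : seq rat :=
  if n is m.+1 then
    let s := fps_invs f m in
    rcons s ((f 0%N)^-1 * ((m == 0%N)%:R - \sum_(i < m) s`_i * f (m - i)%N))
  else [::].

Definition fps_unit : pred fps := fun f => f 0%N != 0.
Definition fps_inv f :=
  if fps_unit f then Fps (fun n => (fps_invs f n.+1)`_n) else f.

Local Lemma size_fps_invs f n : size (fps_invs f n) = n.
Proof. by elim: n => //= n IHn; rewrite size_rcons IHn. Qed.

Local Lemma nth_fps_invs f n i : (i < n)%N -> (fps_invs f n)`_i = (fps_invs f i.+1)`_i.
Proof.
elim: n => // n IHn; rewrite ltnS leq_eqVlt => /predU1P[->//|lt_in].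
by rewrite [LHS]/= nth_rcons size_fps_invs lt_in IHn.
Qed.

Lemma fps_mulV : {in fps_unit, left_inverse 1 fps_inv *%R}.
Proof.
move=> f uf; have {}uf : fps_unit f by [].
have invE n : fps_inv f n = (fps_invs f n.+1)`_n by rewrite /fps_inv uf.
apply: fpsP => n.
transitivity (\sum_(i < n.+1) fps_inv f i * f (n - i)%N) => //.
rewrite big_ord_recr /= subnn invE /= nth_rcons size_fps_invs ltnn eqxx.
rewrite [X in _ + X]mulrAC mulVf // mul1r.
rewrite [X in X + _](_ : _ = \sum_(i < n) (fps_invs f n)`_i * f (n - i)%N).
  by rewrite addrC subrK.
by apply: eq_bigr => i _; rewrite invE -(nth_fps_invs f (ltn_ord i)).
Qed.

Lemma fps_unitP f g : g * f = 1 -> fps_unit f.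
Proof.
move=> /(congr1 (fun h : fps => h 0%N)) /=; rewrite big_ord1 /= => gf1.
by apply/eqP => f0; move: gf1 => /eqP; rewrite f0 mulr0 eq_sym oner_eq0.
Qed.

Lemma fps_inv_out : {in [predC fps_unit], fps_inv =1 id}.
Proof.
by move=> f uf; have {}uf : ~~ fps_unit f by []; rewrite /fps_inv (negPf uf).
Qed.

HB.instance Definition _ :=
  GRing.ComNzRing_hasMulInverse.Build fps fps_mulV fps_unitP fps_inv_out.

(* f(z^k) *)
Definition fps_subX k f := Fps (fun n => if (k %| n)%N then f (n %/ k)%N else 0).

(* The double series converges only when f has zero constant term; then     *)
(* f(z^k)^l is divisible by z^(k * l), so that only the pairs (k, l) with     *)
(* k, l <= n contribute to the n-th coefficient (see [fps_N_stable]).         *)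
Definition fps_N f := Fps (fun n =>
  \sum_(1 <= k < n.+1) \sum_(1 <= l < n.+1)
     (totient k)%:R / (k * l)%:R * (fps_subX k f ^+ l) n).

Lemma fps_exp_eq0 f k l n :
  (forall i, (i < k)%N -> f i = 0) -> (n < k * l)%N -> (f ^+ l) n = 0.
Proof.
move=> f0; elim: l n => [|l IHl] n; first by rewrite muln0.
rewrite exprS mulnS => ltn_kl.
transitivity (\sum_(i < n.+1) f i * (f ^+ l) (n - i)%N) => //.
rewrite big1 // => i _; have [/f0->|le_ki] := ltnP i k; first by rewrite mul0r.
have le_in : (i <= n)%N by rewrite -ltnS.
rewrite IHl ?mulr0 // -(ltn_add2l i) subnKC // (leq_trans ltn_kl) //.
by rewrite leq_add2r.
Qed.

Lemma fps_subX_eq0 f k i : f 0%N = 0 -> (i < k)%N -> fps_subX k f i = 0.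
Proof.
by move=> f0 lt_ik /=; case: ifP => // _; rewrite divn_small.
Qed.

Lemma fps_N_stable f n K L : f 0%N = 0 -> (n < K)%N -> (n < L)%N ->
  fps_N f n = \sum_(1 <= k < K) \sum_(1 <= l < L)
    (totient k)%:R / (k * l)%:R * (fps_subX k f ^+ l) n.
Proof.
move=> f0 nK nL.
have z k l : (0 < k)%N -> (0 < l)%N -> (n < k)%N || (n < l)%N ->
    (totient k)%:R / (k * l)%:R * (fps_subX k f ^+ l) n = 0 :> rat.
  move=> k0 l0 nkl; rewrite (@fps_exp_eq0 _ k) ?mulr0 // => [i|].
    exact: fps_subX_eq0.
  by case/orP: nkl => /leq_trans; apply; rewrite (leq_pmulr, leq_pmull).
rewrite [RHS](big_cat_nat (n := n.+1)) //= [X in _ + X]big_nat_cond.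
rewrite [X in _ + X]big1 ?addr0 => [|k /andP[/andP[nk _] _]].
  apply: eq_big_nat => k /andP[k0 _].
  rewrite [RHS](big_cat_nat (n := n.+1)) //= [X in _ + X]big_nat_cond.
  rewrite [X in _ + X]big1 ?addr0 // => l /andP[/andP[nl _] _].
  by rewrite z ?nl ?orbT // (leq_trans _ nl).
rewrite big_nat_cond big1 // => l /andP[/andP[l0 _] _].
by rewrite z ?nk // (leq_trans _ nk).
Qed.

End PowerSeries.

Section Groups.
Local Open Scope group_scope.
Variable G : groupType.
Implicit Types A H N : set G.

Definition subgroup H := H 1 /\ forall x y, H x -> H y -> H (x / y).

Definition normal_subgroup N :=
  subgroup N /\ forall x y, N x -> N (x ^ y).

Definition generated A : set G := smallest subgroup A.

Definition normal_closure A : set G := smallest normal_subgroup A.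

Lemma normal_closure_normal A : normal_subgroup (normal_closure A).
Proof.
split; first split=> [|x y Ax Ay].
- by move=> N [[[N1 _] _] _].
- move=> N AN; have [[[_ NF] _] _] := AN.
  by apply: NF; [apply: Ax|apply: Ay].
- by move=> x y Ax N AN; have [[_ NJ] _] := AN; apply: NJ; apply: Ax.
Qed.

Section Quotient.
Variable A : set G.
Local Notation N := (normal_closure A).

Definition quo_rel : rel G := fun x y => `[< N (x^-1 * y) >].

Lemma normal_closure1 : N 1.
Proof. by have [[]] := normal_closure_normal A. Qed.
Lemma normal_closureF x y : N x -> N y -> N (x / y).
Proof. by have [[_ nF] _] := normal_closure_normal A => Nx Ny; apply: nF. Qed.
Lemma normal_closureV x : N x -> N x^-1.
Proof.
by rewrite -div1g; apply: normal_closureF; apply: normal_closure1.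
Qed.
Lemma normal_closureM x y : N x -> N y -> N (x * y).
Proof.
move=> Nx Ny; rewrite -[y]invgK; apply: normal_closureF => //.
exact: normal_closureV.
Qed.
Lemma normal_closureJ x y : N x -> N (x ^ y).
Proof. by have [_ nJ] := normal_closure_normal A => Nx; apply: nJ. Qed.

Lemma quo_rel_refl : reflexive quo_rel.
Proof. by move=> x; apply/asboolP; rewrite mulVg; apply: normal_closure1. Qed.
Lemma quo_rel_sym : symmetric quo_rel.
Proof.
by move=> x y; apply/asboolP/asboolP => /normal_closureV; rewrite invgM invgK.
Qed.
Lemma quo_rel_trans : transitive quo_rel.
Proof.
move=> y x z /asboolP Nxy /asboolP Nyz; apply/asboolP.
by rewrite -(mulVKg y z) mulgA; apply: normal_closureM; rewrite // mulgA.
Qed.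

Canonical quo_equiv := EquivRel quo_rel quo_rel_refl quo_rel_sym quo_rel_trans.

(* The quotient of G by the normal closure of A *)
Definition quo := {eq_quot quo_rel}.
HB.instance Definition _ := Choice.on quo.
HB.instance Definition _ := EqQuotient.on quo.

Definition quo_pi (x : G) : quo := \pi_quo x.
Definition quo_one : quo := quo_pi 1.
Definition quo_mul (x y : quo) : quo := quo_pi (repr x * repr y).
Definition quo_inv (x : quo) : quo := quo_pi (repr x)^-1.

Lemma quo_piP x y : quo_pi x = quo_pi y <-> N (x^-1 * y).
Proof. by split=> [/eqmodP/asboolP|Nxy]; [|apply/eqmodP/asboolP]. Qed.

Let N_repr x : N ((repr (quo_pi x))^-1 * x).
Proof. by apply/quo_piP; rewrite /quo_pi reprK. Qed.

Lemma quo_piM x y : quo_pi (x * y) = quo_mul (quo_pi x) (quo_pi y).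
Proof.
apply/esym/quo_piP; set a := repr _; set b := repr _.
rewrite (_ : _ * _ = (a^-1 * x) ^ b * (b^-1 * y)); last first.
  by rewrite conjgE invgM !mulgA mulgK.
by apply: normal_closureM; [apply: normal_closureJ|]; apply: N_repr.
Qed.

Lemma quo_piV x : quo_pi x^-1 = quo_inv (quo_pi x).
Proof.
apply/quo_piP; rewrite invgK; set a := repr _.
rewrite (_ : _ * _ = (a^-1 * x) ^ a^-1); last first.
  by rewrite conjgE invgK !mulgA mulgV mul1g.
by apply: normal_closureJ; apply: N_repr.
Qed.

Let piK (x : quo) : quo_pi (repr x) = x. Proof. exact: reprK. Qed.

Lemma quo_mulA : associative quo_mul.
Proof.
move=> x y z; rewrite -(piK x) -(piK y) -(piK z).
by rewrite -!quo_piM mulgA.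
Qed.
Lemma quo_mul1 : left_id quo_one quo_mul.
Proof. by move=> x; rewrite -(piK x) -quo_piM mul1g. Qed.
Lemma quo_mulr1 : right_id quo_one quo_mul.
Proof. by move=> x; rewrite -(piK x) -quo_piM mulg1. Qed.
Lemma quo_mulV : left_inverse quo_one quo_inv quo_mul.
Proof. by move=> x; rewrite -(piK x) -quo_piV -quo_piM mulVg. Qed.
Lemma quo_mulrV : right_inverse quo_one quo_inv quo_mul.
Proof. by move=> x; rewrite -(piK x) -quo_piV -quo_piM mulgV. Qed.

HB.instance Definition _ := isGroup.Build quo
  quo_mulA quo_mul1 quo_mulr1 quo_mulV quo_mulrV.

Lemma quo_pi_morphism : monoid.monoid_morphism quo_pi.
Proof. by split=> // x y; apply: quo_piM. Qed.

HB.instance Definition _ := isUMagmaMorphism.Build G quo quo_pi quo_pi_morphism.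

End Quotient.
End Groups.

(* Words in the disjoint union of the groups, modulo the congruence generated *)
(* by deleting trivial letters and by multiplying consecutive letters of the  *)
(* same group.                                                                *)
Section FreeProduct.
Local Open Scope group_scope.
Variables (V : finType) (G : V -> groupType).

Definition fp_letter : Type := {v : V & G v}.
HB.instance Definition _ := Choice.on fp_letter.

Definition to_letter v (g : G v) : fp_letter := existT (fun u => G u) v g.

Inductive fp_eq : seq fp_letter -> seq fp_letter -> Prop :=
| fp_eq_refl s : fp_eq s s
| fp_eq_sym s t : fp_eq s t -> fp_eq t s
| fp_eq_trans s t u : fp_eq s t -> fp_eq t u -> fp_eq s u
| fp_eq_cat s1 t1 s2 t2 :
    fp_eq s1 t1 -> fp_eq s2 t2 -> fp_eq (s1 ++ s2) (t1 ++ t2)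
| fp_eq_one v : fp_eq [:: to_letter (1 : G v)] [::]
| fp_eq_mul v (g h : G v) :
    fp_eq [:: to_letter g; to_letter h] [:: to_letter (g * h)].

Definition fp_rel : rel (seq fp_letter) := fun s t => `[< fp_eq s t >].

Lemma fp_rel_refl : reflexive fp_rel.
Proof. by move=> s; apply/asboolP; apply: fp_eq_refl. Qed.
Lemma fp_rel_sym : symmetric fp_rel.
Proof. by move=> s t; apply/asboolP/asboolP; apply: fp_eq_sym. Qed.
Lemma fp_rel_trans : transitive fp_rel.
Proof.
move=> t s u /asboolP st /asboolP tu; apply/asboolP.
exact: fp_eq_trans st tu.
Qed.

Canonical fp_equiv := EquivRel fp_rel fp_rel_refl fp_rel_sym fp_rel_trans.

Definition free_product := {eq_quot fp_rel}.
HB.instance Definition _ := Choice.on free_product.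
HB.instance Definition _ := EqQuotient.on free_product.

Definition letter_inv (l : fp_letter) : fp_letter := to_letter (tagged l)^-1.
Definition word_inv (s : seq fp_letter) := rev (map letter_inv s).

Definition fp_pi (s : seq fp_letter) : free_product := \pi_free_product s.
Definition fp_one : free_product := fp_pi [::].
Definition fp_mul (x y : free_product) : free_product :=
  fp_pi (repr x ++ repr y).
Definition fp_inv (x : free_product) : free_product :=
  fp_pi (word_inv (repr x)).

Lemma fp_piP s t : fp_pi s = fp_pi t <-> fp_eq s t.
Proof. by split=> [/eqmodP/asboolP|st]; [|apply/eqmodP/asboolP]. Qed.

Let fp_repr s : fp_eq (repr (fp_pi s)) s.
Proof. by apply/fp_piP; rewrite /fp_pi reprK. Qed.

Lemma fp_pi_cat s t : fp_pi (s ++ t) = fp_mul (fp_pi s) (fp_pi t).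
Proof. by apply/esym/fp_piP/fp_eq_cat; apply: fp_repr. Qed.

Let piK (x : free_product) : fp_pi (repr x) = x. Proof. exact: reprK. Qed.

Lemma fp_mulA : associative fp_mul.
Proof.
move=> x y z; rewrite -(piK x) -(piK y) -(piK z).
by rewrite -!fp_pi_cat catA.
Qed.
Lemma fp_mul1 : left_id fp_one fp_mul.
Proof. by move=> x; rewrite -(piK x) -fp_pi_cat. Qed.
Lemma fp_mulr1 : right_id fp_one fp_mul.
Proof. by move=> x; rewrite -(piK x) -fp_pi_cat cats0. Qed.

Let fp_letter_mul v (g h : G v) : g * h = 1 ->
  fp_mul (fp_pi [:: to_letter g]) (fp_pi [:: to_letter h]) = fp_one.
Proof.
move=> gh1; rewrite -fp_pi_cat; apply/fp_piP.
by apply: fp_eq_trans (fp_eq_mul g h) _; rewrite gh1; apply: fp_eq_one.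
Qed.

Let word_inv_cons l s : word_inv (l :: s) = word_inv s ++ [:: letter_inv l].
Proof. by rewrite /word_inv /= rev_cons cats1. Qed.

Lemma fp_mulV : left_inverse fp_one fp_inv fp_mul.
Proof.
move=> x; rewrite -{2}(piK x) -fp_pi_cat.
elim: (repr x) => [//|[v g] s IHs]; rewrite word_inv_cons -[_ :: s]cat1s catA.
rewrite !fp_pi_cat -[X in fp_mul X _]fp_mulA.
rewrite [X in fp_mul (fp_mul _ X) _](fp_letter_mul (mulVg g)).
by rewrite fp_mulr1 -fp_pi_cat.
Qed.

Lemma fp_mulrV : right_inverse fp_one fp_inv fp_mul.
Proof.
move=> x; rewrite -{1}(piK x) -fp_pi_cat.
elim: (repr x) => [//|[v g] s IHs]; rewrite word_inv_cons -[_ :: s]cat1s -catA.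
rewrite !fp_pi_cat [X in fp_mul _ X]fp_mulA -fp_pi_cat IHs fp_mul1.
exact: fp_letter_mul (mulgV g).
Qed.

HB.instance Definition _ := isGroup.Build free_product
  fp_mulA fp_mul1 fp_mulr1 fp_mulV fp_mulrV.

Definition fp_inj v (g : G v) : free_product := fp_pi [:: to_letter g].

Lemma fp_inj_morphism v : monoid.monoid_morphism (@fp_inj v).
Proof.
split=> [|g h]; first exact/fp_piP/fp_eq_one.
by apply/esym; rewrite -[LHS]fp_pi_cat; apply/fp_piP/fp_eq_mul.
Qed.

HB.instance Definition _ v :=
  isUMagmaMorphism.Build (G v) free_product (@fp_inj v) (fp_inj_morphism v).

End FreeProduct.

(* The graph is given by its adjacency relation e; statements about it should *)
(* assume e symmetric and irreflexive.                                        *)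
Section GraphProduct.
Local Open Scope group_scope.
Variables (V : finType) (e : rel V) (G : V -> groupType).

Definition gp_relators : set (free_product G) :=
  [set c | exists v w (g : G v) (h : G w), e v w /\ c = [~ fp_inj g, fp_inj h]].

Definition graph_product := quo gp_relators.
HB.instance Definition _ := Group.on graph_product.

Definition gp_inj v (g : G v) : graph_product := quo_pi gp_relators (fp_inj g).

Definition subgraph_product (S : {set V}) : set graph_product :=
  generated (\bigcup_(v in [set` S]) range (@gp_inj v)).

Definition gp_gens (X : forall v, set (G v)) (S : {set V}) : set graph_product :=
  \bigcup_(v in [set` S]) (@gp_inj v @` X v).

Definition link1 (v : V) : {set V} := [set w | e v w]%SET.

(* The empty intersection is the whole of V. *)
Definition link (S : {set V}) : {set V} := (\bigcap_(w in S) link1 w)%SET.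

End GraphProduct.

Arguments subgraph_product {V} e G S%_SET _.
Arguments gp_gens {V} e {G} X S%_SET _.

(* H is meant to be a subgroup of G generated by X, so that lengths are taken *)
(* over X and conjugation is by elements of H. [fset_set] is empty on infinite *)
(* sets; for a finite X the sets counted below are finite.                    *)
Section Growth.
Variables (G : groupType) (H X : set G).

Definition word_for (w : seq G) (g : G) :=
  {in w, forall x, X x} /\ (\prod_(x <- w) x)%g = g.

Definition has_length (g : G) (n : nat) :=
  (exists2 w, word_for w g & size w = n) /\
  (forall w, word_for w g -> (n <= size w)%N).

Definition conj_class (g : G) : set G := [set (g ^ y)%g | y in H].

Definition conj_classes : set (set G) := conj_class @` H.

Definition has_class_length (C : set G) (n : nat) :=
  (exists2 g, C g & has_length g n) /\
  (forall g m, C g -> has_length g m -> (n <= m)%N).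

Definition growth_series : fps := Fps (fun n =>
  #|` fset_set [set g | H g /\ has_length g n]|%:R%R).

Definition conj_growth_series : fps := Fps (fun n =>
  #|` fset_set [set C | conj_classes C /\ has_class_length C n]|%:R%R).

End Growth.

Section GraphProductGrowth.
Variables (V : finType) (e : rel V) (G : V -> groupType).
Variable X : forall v, set (G v).

Definition gp_growth (S : {set V}) : fps :=
  growth_series (subgraph_product e G S) (gp_gens e X S).

Definition gp_conj_growth (S : {set V}) : fps :=
  conj_growth_series (subgraph_product e G S) (gp_gens e X S).

Definition gp_conj_growthM (S : {set V}) : fps :=
  (\sum_(S' : {set V} | S' \subset S)
     (-1) ^+ (#|S| - #|S'|)%N * gp_conj_growth S')%R.

End GraphProductGrowth.

(* Main.v *)
(* For a vertex v let B be its factor, A the subgroup on the other vertices,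
   and L the subgroup on Lk v, so that the group is the amalgam of A and L x B
   over L. Killing factors gives retractions onto the subgraph products, which
   do not increase lengths; hence conjugacy in a subgraph product is the
   restriction of conjugacy in the whole group, minimal lengths agree, and each
   class has a least support.

   The length of an element is the sum of the lengths of its syllables, each
   vertex u contributing those of the amalgam normal form for u. Hence a coset
   x G_S has a shortest element t, with |t l| = |t| + |l| for l in G_S, and the
   quotient of two growth series in the formula counts such elements.

   A conjugacy class meets A, or contains l b with l in L and b in B - 1, or
   contains t_1 b_1 ... t_n b_n l with n > 0, l in L, b_i in B - 1 and t_i <> 1
   shortest in t_i L. In the last case, conjugating by l deletes syllables of l
   until those left commute with every t_i, so that, S being the support of the
   class of l, all t_i lie in G_(Lk S). Up to rotation of the word
   (t_1,b_1) ... (t_n,b_n) and conjugation of l, this form is unique: a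
   conjugating element maps the ray (t_1 b_1 ... t_n b_n)^oo to the other one up
   to finite prefixes. Its length is minimal by comparison of translation
   lengths. By Burnside's counting, N enumerates words up to rotation. *)

From HB Require Import structures.
Require Import Defs.
From mathcomp Require Import all_boot all_order all_algebra finmap.
From mathcomp Require Import boolp classical_sets functions cardinality.
From mathcomp Require Import zify.

Set Implicit Arguments.
Unset Strict Implicit.
Unset Printing Implicit Defensive.

(** * Generating series of weighted sets *)

(** The group is given only as a quotient, so every computation in it comes from letting it act.
    Acting on itself with some letters suppressed, it yields the retractions [proj S]; acting on
    lists of pairs (coset, syllable), it yields [syll u]. Reducedness and syllable counts are then
    invariants of elements rather than of words, and shuffling and merging are controlled by
    counting.

    The infinite ray is replaced by a high power of one period: [absorb] rewrites an arbitrary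
    element times that power as an alternating product times an element commuting with the period,
    after which [conj_peel] compares first pairs.

    The letters that may stand beside [l] depend on the least support of its class, so the classes
    of [l] have to be sorted by exact support; the alternating sums over subsets are the Moebius
    inversion that does this. For a given S the letters live in the subgroup on Lk S, which is
    disjoint from S, so that retracting onto both sides at once bounds the length of a conjugate
    from below. *)

Section Counting.
Local Open Scope classical_set_scope.

Definition cnt (T : choiceType) (A : set T) : nat := #|` fset_set A|.

Lemma cnt_bij (T U : choiceType) (f : T -> U) (A : set T) (B : set U) :
  finite_set A -> (forall x, A x -> B (f x)) ->
  (forall x y, A x -> A y -> f x = f y -> x = y) ->
  (forall y, B y -> exists2 x, A x & f x = y) -> cnt A = cnt B.
Proof.
move=> finA fAB f_inj fB; have -> : B = f @` A.
  by apply/seteqP; split=> [y /fB[x Ax <-]|_ [x Ax <-]]; [exists x | apply: fAB].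
rewrite /cnt fset_set_image // card_in_imfset //= => x y.
by rewrite !in_fset_set // !inE; apply: f_inj.
Qed.

Lemma cnt_cond (T : choiceType) (A : set T) (P : pred T) : finite_set A ->
  cnt [set x | A x /\ P x] = \sum_(x <- fset_set A | P x) 1.
Proof.
move=> finA; rewrite /cnt (_ : fset_set _ = [fset x in fset_set A | P x]%fset).
  by rewrite card_fset_sum1 big_fset.
apply/fsetP => x; rewrite in_fset_set; last by apply: sub_finite_set finA => y [].
rewrite !inE in_fset_set //; apply/idP/andP => [/set_mem[Ax Px]|[Ax Px]].
  by rewrite mem_set.
by apply/mem_set; split=> //; apply: set_mem.
Qed.

Lemma cnt_fibers (T : choiceType) (J : finType) (h : T -> J) (A : set T) :
  finite_set A -> cnt A = \sum_(j : J) cnt [set x | A x /\ h x = j].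
Proof.
move=> finA; rewrite {1}/cnt card_fset_sum1 (partition_big h predT) //=.
apply: eq_bigr => j _; rewrite -cnt_cond //; congr (cnt _).
by apply/seteqP; split=> x /= [Ax /eqP].
Qed.

Lemma cnt_setX (T U : choiceType) (A : set T) (B : set U) :
  finite_set A -> finite_set B -> cnt (A `*` B) = (cnt A * cnt B)%N.
Proof.
move=> finA finB; rewrite /cnt fset_setX // !card_fset_sum1 big_imfset2 /=; last by move=> [x y] [x' y'] _ _ [-> ->].
by rewrite big_distrl /=; apply: eq_bigr => x _; rewrite mul1n.
Qed.

Lemma cnt0 (T : choiceType) : cnt (set0 : set T) = 0%N.
Proof. by rewrite /cnt fset_set0 cardfs0. Qed.

Lemma cnt1 (T : choiceType) (x : T) : cnt [set x] = 1%N.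
Proof. by rewrite /cnt fset_set1 cardfs1. Qed.

End Counting.

Section GeneratingSeries.
Local Open Scope classical_set_scope.
Local Open Scope ring_scope.
Import GRing.Theory.

Definition level (T : choiceType) (A : set T) (wt : T -> nat) n : set T :=
  [set x | A x /\ wt x = n].

Definition gseries (T : choiceType) (A : set T) (wt : T -> nat) : fps :=
  Fps (fun n => (cnt (level A wt n))%:R).

Definition locally_finite (T : choiceType) (A : set T) (wt : T -> nat) :=
  forall n, finite_set (level A wt n).

Lemma locally_finite_sub (T : choiceType) (A B : set T) wt :
  A `<=` B -> locally_finite B wt -> locally_finite A wt.
Proof. by move=> AB finB n; apply: sub_finite_set (finB n) => x [/AB]. Qed.

Lemma gseries_bij (T U : choiceType) (f : T -> U) (A : set T) (B : set U) wt wt' :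
  locally_finite A wt -> (forall x, A x -> B (f x)) ->
  (forall x, A x -> wt' (f x) = wt x) ->
  (forall x y, A x -> A y -> f x = f y -> x = y) ->
  (forall y, B y -> exists2 x, A x & f x = y) -> gseries A wt = gseries B wt'.
Proof.
move=> finA fAB fwt f_inj fB; apply: fpsP => n /=; congr _%:R.
apply: (cnt_bij (f := f)) => //.
- by move=> x [Ax <-]; split; [apply: fAB | apply: fwt].
- by move=> x y [Ax _] [Ay _]; apply: f_inj.
move=> y [/fB[x Ax <-]]; rewrite fwt // => wx.
by exists x.
Qed.

Lemma coef_sum (I : Type) (r : seq I) (P : pred I) (F : I -> fps) n :
  (\sum_(i <- r | P i) F i) n = \sum_(i <- r | P i) F i n.
Proof. exact: (big_morph (fun f : fps => f n) (fun f g => erefl) erefl). Qed.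

Lemma gseries_fibers (T : choiceType) (J : finType) (h : T -> J) (A : set T) wt :
  locally_finite A wt ->
  gseries A wt = \sum_(j : J) gseries [set x | A x /\ h x = j] wt.
Proof.
move=> finA; apply: fpsP => n.
rewrite coef_sum /= (cnt_fibers h (finA n)) natr_sum; apply: eq_bigr => j _.
congr (cnt _)%:R; apply/seteqP; split=> x /= -[[Ax hx] wx] //.
Qed.

Lemma gseries_setX (T U : choiceType) (A : set T) (B : set U) wt wt' :
  locally_finite A wt -> locally_finite B wt' ->
  gseries (A `*` B) (fun p => wt p.1 + wt' p.2)%N = gseries A wt * gseries B wt'.
Proof.
move=> finA finB; apply: fpsP => n.
(* Level [n] of the product splits according to [wt p.1], which is at most [n] and hence survives
   [inord] into ['I_n.+1]. *)
have E i : [set p | level (A `*` B) (fun p => wt p.1 + wt' p.2)%N n p /\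
    inord (wt p.1) = i :> 'I_n.+1] = level A wt i `*` level B wt' (n - i)%N.
  apply/seteqP; split=> -[x y] /=.
    case=> -[[Ax By] wxy] <-; rewrite inordK ?ltnS -?wxy ?leq_addr //.
    by rewrite addKn.
  case=> -[Ax wx] [By wy]; split; first split=> //.
    by rewrite wx wy subnKC // -ltnS.
  by rewrite wx inord_val.
have fin : finite_set (level (A `*` B) (fun p => wt p.1 + wt' p.2)%N n).
  have : finite_set (\bigcup_(i in `I_n.+1) (level A wt i `*` level B wt' (n - i)%N)).
    by apply: bigcup_finite => // i _; apply: finite_setX.
  apply: sub_finite_set => -[x y] [[/= Ax By] wxy]; exists (wt x).
    by rewrite /= ltnS -wxy leq_addr.
  by split=> //; split=> //=; rewrite -wxy addKn.
rewrite /= (cnt_fibers (fun p => inord (wt p.1) : 'I_n.+1) fin) natr_sum.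
by apply: eq_bigr => i _; rewrite E cnt_setX // natrM.
Qed.

Lemma locally_finite_setX (T U : choiceType) (A : set T) (B : set U) wt wt' :
  locally_finite A wt -> locally_finite B wt' ->
  locally_finite (A `*` B) (fun p => wt p.1 + wt' p.2)%N.
Proof.
move=> finA finB n.
have : finite_set (\bigcup_(i in `I_n.+1) (level A wt i `*` level B wt' (n - i)%N)).
  by apply: bigcup_finite => // i _; apply: finite_setX.
apply: sub_finite_set => -[x y] [[/= Ax By] wxy]; exists (wt x).
  by rewrite /= ltnS -wxy leq_addr.
by split=> //; split=> //=; rewrite -wxy addKn.
Qed.

Lemma gseries0 (T : choiceType) wt : gseries (set0 : set T) wt = 0.
Proof.
apply: fpsP => n /=; rewrite (_ : level _ _ _ = set0) ?cnt0 //.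
by apply/seteqP; split=> x // [].
Qed.

Lemma gseries1 (T : choiceType) (x : T) wt : wt x = 0%N -> gseries [set x] wt = 1.
Proof.
move=> wx; apply: fpsP => n /=; have [->|n0] := eqVneq n 0%N.
  rewrite (_ : level _ _ _ = [set x]) ?cnt1 //.
  by apply/seteqP; split=> y /=; [case=> -> | move=> ->].
rewrite (_ : level _ _ _ = set0) ?cnt0 //; apply/seteqP; split=> y //= [-> wn].
by rewrite -wn wx in n0.
Qed.

Lemma gseries_cond (T : choiceType) (P : T -> bool) (A : set T) wt :
  locally_finite A wt ->
  gseries A wt = gseries [set x | A x /\ P x] wt + gseries [set x | A x /\ ~~ P x] wt.
Proof.
move=> finA; rewrite (gseries_fibers P finA) (bigD1 true) //= (big_pred1 false).
  congr (gseries _ _ + gseries _ _); apply/seteqP; split=> x /= [Ax];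
  by [move=> -> | case: (P x) | move=> /negPf->].
by case.
Qed.

Lemma gseries_setU (T : choiceType) (A B : set T) wt : (forall x, A x -> ~ B x) ->
  locally_finite (A `|` B) wt ->
  gseries (A `|` B) wt = gseries A wt + gseries B wt.
Proof.
move=> AB fin; rewrite (gseries_cond (fun x => `[< A x >]) fin).
congr (_ + _); congr (gseries _ _); apply/seteqP; split=> x /=.
- by case=> _ /asboolP.
- by move=> Ax; split; [left | apply/asboolP].
- by case=> -[] // Ax /asboolP.
by move=> Bx; split; [right | apply/asboolP => /AB].
Qed.

Lemma gseries_setD1 (T : choiceType) (A : set T) (x : T) wt : A x -> wt x = 0%N ->
  locally_finite A wt -> gseries (A `\ x) wt = gseries A wt - 1.
Proof.
move=> Ax wx finA; rewrite -(gseries1 wx).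
have AE : A = [set x] `|` (A `\ x).
  apply/seteqP; split=> y /=; last by case=> [->|[]].
  by move=> Ay; have [->|/eqP] := eqVneq y x; [left | right].
rewrite [in RHS]AE gseries_setU ?(addrC (gseries [set x] wt)) ?addrK //.
- by move=> y -> [_]; apply.
- by rewrite -AE.
Qed.

Lemma gseries_bigcup (T : choiceType) (I : finType) (P : pred I) (F : I -> set T) wt :
  (forall i j x, P i -> P j -> F i x -> F j x -> i = j) ->
  locally_finite (\bigcup_(i in [set i | P i]) F i) wt ->
  gseries (\bigcup_(i in [set i | P i]) F i) wt = \sum_(i | P i) gseries (F i) wt.
Proof.
move=> dis; have H (r : seq I) : uniq r ->
    locally_finite [set x | exists2 i, i \in r & P i /\ F i x] wt ->
    gseries [set x | exists2 i, i \in r & P i /\ F i x] wt =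
    \sum_(i <- r | P i) gseries (F i) wt.
  elim: r => [_ _|i r IHr /= /andP[ir ur]].
    rewrite big_nil (_ : mkset _ = set0) ?gseries0 //.
    by apply/seteqP; split=> x // [].
  set R := [set x | exists2 j, j \in r & P j /\ F j x] in IHr.
  rewrite big_cons; case: ifP => Pi.
    have -> : [set x | exists2 j, j \in i :: r & P j /\ F j x] = F i `|` R.
      apply/seteqP; split=> x /=.
        by case=> j; rewrite inE => /predU1P[->|jr] [Pj Fj]; [left | right; exists j].
      case=> [Fi|[j jr Fj]]; first by exists i; rewrite ?mem_head.
      by exists j; rewrite // inE jr orbT.
    move=> fin; rewrite gseries_setU // ?IHr //.
      by apply: locally_finite_sub fin => x; right.
    by move=> x Fi [j jr [Pj Fj]]; rewrite (dis i j x) ?jr in ir.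
  have -> : [set x | exists2 j, j \in i :: r & P j /\ F j x] = R.
    apply/seteqP; split=> x /=.
      by case=> j; rewrite inE => /predU1P[->|jr] [Pj Fj]; [rewrite Pi in Pj | exists j].
    by case=> j jr Fj; exists j; rewrite // inE jr orbT.
  exact: IHr.
have E : \bigcup_(i in [set i | P i]) F i =
    [set x | exists2 i, i \in index_enum I & P i /\ F i x].
  apply/seteqP; split=> x; last by case=> i _ [Pi Fi]; exists i.
  by case=> i Pi Fi; exists i; rewrite ?mem_index_enum.
by rewrite E => fin; rewrite H // index_enum_uniq.
Qed.

End GeneratingSeries.

(** * Words up to rotation *)

Section Rotations.
Variable T : choiceType.
Implicit Types s : seq T.

Lemma nth_rot x0 s i j : j <= size s -> i < size s ->
  nth x0 (rot j s) i = nth x0 s ((i + j) %% size s).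
Proof.
move=> le_j lt_i; rewrite /rot nth_cat size_drop; case: ltnP => [lt_ij|le_ji].
  by rewrite nth_drop modn_small addnC // -ltn_subRL.
have ij : (i + j) %% size s = i + j - size s.
  have le1 : size s <= i + j by lia.
  by rewrite -{1}(subnK le1) modnDr modn_small //; lia.
rewrite ij nth_take; last by lia.
by congr nth; lia.
Qed.

(** The sum is taken modulo the length, so rotation is an action of the cyclic group; [burnside_rot]
    reindexes by translations of that group. *)
Lemma rot_ordD p s (a b : 'I_p.+1) : size s = p.+1 ->
  rot (a + b)%R s = rot b (rot a s).
Proof.
move=> sz; rewrite rot_add_mod ?sz; [|exact: ltnW|exact: ltnW].
rewrite /= addnC; case: ltngtP => [lt|gt|E]; last first.
- by rewrite E modnn rot0 -sz rot_size.
- have E : b + a = (b + a - p.+1) + p.+1 by lia.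
  by rewrite E modnDr addnK modn_small //; have := ltn_ord a; have := ltn_ord b; lia.
by rewrite modn_small.
Qed.

Lemma nth_flatten_nseq x0 q s i : i < q * size s ->
  nth x0 (flatten (nseq q s)) i = nth x0 s (i %% size s).
Proof.
elim: q i => [|q IHq] i; first by rewrite mul0n.
rewrite mulSn /= nth_cat => lt_i; case: ltnP => [lt|le]; first by rewrite modn_small.
rewrite IHq; first by rewrite -{2}(subnK le) modnDr.
by rewrite ltn_subLR.
Qed.

(** Read cyclically, the letters have period [j], hence, by a Bezout relation, period gcd of [j] and
    the length. *)
Lemma rot_fixP s j : j < size s -> rot j s = s ->
  s = flatten (nseq (size s %/ gcdn j (size s)) (take (gcdn j (size s)) s)).
Proof.
set m := size s; set d := gcdn j m => ltjm rj.
have m0 : 0 < m by apply: leq_ltn_trans ltjm.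
have d0 : 0 < d by rewrite gcdn_gt0 m0 orbT.
have dm : d %| m := dvdn_gcdr _ _.
have ledm : d <= m by apply: dvdn_leq.
have st : size (take d s) = d by rewrite size_takel.
have qd : m %/ d * d = m by apply: divnK.
case: s @m @d ltjm rj m0 d0 dm ledm st qd => // x0 s'; set s := x0 :: s'.
move=> m d ltjm rj m0 d0 dm ledm st qd.
have step i : i < m -> nth x0 s ((i + j) %% m) = nth x0 s i.
  by move=> lti; rewrite -nth_rot ?rj // ltnW.
have stepk k i : i < m -> nth x0 s ((i + k * j) %% m) = nth x0 s i.
  elim: k => [|k IHk] lti; first by rewrite mul0n addn0 modn_small.
  by rewrite mulSnr addnA -modnDml step ?ltn_mod // IHk.
have stepd i : i < m -> nth x0 s ((i + d) %% m) = nth x0 s i.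
  move=> lti; have [j0|j0] := posnP j.
    by rewrite /d j0 gcd0n modnDr modn_small.
  case: (egcdnP m j0) => k k' E _.
  by rewrite -[RHS](stepk k) // E -/d addnCA modnMDl.
have perk k r : k * d + r < m -> nth x0 s (k * d + r) = nth x0 s r.
  elim: k => [|k IHk] lt; first by rewrite mul0n.
  have ltk : k * d + r < m by apply: leq_ltn_trans lt; rewrite leq_add2r leq_mul2r leqnSn orbT.
  have E : k.+1 * d + r = k * d + r + d by rewrite mulSnr addnAC.
  by rewrite -IHk // -(stepd (k * d + r)) // -E modn_small.
have per i : i < m -> nth x0 s i = nth x0 s (i %% d).
  by move=> lti; rewrite {1}(divn_eq i d) perk // -divn_eq.
apply: (@eq_from_nth _ x0).
  by rewrite size_flatten /shape map_nseq sumn_nseq st mulnC qd.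
move=> i lti; rewrite per // nth_flatten_nseq st ?qd // nth_take ?ltn_mod //.
Qed.

Lemma rot_fix s j q : s != [::] -> size s %| j -> j < q * size s ->
  rot j (flatten (nseq q s)) = flatten (nseq q s).
Proof.
case: s => // x0 s' _; set s := x0 :: s' => dj ltj.
have sz : size (flatten (nseq q s)) = q * size s.
  by rewrite size_flatten /shape map_nseq sumn_nseq mulnC.
apply: (@eq_from_nth _ x0); rewrite size_rot // sz => i lti.
rewrite nth_rot sz //; last exact: ltnW.
rewrite !nth_flatten_nseq // ?ltn_mod ?(leq_ltn_trans _ ltj) //.
by rewrite modn_dvdm ?dvdn_mull // -modnDmr (eqP dj) addn0.
Qed.

Local Open Scope classical_set_scope.

Definition rotations s : set (seq T) := [set s' | exists i, s' = rot i s].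

Lemma rotations_refl s : rotations s s.
Proof. by exists 0; rewrite rot0. Qed.

Lemma rotations_rot i s : rotations (rot i s) = rotations s.
Proof.
apply/seteqP; split=> [_ [j ->]|_ [j ->]].
  by exists (rot_add s i j); rewrite rot_rot_add.
exists (rot_add (rot i s) (size s - i) j); rewrite -rot_rot_add.
by congr rot; rewrite -{1}(rotK i s) /rotr size_rot.
Qed.

Lemma rotations_ord p s s' : size s = p.+1 -> rotations s s' ->
  exists i : 'I_p.+1, s' = rot i s.
Proof.
move=> sz [i ->]; have [lti|lei] := ltnP i p.+1; first by exists (Ordinal lti).
by exists ord0; rewrite rot0 rot_oversize // sz.
Qed.

(* Double counting the pairs (j, s) with s fixed by the rotation by j: a class *)
(* of rotations accounts for as many pairs as there are rotations.            *)
Lemma burnside_rot p (W : set (seq T)) : finite_set W ->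
  (forall s, W s -> size s = p.+1) -> (forall i s, W s -> W (rot i s)) ->
  (p.+1 * cnt (rotations @` W) =
   \sum_(j < p.+1) cnt [set s | W s /\ rot j s == s])%N.
Proof.
move=> finW szW rotW; have inW s : (s \in fset_set W) = (s \in W) by rewrite in_fset_set.
under eq_bigr => j _ do rewrite (cnt_cond (fun s => rot j s == s) finW).
rewrite (exchange_big_dep predT) //= (partition_big_imfset _ rotations) /=.
rewrite /cnt fset_set_image // card_fset_sum1 big_distrr /=.
rewrite big_seq [RHS]big_seq; apply: eq_bigr => c /imfsetP[s0 /= Ws0 cE].
rewrite muln1 -[LHS]card_ord -sum1_card.
have {}Ws0 : W s0 by apply: set_mem; rewrite -inW.
(* Each index [i] accounts for the single word [rot i s0], so that [p.+1] becomes a sum over the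
   words of the class. *)
transitivity (\sum_(i < p.+1) \sum_(s <- fset_set W | s == rot i s0) 1)%N.
  apply: eq_bigr => i _; rewrite sum1_count count_uniq_mem ?fset_uniq // inW.
  by rewrite mem_set //; apply: rotW.
rewrite (exchange_big_dep predT) //= [RHS]big_mkcond /=.
rewrite big_seq [RHS]big_seq; apply: eq_bigr => s; rewrite inW => /set_mem Ws.
case: eqP => [sc|nsc]; last first.
  apply: big1 => i /eqP sE; case: nsc; rewrite cE sE; exact: rotations_rot.
have [i0 sE] : exists i : 'I_p.+1, s = rot i s0.
  by apply: rotations_ord (szW _ Ws0) _; rewrite -cE -sc; apply: rotations_refl.
(* Translating by [i0] turns the indices that carry [s0] to [s] into the rotations that fix [s]. *)
rewrite (reindex_inj (GRing.addrI i0)) /=; apply: eq_bigl => j.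
by rewrite (rot_ordD _ _ (szW _ Ws0)) -sE eq_sym.
Qed.

End Rotations.

(** * Counting necklaces: the operator N *)

Section Necklaces.
Local Open Scope classical_set_scope.
Local Open Scope ring_scope.
Import GRing.Theory Order.TTheory Num.Theory.
Variable T : choiceType.
Implicit Types (s : seq T) (Y : set T) (wt : T -> nat).

Definition words Y l : set (seq T) := [set s | size s = l /\ {in s, forall x, Y x}].

Definition seq_weight wt s : nat := (\sum_(x <- s) wt x)%N.

Lemma words_gseries Y wt l : locally_finite Y wt ->
  locally_finite (words Y l) (seq_weight wt) /\
  gseries (words Y l) (seq_weight wt) = gseries Y wt ^+ l.
Proof.
move=> finY; elim: l => [|l [finl IHl]].
  have w0 : words Y 0 = [set [::]].
    by apply/seteqP; split=> [s [/size0nil]|_ ->].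
  split; last by rewrite w0 gseries1 // /seq_weight big_nil.
  by move=> n; rewrite w0; apply: (@sub_finite_set _ _ [set [::]]) => // s [].
have cons_weight x s : seq_weight wt (x :: s) = (wt x + seq_weight wt s)%N.
  by rewrite /seq_weight big_cons.
have surj s : words Y l.+1 s -> exists2 p, (Y `*` words Y l) p & p.1 :: p.2 = s.
  case: s => [|x s] [//= [sz] inY]; exists (x, s) => //; split=> /=.
    by apply: inY; rewrite inE eqxx.
  by split=> // y ys; apply: inY; rewrite inE ys orbT.
have finX := locally_finite_setX finY finl; split.
  move=> n; have := finite_image (fun p : T * seq T => p.1 :: p.2) (finX n).
  apply: sub_finite_set => s [/surj[p Yp <-]]; rewrite cons_weight => wn.
  by exists p.
rewrite exprS -IHl -gseries_setX //; apply/esym.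
apply: (@gseries_bij _ _ (fun p : T * seq T => p.1 :: p.2)) => //.
- move=> [x s] [/= Yx [sz Ys]]; split=> /=; first by rewrite sz.
  by move=> y; rewrite inE => /predU1P[->|/Ys].
by move=> p q _ _; case: p => x s; case: q => y t /= [-> ->].
Qed.

Lemma fps_subX_gseries k Y wt : (0 < k)%N ->
  fps_subX k (gseries Y wt) = gseries Y (fun x => k * wt x)%N.
Proof.
move=> k0; apply: fpsP => n /=; case: ifP => [kn|nkn].
  congr (cnt _)%:R; apply/seteqP; split=> x /= [Yx wx]; split=> //.
    by rewrite wx mulnC divnK.
  by rewrite -wx mulKn.
rewrite (_ : level _ _ _ = set0) ?cnt0 //; apply/seteqP; split=> x //= [_ wx].
by rewrite -wx dvdn_mulr in nkn.
Qed.

Lemma locally_finite_scale k Y wt : (0 < k)%N ->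
  locally_finite Y wt -> locally_finite Y (fun x => k * wt x)%N.
Proof.
move=> k0 finY n; have := finY (n %/ k)%N; apply: sub_finite_set => x [Yx <-].
by split=> //; rewrite mulKn.
Qed.

Lemma seq_weight_rot wt i s : seq_weight wt (rot i s) = seq_weight wt s.
Proof. by apply: perm_big; rewrite perm_rot. Qed.

Lemma seq_weight_flatten wt q s :
  seq_weight wt (flatten (nseq q s)) = (q * seq_weight wt s)%N.
Proof.
elim: q => [|q IHq] /=; first by rewrite /seq_weight big_nil.
by rewrite /seq_weight big_cat /= -/(seq_weight _ _) -/(seq_weight _ _) IHq.
Qed.

Lemma words_rot Y l i s : words Y l s -> words Y l (rot i s).
Proof. by case=> sz Ys; split=> [|x]; rewrite ?size_rot ?mem_rot //; apply: Ys. Qed.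

(* The words of length m fixed by the rotation by j are the powers of the     *)
(* words of length d.                                                         *)
Lemma cnt_rot_fixed Y wt m n j (d := gcdn j m) : (j < m)%N -> locally_finite Y wt ->
  (cnt [set s | level (words Y m) (seq_weight wt) n s /\ rot j s == s])%:R =
  (fps_subX (m %/ d) (gseries Y wt) ^+ d) n :> rat.
Proof.
move=> ltjm finY; have m0 : (0 < m)%N by apply: leq_ltn_trans ltjm.
have d0 : (0 < d)%N by rewrite gcdn_gt0 m0 orbT.
have dm : (d %| m)%N := dvdn_gcdr _ _.
have qd : (m %/ d * d)%N = m by apply: divnK.
have q0 : (0 < m %/ d)%N by rewrite divn_gt0 // dvdn_leq.
rewrite fps_subX_gseries //.
have [fin <-] := words_gseries d (locally_finite_scale q0 finY).
have sw s : seq_weight (fun x => m %/ d * wt x)%N s = (m %/ d * seq_weight wt s)%N.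
  by rewrite /seq_weight big_distrr.
congr _%:R; apply/esym; apply: (@cnt_bij _ _ (fun s => flatten (nseq (m %/ d) s))) => //.
- move=> s [[sz Ys]]; rewrite sw => ws; split; last first.
    rewrite rot_fix // ?sz ?qd //; first by rewrite -size_eq0 sz -lt0n.
    exact: dvdn_gcdl.
  split; last by rewrite seq_weight_flatten.
  split=> [|x /flattenP[t /nseqP[-> _] /Ys //]].
  by rewrite size_flatten /shape map_nseq sumn_nseq sz mulnC qd.
- move=> s t [[sz _] _] [[tz _] _]; case: (m %/ d)%N q0 => // q _ /=.
  by move/(congr1 (take d)); rewrite !take_size_cat.
move=> s [[[sz Ys] ws] /eqP rs]; exists (take d s); last first.
  by rewrite [RHS](rot_fixP _ rs) sz.
have E : s = flatten (nseq (m %/ d) (take d s)) by rewrite [LHS](rot_fixP _ rs) sz.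
split; last by rewrite sw -ws [in RHS]E seq_weight_flatten.
split=> [|x /mem_take/Ys //]; by rewrite size_takel // sz dvdn_leq.
Qed.

(** For a divisor [d] of [m], exactly [totient (m %/ d)] of the [j < m] have gcd [d] with [m]. *)
Lemma sum_gcd (H : nat -> rat) m : (0 < m)%N ->
  \sum_(j < m) H (gcdn j m) =
  \sum_(1 <= d < m.+1 | (d %| m)%N) (totient (m %/ d))%:R * H d.
Proof.
move=> m0.
have count q d : (0 < d)%N ->
    (\sum_(0 <= j < q * d) (gcdn j (q * d) == d) = totient q)%N.
  move=> d0; rewrite totient_count_coprime.
  (* The range [p * d] is freed from the modulus [q * d] for the induction: each block of [d]
     consecutive integers holds one multiple of [d], which counts when its quotient is prime to
     [q]. *)
  have aux p : (\sum_(0 <= j < p * d) (gcdn j (q * d) == d) =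
                \sum_(0 <= i < p) coprime q i)%N.
    elim: p => [|p IHp]; first by rewrite mul0n !big_geq.
    rewrite mulSnr (@big_cat_nat _ _ _ (p * d)) ?leq_addr //= IHp big_nat_recr //=.
    congr addn; rewrite -{1}[(p * d)%N]add0n big_addn addKn.
    rewrite big_ltn // add0n -muln_gcdl -{2}[d]mul1n eqn_pmul2r // gcdnC -/(coprime q p).
    rewrite big_nat_cond big1 ?addn0 // => i /andP[/andP[i0 ltid] _].
    case: eqP => // gd; have : (d %| i + p * d)%N by rewrite -{1}gd dvdn_gcdl.
    by rewrite dvdn_addl ?dvdn_mull // gtnNdvd.
  exact: aux.
have -> : \sum_(j < m) H (gcdn j m) =
    \sum_(j < m) \sum_(1 <= d < m.+1) (gcdn j m == d)%:R * H d.
  apply: eq_bigr => j _; rewrite (bigD1_seq (gcdn j m)) ?iota_uniq //=; last first.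
    by rewrite mem_index_iota gcdn_gt0 m0 orbT ltnS dvdn_leq ?dvdn_gcdr.
  rewrite eqxx mul1r big1 ?addr0 // => d /negPf; rewrite eq_sym => ->.
  by rewrite mul0r.
rewrite exchange_big /= [RHS]big_mkcond /=.
rewrite big_nat_cond [RHS]big_nat_cond; apply: eq_bigr => d /andP[/andP[d0 _] _].
rewrite -mulr_suml; case: ifP => [dm|ndm].
  congr (_ * _); rewrite -natr_sum; congr _%:R.
  rewrite -(count _ d d0) divnK // big_mkord; by [].
rewrite big1 ?mul0r // => j _; case: eqP => // gd.
by rewrite -gd dvdn_gcdr in ndm.
Qed.

Definition necklaces Y : set (set (seq T)) :=
  [set c | exists2 s, s != [::] /\ {in s, forall x, Y x} & c = rotations s].

Definition necklace_weight wt (c : set (seq T)) : nat := seq_weight wt (xget [::] c).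

Lemma xget_rotations s : exists i, xget [::] (rotations s) = rot i s.
Proof. by have := xgetPex [::] (ex_intro _ s (rotations_refl s)); case=> i ->; exists i. Qed.

Lemma necklace_weightE wt s : necklace_weight wt (rotations s) = seq_weight wt s.
Proof. by rewrite /necklace_weight; have [i ->] := xget_rotations s; apply: seq_weight_rot. Qed.

Lemma seq_weight_size Y wt s : (forall x, Y x -> (0 < wt x)%N) -> {in s, forall x, Y x} ->
  (size s <= seq_weight wt s)%N.
Proof.
move=> wt0; rewrite /seq_weight; elim: s => [//|x s IHs] Ys; rewrite big_cons /= -add1n leq_add //.
  by apply/wt0/Ys; rewrite inE eqxx.
by apply: IHs => y ys; apply: Ys; rewrite inE ys orbT.
Qed.

Let necklace_level Y wt n m :=
  [set c | level (necklaces Y) (necklace_weight wt) n c /\ size (xget [::] c) = m].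

Let necklace_levelE Y wt n m :
  necklace_level Y wt n m.+1 =
  @rotations T @` level (words Y m.+1) (seq_weight wt) n.
Proof.
apply/seteqP; split=> c /=.
  case=> -[[s [sn Ys] ->]]; rewrite necklace_weightE => ws.
  have [i ->] := xget_rotations s; rewrite size_rot => sz.
  by exists s.
case=> s [[sz Ys] ws] <-; split; last by have [i ->] := xget_rotations s; rewrite size_rot.
split; last by rewrite necklace_weightE.
by exists s => //; split=> //; rewrite -size_eq0 sz.
Qed.

Lemma locally_finite_necklaces Y wt : (forall x, Y x -> (0 < wt x)%N) ->
  locally_finite Y wt -> locally_finite (necklaces Y) (necklace_weight wt).
Proof.
move=> wt0 finY n.
have : finite_set (\bigcup_(m in `I_n.+1)
    (@rotations T @` level (words Y m) (seq_weight wt) n)).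
  apply: bigcup_finite => // m _; apply: finite_image.
  by have [] := words_gseries m finY.
apply: sub_finite_set => _ [[s [sn Ys] ->]]; rewrite necklace_weightE => ws.
exists (size s); last by exists s.
by rewrite /= ltnS -ws; apply: seq_weight_size Ys.
Qed.

(** Regroups the double sum of N by [m = k * l]: in the application [m] is the length of a word made
    of [k] copies of a block of length [l]. *)
Lemma sum_pairs_mul (g : nat -> nat -> rat) n :
  (forall k l, (0 < k)%N -> (0 < l)%N -> (n < k * l)%N -> g k l = 0) ->
  \sum_(1 <= k < n.+1) \sum_(1 <= l < n.+1) g k l =
  \sum_(1 <= m < n.+1) \sum_(1 <= l < m.+1 | (l %| m)%N) g (m %/ l)%N l.
Proof.
move=> g0.
transitivity (\sum_(1 <= k < n.+1) \sum_(1 <= l < n.+1)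
    \sum_(1 <= m < n.+1) (m == k * l)%N%:R * g k l).
  rewrite big_nat_cond [RHS]big_nat_cond; apply: eq_bigr => k /andP[/andP[k0 _] _].
  rewrite big_nat_cond [RHS]big_nat_cond; apply: eq_bigr => l /andP[/andP[l0 _] _].
  have [lekl|ltkl] := leqP (k * l) n; last first.
    by rewrite g0 // big1 // => m _; rewrite mulr0.
  rewrite (bigD1_seq (k * l)%N) ?iota_uniq ?mem_index_iota ?muln_gt0 ?k0 ?l0 //=.
  rewrite eqxx mul1r big1 ?addr0 // => m /negPf->; by rewrite mul0r.
under eq_bigr => k _ do rewrite exchange_big /=.
rewrite exchange_big /= big_nat_cond [RHS]big_nat_cond.
apply: eq_bigr => m /andP[/andP[m0 lemn] _].
rewrite exchange_big /= (@big_cat_nat _ _ _ m.+1) //= [X in _ + X]big_nat_cond.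
rewrite [X in _ + X]big1 ?addr0; last first.
  move=> l /andP[/andP[ltml _] _]; rewrite big_nat_cond big1 // => k /andP[/andP[k0 _] _].
  case: eqP => [mE|_]; last by rewrite mul0r.
  by move: ltml; rewrite ltnNge mE leq_pmull.
rewrite [RHS]big_mkcond /= big_nat_cond [RHS]big_nat_cond.
apply: eq_bigr => l /andP[/andP[l0 lelm] _]; case: ifP => [lm|nlm]; last first.
  rewrite big1 // => k _; case: eqP => [mE|_]; last by rewrite mul0r.
  by rewrite mE dvdn_mull in nlm.
have lem : (m %/ l <= m)%N by apply: leq_div.
rewrite (bigD1_seq (m %/ l)%N) ?iota_uniq ?mem_index_iota //=; last first.
  by rewrite divn_gt0 // -ltnS lelm /= (leq_ltn_trans lem).
rewrite divnK // eqxx mul1r big1 ?addr0 // => k kn.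
case: eqP => [mE|_]; last by rewrite mul0r.
by rewrite mE mulnK ?eqxx in kn.
Qed.

(** Burnside's count gives [m] times the number of necklaces of length [m] as the sum, over
    [k * l = m], of [totient k] times the coefficient of [f(z^k)^l]; dividing by [m] gives the terms
    of N. *)
Lemma necklaces_gseries Y wt : (forall x, Y x -> (0 < wt x)%N) ->
  locally_finite Y wt ->
  gseries (necklaces Y) (necklace_weight wt) = fps_N (gseries Y wt).
Proof.
move=> wt0 finY; set f := gseries Y wt; apply: fpsP => n.
have f0 : f 0%N = 0.
  rewrite /f /= (_ : level _ _ _ = set0) ?cnt0 //.
  by apply/seteqP; split=> x //= [/wt0 + wx]; rewrite wx.
have finN := locally_finite_necklaces wt0 finY n.
pose F k l : rat := (fps_subX k f ^+ l) n.
have F0 k l : (0 < k)%N -> (0 < l)%N -> (n < k * l)%N -> F k l = 0.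
  move=> k0 l0 ltn; apply: (@fps_exp_eq0 _ k) => // i; exact: fps_subX_eq0.
rewrite [RHS](_ : _ = \sum_(1 <= k < n.+1) \sum_(1 <= l < n.+1)
   (totient k)%:R / (k * l)%:R * F k l) //.
rewrite (sum_pairs_mul (g := fun k l => (totient k)%:R / (k * l)%:R * F k l)); last first.
  by move=> k l k0 l0 ltn; rewrite F0 // mulr0.
(* The letters have positive weight, so the length of a necklace is at most its weight [n]: sorting
   by length in ['I_n.+1] loses nothing. *)
rewrite /= (cnt_fibers (fun c => inord (size (xget [::] c)) : 'I_n.+1) finN).
rewrite big_ord_recl /= [X in (X + _)%N](_ : _ = 0%N); last first.
  rewrite (_ : [set c | _] = set0) ?cnt0 //; apply/seteqP; split=> c //= [[[s [sn Ys] ->]]].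
  rewrite necklace_weightE => ws /(congr1 val) /=; have [i ->] := xget_rotations s.
  rewrite size_rot inordK; last by rewrite ltnS -ws; apply: seq_weight_size Ys.
  by move/size0nil => s0; rewrite s0 in sn.
rewrite add0n natr_sum big_add1 /= big_mkord; apply: eq_bigr => m _.
set D := (X in cnt X); have -> : D = necklace_level Y wt n m.+1.
  apply/seteqP; split=> c [[[s [sn Ys] cE] wn] sz]; split; try by split=> //; exists s.
    move: sz => /(congr1 val) /=; rewrite inordK //.
    rewrite cE; have [i ->] := xget_rotations s; rewrite size_rot ltnS.
    by move: wn; rewrite cE necklace_weightE => <-; apply: seq_weight_size Ys.
  by rewrite sz; apply: val_inj; rewrite /= inordK // ltnS ltn_ord.
rewrite necklace_levelE.
have m1 : m.+1%:R != 0 :> rat by rewrite pnatr_eq0.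
apply: (mulfI m1); rewrite -natrM burnside_rot; last first.
- by move=> i s [Ws ws]; split; [apply: words_rot | rewrite seq_weight_rot].
- by move=> s [[]].
- by have [] := words_gseries m.+1 finY.
rewrite natr_sum; under eq_bigr => j _ do rewrite cnt_rot_fixed ?ltn_ord //.
rewrite (sum_gcd (fun d => F (m.+1 %/ d)%N d)) // mulr_sumr.
rewrite big_nat_cond [RHS]big_nat_cond; apply: eq_bigr => d /andP[_ dm].
by rewrite divnK // mulrA mulrCA mulfV // mulr1.
Qed.

End Necklaces.

(** * Actions of graph products and retractions *)

Section UniversalProperty.
Local Open Scope group_scope.
Variables (V : finType) (e : rel V) (G : V -> groupType).
(** The relations are asked only on an invariant part [D] of [W], since [add_syllable] behaves as an
    action only on lists satisfying [red]. *)
Variables (W : Type) (D : W -> Prop) (f : forall u, G u -> W -> W).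
Hypothesis fD : forall u (g : G u) w, D w -> D (f g w).
Hypothesis f1 : forall u w, D w -> f (1 : G u) w = w.
Hypothesis fM : forall u (g h : G u) w, D w -> f (g * h) w = f g (f h w).
Hypothesis fC : forall u u' (g : G u) (h : G u') w, e u u' -> D w ->
  f g (f h w) = f h (f g w).

Let word_act (s : seq (fp_letter G)) w := foldr (fun l => f (tagged l)) w s.

Let word_actD s w : D w -> D (word_act s w).
Proof. by move=> Dw; elim: s => //= l s IHs; apply: fD. Qed.

Let word_act_cat s t w : word_act (s ++ t) w = word_act s (word_act t w).
Proof. by rewrite /word_act foldr_cat. Qed.

Let word_act_eq s t w : fp_eq s t -> D w -> word_act s w = word_act t w.
Proof.
move=> st; elim: st w => {s t} /=.
- by [].
- by move=> s t _ IH w Dw; rewrite IH.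
- by move=> s t u _ IHst _ IHtu w Dw; rewrite IHst // IHtu.
- move=> s1 t1 s2 t2 _ IH1 _ IH2 w Dw.
  by rewrite !word_act_cat IH2 // IH1 //; apply: word_actD.
- by move=> u w; apply: f1.
- by move=> u g h w Dw; rewrite fM.
Qed.

Let fp_act (x : free_product G) w := word_act (repr x) w.

Let fp_actD x w : D w -> D (fp_act x w). Proof. exact: word_actD. Qed.

Let fp_act_pi s w : D w -> fp_act (fp_pi s) w = word_act s w.
Proof. by apply: word_act_eq; apply/fp_piP; rewrite /fp_pi reprK. Qed.

Let fp_act1 w : D w -> fp_act 1 w = w.
Proof. exact: (fp_act_pi [::]). Qed.

Let fp_actM x y w : D w -> fp_act (x * y) w = fp_act x (fp_act y w).
Proof. by move=> Dw; rewrite fp_act_pi // word_act_cat. Qed.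

Let fp_actV x w : D w -> fp_act x^-1 (fp_act x w) = w.
Proof. by move=> Dw; rewrite -fp_actM // mulVg fp_act1. Qed.

Let fp_act_inj u (g : G u) w : D w -> fp_act (fp_inj g) w = f g w.
Proof. exact: (fp_act_pi [:: to_letter g]). Qed.

Let fp_act_inj2 u u' (g : G u) (h : G u') w : D w ->
  fp_act (fp_inj g * fp_inj h) w = f g (f h w).
Proof.
move=> Dw; apply: etrans (fp_actM _ _ Dw) _; rewrite (fp_act_inj h Dw).
exact: (fp_act_inj g (fD h Dw)).
Qed.

(** The elements acting trivially on [D] form a normal subgroup, which contains the relators by
    [fC]. *)
Let fp_act_ker x w : normal_closure (@gp_relators V e G) x -> D w -> fp_act x w = w.
Proof.
move=> Nx; move: w.
apply: (Nx [set x : free_product G | forall w, D w -> fp_act x w = w]%classic).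
split=> [|_ [u [u' [g [h [uu' ->]]]]] w Dw]; last first.
  rewrite (_ : [~ _, _] = (fp_inj h * fp_inj g)^-1 * (fp_inj g * fp_inj h)).
    have E : fp_act (fp_inj g * fp_inj h) w = fp_act (fp_inj h * fp_inj g) w.
      exact: etrans (fp_act_inj2 _ _ Dw) (etrans (fC _ _ uu' Dw) (esym (fp_act_inj2 _ _ Dw))).
    apply: etrans (fp_actM _ _ Dw) _; rewrite E; exact: fp_actV.
  by rewrite commgEl conjgE invgM !mulgA.
split; first split=> [|x1 y /= Kx Ky w Dw].
- exact: fp_act1.
- have E : fp_act (x1 / y) w = fp_act y^-1 w.
    exact: etrans (fp_actM x1 y^-1 Dw) (Kx _ (fp_actD y^-1 Dw)).
  apply: etrans E _.
  exact: etrans (congr1 (fp_act y^-1) (esym (Ky w Dw))) (fp_actV y Dw).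
- move=> x1 y /= Kx w Dw; rewrite conjgE; apply: etrans (fp_actM _ _ Dw) _.
  rewrite -[RHS](fp_actV y Dw); congr (fp_act _ _).
  exact: etrans (fp_actM _ _ Dw) (Kx _ (fp_actD _ Dw)).
Qed.

Definition gp_act (x : graph_product e G) w := fp_act (repr x) w.

Lemma gp_act_pi (x : free_product G) w : D w ->
  gp_act (quo_pi (@gp_relators V e G) x) w = fp_act x w.
Proof.
move=> Dw; rewrite /gp_act; set y := repr _.
have /quo_piP Nyx : quo_pi (@gp_relators V e G) y = quo_pi (@gp_relators V e G) x.
  by rewrite /y /quo_pi reprK.
have := fp_actM y (y^-1 * x) Dw; rewrite mulVKg => ->.
by congr (fp_act _ _); apply/esym; apply: fp_act_ker.
Qed.

Lemma gp_actD x w : D w -> D (gp_act x w). Proof. exact: fp_actD. Qed.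

Lemma gp_act1 w : D w -> gp_act 1 w = w.
Proof. by move=> Dw; rewrite (gp_act_pi 1) // fp_act1. Qed.

Lemma gp_actM x y w : D w -> gp_act (x * y) w = gp_act x (gp_act y w).
Proof.
move=> Dw; apply: etrans (gp_act_pi _ Dw) _; exact: fp_actM.
Qed.

Lemma gp_act_inj u (g : G u) w : D w -> gp_act (gp_inj e g) w = f g w.
Proof. by move=> Dw; apply: etrans (gp_act_pi _ Dw) (fp_act_inj _ Dw). Qed.

End UniversalProperty.

Section Elements.
Local Open Scope group_scope.
Variables (V : finType) (e : rel V) (G : V -> groupType).
Local Notation GP := (graph_product e G).

Lemma gp_injM u : {morph (@gp_inj V e G u) : g h / g * h}.
Proof. by move=> g h; rewrite /gp_inj !gmulfM. Qed.

Lemma gp_inj1 u : gp_inj e (1 : G u) = 1.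
Proof. by rewrite /gp_inj !gmulf1. Qed.

Lemma gp_injV u : {morph (@gp_inj V e G u) : g / g^-1}.
Proof. by move=> g; rewrite /gp_inj !gmulfV. Qed.

Lemma gp_ind (P : GP -> Prop) :
  P 1 -> (forall u (g : G u) x, P x -> P (gp_inj e g * x)) -> forall x, P x.
Proof.
move=> P1 PS x; have <- : quo_pi (@gp_relators V e G) (fp_pi (repr (repr x))) = x.
  by rewrite /fp_pi reprK /quo_pi reprK.
elim: (repr (repr x)) => [|[u g] s IHs].
  by rewrite -[fp_pi _]/(1 : free_product G) gmulf1.
by rewrite -cat1s fp_pi_cat [quo_pi _ _]gmulfM; apply: (PS u g).
Qed.

Lemma gp_inj_comm u u' (g : G u) (h : G u') : e u u' ->
  gp_inj e g * gp_inj e h = gp_inj e h * gp_inj e g.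
Proof.
move=> uu'; apply/commgP/eqP; rewrite /gp_inj -gmulfR.
apply/esym/quo_piP; rewrite invg1 mul1g => N [_ sN]; apply: sN.
by exists u, u', g, h.
Qed.

End Elements.

(* Otherwise unification unfolds the two quotients and diverges. *)
Local Opaque fp_inj fp_mul fp_inv fp_one quo_mul quo_inv quo_one gp_inj.

Section Retractions.
Local Open Scope group_scope.
Variables (V : finType) (e : rel V) (G : V -> groupType).
Local Notation GP := (graph_product e G).
Implicit Types (x y : GP) (S T : {set V}).

Let proj_letter S u (g : G u) y := if u \in S then gp_inj e g * y else y.

(** The endomorphism that kills the factors outside S, obtained as the orbit map of 1. *)
Definition proj S x : GP := gp_act (proj_letter S) x 1.

Let D (y : GP) := True.
Let pD S u (g : G u) y : D y -> D (proj_letter S g y). Proof. by []. Qed.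
Let p1 S u y : D y -> proj_letter S (1 : G u) y = y.
Proof. by rewrite /proj_letter gp_inj1 mul1g if_same. Qed.
Let pM S u (g h : G u) y :
  D y -> proj_letter S (g * h) y = proj_letter S g (proj_letter S h y).
Proof. by rewrite /proj_letter gp_injM; case: ifP => //; rewrite mulgA. Qed.
Let pC S u u' (g : G u) (h : G u') y : e u u' -> D y ->
  proj_letter S g (proj_letter S h y) = proj_letter S h (proj_letter S g y).
Proof.
move=> uu' _; rewrite /proj_letter; case: ifP; case: ifP => // _ _.
by rewrite !mulgA (gp_inj_comm _ _ uu').
Qed.

Lemma proj1 S : proj S 1 = 1.
Proof. exact: (gp_act1 (pD S) (p1 S) (pM S) (pC S)). Qed.

Let proj_injM S u (g : G u) x :
  proj S (gp_inj e g * x) = if u \in S then gp_inj e g * proj S x else proj S x.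
Proof.
rewrite /proj (gp_actM (pD S) (p1 S) (pM S) (pC S)) //.
by rewrite (gp_act_inj (pD S) (p1 S) (pM S) (pC S)).
Qed.

Lemma projM S : {morph proj S : x y / x * y}.
Proof.
move=> x y; elim/gp_ind: x => [|u g x IHx]; first by rewrite proj1 !mul1g.
by rewrite -mulgA !proj_injM IHx; case: ifP => // _; rewrite mulgA.
Qed.

HB.instance Definition _ S := isUMagmaMorphism.Build GP GP (proj S)
  (conj (proj1 S) (projM S)).

Lemma projV S : {morph proj S : x / x^-1}. Proof. exact: gmulfV. Qed.

Lemma projJ S : {morph proj S : x y / x ^ y}. Proof. exact: gmulfJ. Qed.

Lemma proj_inj S u (g : G u) :
  proj S (gp_inj e g) = if u \in S then gp_inj e g else 1.
Proof. by have := proj_injM S g 1; rewrite proj1 !mulg1. Qed.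

Lemma proj_proj S T x : proj S (proj T x) = proj (S :&: T)%SET x.
Proof.
elim/gp_ind: x => [|u g x IHx]; first by rewrite !proj1.
rewrite !projM IHx !proj_inj inE andbC; case: (u \in T); last by rewrite proj1.
by rewrite proj_inj.
Qed.

(** Membership in the subgraph product as being fixed by the retraction (see [subgraph_productE]): a
    boolean test, for which intersections reduce to [proj_proj]. *)
Definition par S : pred GP := fun x => proj S x == x.

Lemma parP S x : reflect (proj S x = x) (par S x). Proof. exact: eqP. Qed.

Lemma par1 S : par S 1. Proof. by rewrite /par proj1. Qed.

Lemma parM S x y : par S x -> par S y -> par S (x * y).
Proof. by move=> /eqP px /eqP py; rewrite /par projM px py. Qed.

Lemma parV S x : par S x^-1 = par S x.
Proof. by rewrite /par projV eqg_inv. Qed.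

Lemma parVr S x : par S x -> par S x^-1. Proof. by rewrite parV. Qed.

Lemma parMl S x y : par S x -> par S (x * y) = par S y.
Proof.
by move=> px; apply/idP/idP=> [pxy|]; [rewrite -(mulKg x y)|]; apply: parM;
  rewrite ?parV.
Qed.

Lemma parMr S x y : par S y -> par S (x * y) = par S x.
Proof.
by move=> py; apply/idP/idP=> [pxy|px]; [rewrite -(mulgK y x)|]; apply: parM;
  rewrite ?parV.
Qed.

Lemma par_inj S u (g : G u) : u \in S -> par S (gp_inj e g).
Proof. by move=> uS; rewrite /par proj_inj uS. Qed.

Lemma par_proj S x : par S (proj S x).
Proof. by rewrite /par proj_proj finset.setIid. Qed.

Lemma proj_sub S T x : S \subset T -> par S x -> proj T x = x.
Proof. by move=> /finset.setIidPr ST /eqP px; rewrite -px proj_proj ST. Qed.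

Lemma par_sub S T x : S \subset T -> par S x -> par T x.
Proof. by move=> ST px; apply/eqP; apply: proj_sub px. Qed.

Lemma par_ind S (P : GP -> Prop) :
  P 1 ->
  (forall u (g : G u) x, u \in S -> par S x -> P x -> P (gp_inj e g * x)) ->
  forall x, par S x -> P x.
Proof.
move=> P1 PS x /eqP <-; elim/gp_ind: x => [|u g x IHx]; first by rewrite proj1.
by rewrite projM proj_inj; case: ifP => uS; rewrite ?mul1g //; apply: PS => //;
  apply: par_proj.
Qed.

Lemma par0P x : par finset.set0 x -> x = 1.
Proof. by elim/par_ind: x / => // u g x; rewrite inE. Qed.

Lemma parI S T x : par (S :&: T)%SET x = par S x && par T x.
Proof.
apply/idP/andP => [px|[/eqP Sx /eqP Tx]].
  by split; apply: par_sub px; rewrite ?finset.subsetIl ?finset.subsetIr.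
by rewrite /par -proj_proj Tx Sx.
Qed.

Lemma proj_disjoint S T x : [disjoint S & T] -> par T x -> proj S x = 1.
Proof.
rewrite -finset.setI_eq0 => /eqP ST /eqP <-; rewrite proj_proj ST; apply: par0P.
exact: par_proj.
Qed.

Lemma proj_par S T x : par T x -> par (S :&: T)%SET (proj S x).
Proof. by move=> /eqP <-; rewrite proj_proj; apply: par_proj. Qed.

Lemma parT x : par [set: V] x.
Proof.
elim/gp_ind: x => [|u g x IHx]; first exact: par1.
by apply: parM => //; apply: par_inj; rewrite inE.
Qed.

Lemma par_setP u x : par [set u] x -> exists g : G u, x = gp_inj e g.
Proof.
elim/par_ind: x / => [|w g x]; first by exists 1; rewrite gp_inj1.
by rewrite inE => /eqP wu; subst w => _ [h ->]; exists (g * h); rewrite gp_injM.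
Qed.

Lemma par_comm S T x y : {in S & T, forall u w, e u w} ->
  par S x -> par T y -> x * y = y * x.
Proof.
move=> ST Sx Ty; elim/par_ind: x / Sx => [|u g x uS _ IHx].
  by rewrite mulg1 mul1g.
rewrite -mulgA IHx !mulgA; congr (_ * _).
elim/par_ind: y / Ty {IHx} => [|w h y wT _ IHy]; first by rewrite mulg1 mul1g.
by rewrite -!mulgA -IHy !mulgA (gp_inj_comm _ _ (ST _ _ uS wT)).
Qed.

Lemma subgraph_productE S : subgraph_product e G S = [set` par S]%classic.
Proof.
apply/seteqP; split=> x /=.
  move=> Sx; apply: (Sx [set` par S]%classic); split; first split=> /=.
  - exact: par1.
  - by move=> y z /= py pz; apply: parM; rewrite ?parV.
  - by move=> _ [u /= uS [g _ <-]]; apply: par_inj.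
elim/par_ind: x / => [|u g x uS _ Sx] H.
  by case=> [[H1 _] _].
move=> HH; have [[H1 HF] HS] := HH.
have Hx : H x := Sx H HH.
rewrite -[x]invgK; apply: (HF); first by apply: HS; exists u => //; exists g.
by rewrite -div1g; apply: HF.
Qed.

End Retractions.

(** * Syllables and reduced words *)

Section GraphProductGroup.
Local Open Scope group_scope.
Variables (V : finType) (e : rel V).
Hypothesis e_irr : irreflexive e.
Hypothesis e_sym : symmetric e.
Variable G : V -> groupType.
Local Notation GP := (graph_product e G).
Implicit Types (x y : GP) (S T : {set V}).

(** Cosets are encoded by their indicator functions, which have a boolean equality; left
    multiplication then acts by translation. *)
Definition translate x (c : GP -> bool) : GP -> bool := fun z => c (x^-1 * z).

Lemma translate1 c : translate 1 c = c.
Proof. by apply/funext => z; rewrite /translate invg1 mul1g. Qed.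

Lemma translateM x y c : translate (x * y) c = translate x (translate y c).
Proof. by apply/funext => z; rewrite /translate invgM mulgA. Qed.

Lemma translate_inj x : injective (translate x).
Proof.
move=> c d /(congr1 (translate x^-1)).
by rewrite -!translateM mulVg !translate1.
Qed.

Let syllables := seq ((GP -> bool) * GP).

Definition base u : GP -> bool := par (link1 e u).

Lemma translate_base u x : (translate x (base u) == base u) = par (link1 e u) x.
Proof.
apply/eqP/idP => [/(congr1 (fun c => c x))|px].
  by rewrite /translate mulVg /base par1 => /esym.
by apply/funext => z; rewrite /translate /base parMl // parV.
Qed.

Lemma translate_base_eq u x y :
  translate x (base u) = translate y (base u) <-> par (link1 e u) (x^-1 * y).
Proof.
rewrite -translate_base translateM; split=> [<-|/eqP E].
  by rewrite -translateM mulVg translate1.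
by rewrite -{1}E -!translateM mulgV mul1g.
Qed.

Definition add_syllable u (b : GP) (s : syllables) : syllables :=
  match s with
  | (c, b') :: s' =>
    if c == base u then if b * b' == 1 then s' else (c, b * b') :: s'
    else if b == 1 then s else (base u, b) :: s
  | [::] => if b == 1 then [::] else [:: (base u, b)]
  end.

Definition red (s : syllables) : bool :=
  all (fun p => p.2 != 1) s && sorted (fun p q => p.1 != q.1) s.

Lemma add_syllable_red u b s : red s -> red (add_syllable u b s).
Proof.
rewrite /red; case: s => [|[c b'] s] /=; first by case: ifP => //= ->.
case/andP=> /andP[b'n as_] ps; case: eqVneq => [_|cn].
  case: ifP => /= [_|->]; last by rewrite as_; case: s ps {as_} => [|p s].
  by rewrite as_ (path_sorted ps).
by case: ifP => /= [_|->]; rewrite ?b'n as_ ?ps //= eq_sym cn.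
Qed.

Lemma add_syllable1 u s : red s -> add_syllable u 1 s = s.
Proof.
rewrite /red; case: s => [|[c b'] s] /=; first by rewrite eqxx.
by rewrite eqxx mul1g => /andP[/andP[/negPf-> _] _]; rewrite if_same.
Qed.

Lemma add_syllableM u a b s : red s ->
  add_syllable u (a * b) s = add_syllable u a (add_syllable u b s).
Proof.
rewrite /red; case: s => [|[c b'] s] /=.
  case: (eqVneq b 1) => [->|bn] _ /=; first by rewrite mulg1.
  by rewrite eqxx.
case/andP=> /andP[b'n _] ps; case: eqVneq => [cE|cn].
  case: (eqVneq (b * b') 1) => [bb'|bb'n] /=; last by rewrite cE eqxx mulgA.
  rewrite -mulgA bb' mulg1.
  case: s ps => [|[d b2] s] /=; rewrite cE // eq_sym.
  by case/andP=> /negPf->.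
case: (eqVneq b 1) => [->|bn] /=; first by rewrite mulg1 (negPf cn).
by rewrite eqxx.
Qed.

Let translates x (s : syllables) := [seq (translate x p.1, p.2) | p <- s].

Let translates1 s : translates 1 s = s.
Proof. by rewrite -[RHS]map_id; apply: eq_map => -[c b]; rewrite translate1. Qed.

Let translatesM x y s : translates (x * y) s = translates x (translates y s).
Proof.
by rewrite /translates -map_comp; apply: eq_map => -[c b] /=; rewrite translateM.
Qed.

Let translates_red x s : red s -> red (translates x s).
Proof.
case/andP=> as_ ss; apply/andP; split; first by rewrite all_map.
rewrite sorted_map; apply: sub_sorted ss => p q /=.
by rewrite (inj_eq (@translate_inj x)).
Qed.

Let translates_add u x b s : par (link1 e u) x ->
  translates x (add_syllable u b s) = add_syllable u b (translates x s).
Proof.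
move=> px; have xb : translate x (base u) = base u.
  by apply/eqP; rewrite translate_base.
have E c : (translate x c == base u) = (c == base u).
  by rewrite -{1}xb (inj_eq (@translate_inj x)).
case: s => [|[c b'] s] /=; first by case: ifP => //= _; rewrite xb.
by rewrite E; do ![case: ifP => //= _]; rewrite xb.
Qed.

Let letter_act u w (g : G w) (s : syllables) : syllables :=
  if w == u then add_syllable u (gp_inj e g) s else translates (gp_inj e g) s.

(* With B = G_u, L the subgroup on the link of u and A the one on the other   *)
(* factors, the graph product is the amalgam of A and L x B over L, hence the *)
(* semidirect product of A and a free product of copies of B indexed by A / L.*)
(* [syll u x] lists the (coset, syllable) pairs of the reduced word of the    *)
(* free product part of x. It is the image of the empty word under an action  *)
(* in which A translates the cosets and B acts at the trivial coset [base u]. *)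
Definition syll u x : syllables := gp_act (letter_act u) x [::].

Let letter_act_red u w (g : G w) s : red s -> red (letter_act u g s).
Proof.
by rewrite /letter_act; case: ifP => _; [apply: add_syllable_red|apply: translates_red].
Qed.
Let letter_act1 u w s : red s -> letter_act u (1 : G w) s = s.
Proof.
rewrite /letter_act gp_inj1 => rs.
by case: ifP => _; [apply: add_syllable1|apply: translates1].
Qed.
Let letter_actM u w (g h : G w) s : red s ->
  letter_act u (g * h) s = letter_act u g (letter_act u h s).
Proof.
rewrite /letter_act gp_injM => rs.
by case: ifP => _; [apply: add_syllableM|apply: translatesM].
Qed.
Let letter_actC u w w' (g : G w) (h : G w') s : e w w' -> red s ->
  letter_act u g (letter_act u h s) = letter_act u h (letter_act u g s).
Proof.
move=> ww' rs; rewrite /letter_act.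
case: (eqVneq w u) => [wu|wu]; case: (eqVneq w' u) => [w'u|w'u].
- by have := e_irr u; rewrite -{1}wu -w'u ww'.
(* A factor adjacent to [u] fixes the coset [base u], at which the syllables of [u] are inserted. *)
- by rewrite translates_add //; apply: par_inj; rewrite inE -wu.
- by rewrite translates_add //; apply: par_inj; rewrite inE -w'u e_sym.
- by rewrite -!translatesM (gp_inj_comm _ _ ww').
Qed.

Lemma syll1 u : syll u 1 = [::].
Proof. exact: (gp_act1 (letter_act_red u) (letter_act1 u) (letter_actM u) (letter_actC u)). Qed.

Let syll_act u x y : syll u (x * y) = gp_act (letter_act u) x (syll u y).
Proof. exact: (gp_actM (letter_act_red u) (letter_act1 u) (letter_actM u) (letter_actC u)). Qed.

Lemma syll_red u x : red (syll u x).
Proof. exact: (gp_actD (letter_act_red u)). Qed.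

Let syll_inj u w (g : G w) x :
  syll u (gp_inj e g * x) = letter_act u g (syll u x).
Proof.
rewrite syll_act; apply: (gp_act_inj (letter_act_red u) (letter_act1 u) (letter_actM u) (letter_actC u)).
exact: syll_red.
Qed.

Lemma syllMl u b x : par [set u] b -> syll u (b * x) = add_syllable u b (syll u x).
Proof. by case/par_setP=> g ->; rewrite syll_inj /letter_act eqxx. Qed.

Lemma syll_translate u a x : par [set~ u] a ->
  syll u (a * x) = [seq (translate a p.1, p.2) | p <- syll u x].
Proof.
elim/par_ind: a / => [|w g a]; first by rewrite mul1g; apply/esym/translates1.
rewrite !inE => wu _ IHa; rewrite -mulgA syll_inj /letter_act (negPf wu) IHa.
exact/esym/translatesM.
Qed.

Lemma syll_par u a : par [set~ u] a -> syll u a = [::].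
Proof. by move=> pa; rewrite -[a]mulg1 syll_translate ?syll1. Qed.

(** The syllable of [u] that can be shuffled to the left end of [x], or 1: what precedes the first
    [u]-syllable commutes with the factor [u] exactly when the coset of that syllable is the trivial
    one. *)
Definition hd u x : GP :=
  if syll u x is (c, b) :: _ then if c == base u then b else 1 else 1.

Lemma syll_nonempty u x c b s : syll u x = (c, b) :: s -> b != 1.
Proof. by have := syll_red u x; rewrite /red => /andP[+ _] E; rewrite E => /andP[]. Qed.

Lemma hd_par u x : par [set~ u] x -> hd u x = 1.
Proof. by move=> px; rewrite /hd syll_par. Qed.

Lemma hdM u b x : par [set u] b -> hd u (b * x) = b * hd u x.
Proof.
move=> pb; rewrite /hd syllMl //; have := syll_red u x; rewrite /red.
case: (syll u x) => [|[c b'] s] /=.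
  by rewrite mulg1; case: eqVneq => //=; rewrite eqxx.
case/andP=> _ ps; case: (eqVneq c (base u)) => [cE|cn].
  case: eqVneq => [->|_] /=; last by rewrite cE eqxx.
  by case: s ps => [|[d b2] s] //= /andP[]; rewrite cE eq_sym => /negPf->.
by rewrite mulg1; case: eqVneq => /= [->|_]; rewrite ?(negPf cn) ?eqxx.
Qed.

Lemma hd_link u a x : par (link1 e u) a -> hd u (a * x) = hd u x.
Proof.
move=> pa; have ab : translate a (base u) = base u.
  by apply/eqP; rewrite translate_base.
rewrite /hd syll_translate.
  by case: (syll u x) => [|[c b] s] //=; rewrite -{1}ab (inj_eq (@translate_inj a)).
apply: par_sub pa; apply/fintype.subsetP => w; rewrite !inE.
by apply: contraTneq => ->; rewrite e_irr.
Qed.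

Lemma syllM_cons u b x : par [set u] b -> b != 1 -> hd u x = 1 ->
  syll u (b * x) = (base u, b) :: syll u x.
Proof.
move=> pb /negPf bn; rewrite /hd syllMl //; case E: (syll u x) => [|[c b'] s] /=.
  by rewrite bn.
case: ifP => _ => [b1|_]; last by rewrite bn.
by have := syll_nonempty E; rewrite b1 eqxx.
Qed.

Lemma size_syllM u b x : par [set u] b -> size (syll u (b * x)) <= (size (syll u x)).+1.
Proof.
move=> pb; rewrite syllMl //; case: (syll u x) => [|[c b'] s] /=; first by case: ifP.
by do 2!case: ifP => _ //=; lia.
Qed.

Lemma size_syllM_eq u b x : par [set u] b ->
  size (syll u (b * x)) = (size (syll u x)).+1 -> b != 1 /\ hd u x = 1.
Proof.
move=> pb; rewrite /hd syllMl //; case: (syll u x) => [|[c b'] s] /=.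
  by case: eqVneq.
by case: ifP => _; case: eqVneq => //= _; lia.
Qed.

Lemma hd_par_set u x : par [set u] (hd u x).
Proof.
suff: all (fun p => par [set u] p.2) (syll u x).
  rewrite /hd; case: (syll u x) => [|[c b] s] /=; first by rewrite par1.
  by case/andP=> pb _; case: ifP => _ //; apply: par1.
elim/gp_ind: x => [|w g x IHx]; first by rewrite syll1.
rewrite syll_inj /letter_act; case: eqVneq => [wu|_]; last by rewrite all_map.
have pg : par [set u] (gp_inj e g) by apply: par_inj; rewrite inE wu.
case: (syll u x) IHx => [|[c b] s] /=; first by case: ifP => //=; rewrite pg.
by case/andP=> pb ps; do 2!case: ifP => _ //=; rewrite ?pg ?pb ?parM.
Qed.

Section Words.
Local Notation word := (seq (V * GP)).
Implicit Types (w p q : word).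

Definition wprod w : GP := foldr (fun a x => a.2 * x) 1 w.

Lemma wprod_cat p q : wprod (p ++ q) = wprod p * wprod q.
Proof. by elim: p => [|a p IHp] /=; rewrite ?mul1g // IHp mulgA. Qed.

Definition syllabic w := all (fun a => par [set a.1] a.2) w.

(** The condition on [hd] says that no later syllable of the same factor can be shuffled back to
    merge with [a]; it depends only on the product of the tail. *)
Fixpoint reduced w : bool :=
  if w is a :: w' then
    [&& par [set a.1] a.2, a.2 != 1, hd a.1 (wprod w') == 1 & reduced w']
  else true.

Lemma reduced_syllabic w : reduced w -> syllabic w.
Proof. by elim: w => //= p w IHw /and4P[-> _ _ /IHw]. Qed.

Lemma wprod_par S w : syllabic w -> {subset map fst w <= S} -> par S (wprod w).
Proof.
elim: w => [|[u b] w IHw] /=; first by rewrite par1.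
case/andP=> pb sw S_w; apply: parM; last first.
  by apply: IHw => // t wt; apply: S_w; rewrite inE wt orbT.
by apply: par_sub pb; rewrite finset.sub1set; apply: S_w; rewrite inE eqxx.
Qed.

(** An invariant of the element, hence a lower bound for the size of its syllabic words, attained
    exactly by the reduced ones ([nsyll_wprod], [nsyll_reduced], [reduced_nsyll]). *)
Definition nsyll x := (\sum_u size (syll u x))%N.

Lemma par_setC u t (b : GP) : u != t -> par [set u] b -> par [set~ t] b.
Proof. by move=> ut; apply: par_sub; rewrite finset.sub1set !inE. Qed.

Lemma size_syll_translate u (a : GP) x : par [set~ u] a ->
  size (syll u (a * x)) = size (syll u x).
Proof. by move=> pa; rewrite syll_translate // size_map. Qed.

(** Only the summand of [u] changes; the identity is written without subtraction. *)
Lemma nsyll_exchange u (b : GP) x : par [set u] b ->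
  nsyll (b * x) + size (syll u x) = nsyll x + size (syll u (b * x)).
Proof.
move=> pb; rewrite /nsyll (bigD1 u) //= [in RHS](bigD1 u) //=.
under eq_bigr => t tu do rewrite size_syll_translate ?(par_setC _ pb) 1?eq_sym //.
lia.
Qed.

Lemma nsyllM_le u (b : GP) x : par [set u] b -> nsyll (b * x) <= (nsyll x).+1.
Proof. by move=> pb; have := nsyll_exchange x pb; have := size_syllM x pb; lia. Qed.

Lemma nsyllM_eq u (b : GP) x : par [set u] b -> nsyll (b * x) = (nsyll x).+1 ->
  b != 1 /\ hd u x = 1.
Proof.
move=> pb E; apply: size_syllM_eq => //.
by have := nsyll_exchange x pb; rewrite E; lia.
Qed.

Lemma nsyllM_cons u (b : GP) x : par [set u] b -> b != 1 -> hd u x = 1 ->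
  nsyll (b * x) = (nsyll x).+1.
Proof.
move=> pb bn hx; have := nsyll_exchange x pb.
by rewrite syllM_cons //=; lia.
Qed.

Lemma nsyll1 : nsyll 1 = 0.
Proof. by rewrite /nsyll big1 // => u _; rewrite syll1. Qed.

Lemma nsyll_wprod_le w x : syllabic w -> nsyll (wprod w * x) <= size w + nsyll x.
Proof.
elim: w => [|[u b] w IHw] /=; first by rewrite mul1g.
case/andP=> pb /IHw wx; rewrite -mulgA.
exact: leq_trans (nsyllM_le _ pb) _.
Qed.

Lemma nsyll_reduced w : reduced w -> nsyll (wprod w) = size w.
Proof.
elim: w => [_|[u b] w IHw] /=; first exact: nsyll1.
by case/and4P=> pb bn /eqP hw /IHw <-; apply: (nsyllM_cons pb).
Qed.

Lemma syll_size_reduced u w : reduced w ->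
  size (syll u (wprod w)) = count (fun a => a.1 == u) w.
Proof.
elim: w => [_|[t b] w IHw] /=; first by rewrite syll1.
case/and4P=> pb bn /eqP hw /IHw <-; case: eqVneq => [tu|tu].
  by rewrite -tu syllM_cons.
by rewrite size_syll_translate //; apply: par_setC pb.
Qed.

Lemma nsyll_wprod w : syllabic w -> nsyll (wprod w) <= size w.
Proof. by move=> /(nsyll_wprod_le 1); rewrite mulg1 nsyll1 addn0. Qed.

Lemma reduced_nsyll w : syllabic w -> size w <= nsyll (wprod w) -> reduced w.
Proof.
elim: w => [//|[u b] w IHw] /= /andP[pb sw] lew.
have le1 := nsyllM_le (wprod w) pb; have le2 := nsyll_wprod sw.
have [bn hw] : b != 1 /\ hd u (wprod w) = 1 by apply: (nsyllM_eq pb); lia.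
by rewrite pb bn hw eqxx IHw //; lia.
Qed.

Lemma syll_split u w c b s : reduced w -> syll u (wprod w) = (c, b) :: s ->
  exists p q, [/\ w = p ++ (u, b) :: q, c = translate (wprod p) (base u) &
    u \notin map fst p].
Proof.
elim: w c b s => [|[t d] w IHw] c b s /=; first by rewrite syll1.
case/and4P=> pd dn /eqP hw rw; case: (eqVneq t u) => [tu|tu].
  rewrite -tu syllM_cons // => -[<- <- _].
  by exists [::], w; rewrite /= translate1.
rewrite syll_translate; last exact: par_setC pd.
case E: (syll u (wprod w)) => [//|[c' b'] s'] /= [<- <- _].
have [p [q [-> -> up]]] := IHw _ _ _ rw E.
exists ((t, d) :: p), q; split=> //=; first by rewrite translateM.
by rewrite inE negb_or up eq_sym tu.
Qed.

Lemma hd_split u w : reduced w -> hd u (wprod w) != 1 ->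
  exists p q, [/\ w = p ++ (u, hd u (wprod w)) :: q, par (link1 e u) (wprod p) &
    u \notin map fst p].
Proof.
move=> rw; rewrite /hd; case E: (syll u (wprod w)) => [|[c b] s]; rewrite ?eqxx //.
have [p [q [-> -> up]]] := syll_split rw E.
by rewrite translate_base; case: ifP => [pp _|]; [exists p, q | rewrite eqxx].
Qed.

Lemma syllabic_cat p q : syllabic (p ++ q) = syllabic p && syllabic q.
Proof. exact: all_cat. Qed.

(* If a syllable could be merged with a later one, the product of the         *)
(* syllables in between would lie in the subgroup on the link, so that the    *)
(* merged word would be a shorter word for the same element.                  *)
Lemma reduced_min w : syllabic w ->
  (forall p, syllabic p -> wprod p = wprod w -> size w <= size p) -> reduced w.
Proof.
elim: w => [//|[u b] w IHw] /= /andP[pb sw] min_w.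
have rw : reduced w.
  by apply: IHw => // p sp pw; apply: (min_w ((u, b) :: p)); rewrite /= ?pb ?pw.
rewrite pb rw andbT; case: eqVneq => [b1|_] /=.
  by have := min_w _ sw; rewrite b1 mul1g ltnn => ->.
apply: contraT => /(hd_split rw) [p [q []]].
move: (hd u (wprod w)) (hd_par_set u (wprod w)) => z pz wE pp up.
have [sp sq] : syllabic p /\ syllabic q.
  by move: sw; rewrite wE syllabic_cat /= => /and3P[].
have bp : wprod p * b = b * wprod p.
  by apply: par_comm pp pb => s t; rewrite !inE => us /eqP->; rewrite e_sym.
have E : wprod (p ++ (u, b * z) :: q) = b * wprod w.
  by rewrite wE !wprod_cat /= !mulgA bp.
have s' : syllabic (p ++ (u, b * z) :: q) by rewrite syllabic_cat /= sp sq parM.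
by have := min_w _ s' E; rewrite wE !size_cat /=; lia.
Qed.

Lemma exists_reduced x : exists2 w, reduced w & wprod w = x.
Proof.
have ex_n : exists n, `[< exists w, [/\ syllabic w, wprod w = x & size w = n] >].
  suff [w [sw wx]] : exists w, syllabic w /\ wprod w = x.
    by exists (size w); apply/asboolP; exists w.
  elim/gp_ind: x => [|u g x [w [sw wx]]]; first by exists [::].
  by exists ((u, gp_inj e g) :: w); rewrite /= sw wx par_inj ?inE.
case: (ex_minnP ex_n) => n /asboolP[w [sw wx wn]] min_n.
exists w => //; apply: reduced_min => // p sp pw; rewrite wn; apply: min_n.
by apply/asboolP; exists p; rewrite pw.
Qed.

Lemma nsyllM x y : nsyll (x * y) <= nsyll x + nsyll y.
Proof.
have [w rw <-] := exists_reduced x; rewrite (nsyll_reduced rw).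
exact: nsyll_wprod_le (reduced_syllabic rw).
Qed.

(** By [nsyllM], a piece with fewer syllables than letters would leave the whole word with too few
    syllables. *)
Lemma reduced_cat p q : reduced (p ++ q) -> reduced p /\ reduced q.
Proof.
move=> r; have n := nsyll_reduced r; have := reduced_syllabic r.
rewrite syllabic_cat => /andP[sp sq].
have np := nsyll_wprod sp; have nq := nsyll_wprod sq.
have := nsyllM (wprod p) (wprod q); rewrite -wprod_cat n size_cat => le.
by split; apply: reduced_nsyll => //; lia.
Qed.

Lemma nsyll_eq0 x : nsyll x = 0 -> x = 1.
Proof.
have [w rw <-] := exists_reduced x; rewrite (nsyll_reduced rw).
by move/size0nil->.
Qed.

Definition supp x : {set V} := [set u | syll u x != [::]].

Lemma par_supp S x : par S x = (supp x \subset S).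
Proof.
apply/idP/fintype.subsetP => [px u|Sx].
  rewrite inE; apply: contraNT => uS; rewrite syll_par //.
  by apply: par_sub px; apply/fintype.subsetP => t; rewrite !inE; apply: contraTneq => ->.
have [w rw xE] := exists_reduced x; rewrite -xE; apply: wprod_par.
  exact: reduced_syllabic.
move=> u uw; apply: Sx; rewrite inE -size_eq0 -xE syll_size_reduced // -lt0n.
by rewrite -has_count; case/mapP: uw => a aw ->; apply/hasP; exists a.
Qed.

Lemma supp_wprod w u : reduced w -> (u \in supp (wprod w)) = (u \in map fst w).
Proof.
move=> rw; rewrite inE -size_eq0 syll_size_reduced // -lt0n -has_count.
apply/hasP/mapP => [[a aw /eqP <-]|[a aw ->]]; by exists a.
Qed.

Lemma reduced_par S w a : reduced w -> par S (wprod w) -> a \in w -> a.1 \in S.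
Proof.
move=> rw; rewrite par_supp => /fintype.subsetP Sw aw; apply: Sw.
by rewrite supp_wprod //; apply/mapP; exists a.
Qed.

Lemma hd_split_link u w : reduced w -> hd u (wprod w) != 1 ->
  exists p q, [/\ w = p ++ (u, hd u (wprod w)) :: q, par (link1 e u) (wprod p) &
    {subset map fst p <= link1 e u}].
Proof.
move=> rw /(hd_split rw) [p [q [wE pp _]]]; exists p, q; split=> //.
have rp : reduced p by move: rw; rewrite wE => /reduced_cat[].
by move=> u' /mapP[a ap ->]; apply: reduced_par ap.
Qed.

(** The syllable [b] stays in front, and as [t] is not adjacent to [u] it blocks every syllable of
    [u]. *)
Lemma hdM_nonadj u t (b : GP) x : t != u -> ~~ e u t -> par [set t] b -> b != 1 ->
  hd t x = 1 -> hd u (b * x) = 1.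
Proof.
move=> tu ut pb bn hx; have [w rw xE] := exists_reduced x; apply/eqP.
have rbw : reduced ((t, b) :: w) by rewrite /= pb bn xE hx eqxx.
rewrite -xE -[b * _]/(wprod ((t, b) :: w)).
apply: contraT => /(hd_split_link rbw)[[|a p] [q [[tE _] pq sp]]].
  by rewrite tE eqxx in tu.
by have := sp t; rewrite -tE inE eqxx inE (negPf ut) => /(_ isT).
Qed.

End Words.

Lemma cat_eq_cat_cons (A : Type) (p q r s : seq A) c : p ++ q = r ++ c :: s ->
  (exists s', p = r ++ c :: s') \/ (exists2 r', r = p ++ r' & q = r' ++ c :: s).
Proof.
elim: p r => [|a p IHp] [|b r] /= E; try by right; exists (b :: r).
- by right; exists [::].
- by case: E => -> _; left; exists p.
case: E => <- /IHp[[s' ->]|[r' -> ->]]; first by left; exists s'.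
by right; exists r'.
Qed.

Lemma nsyllV x : nsyll x^-1 = nsyll x.
Proof.
suff le y : nsyll y^-1 <= nsyll y.
  by apply/eqP; rewrite eqn_leq le -{1}[x]invgK le.
have [w rw <-] := exists_reduced y; rewrite (nsyll_reduced rw).
elim: w {rw}(reduced_syllabic rw) => [|[u b] w IHw] /=.
  by rewrite invg1 nsyll1.
case/andP=> pb /IHw lew; rewrite invgM.
apply: leq_trans (nsyllM _ _) _; rewrite -addn1 leq_add //.
by have := nsyllM_le 1 (parVr pb); rewrite mulg1 nsyll1.
Qed.

Lemma link_setC u : link1 e u \subset [set~ u].
Proof. by apply/fintype.subsetP => t; rewrite !inE; apply: contraTneq => ->; rewrite e_irr. Qed.

(** Syllables merge across the product only if some factor has one movable to the right end of [x]
    and one movable to the left end of [y]. The proof shows that reduced words for [x] and [y]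
    concatenate to a reduced word. *)
Lemma nsyllM_add x y :
  (forall u, hd u x^-1 = 1 \/ hd u y = 1) -> nsyll (x * y) = nsyll x + nsyll y.
Proof.
have [p rp xE] := exists_reduced x; have [q rq yE] := exists_reduced y => hxy.
suff rpq : reduced (p ++ q).
  by rewrite -xE -yE -wprod_cat !nsyll_reduced // size_cat.
suff: forall p0 p1, p = p0 ++ p1 -> reduced (p1 ++ q) by move=> H; apply: (H [::]).
move=> p0 p1; elim: p1 p0 => [//|[u g] p1 IHp] p0 pE /=.
have rp1q : reduced (p1 ++ q) by apply: (IHp (rcons p0 (u, g))); rewrite cat_rcons.
have := rp; rewrite pE => /reduced_cat[_] /= /and4P[pg gn /eqP hp1 rp1].
rewrite pg gn rp1q andbT; apply: contraT => /(hd_split_link rp1q).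
have hdE (r : seq (V * GP)) (z : GP) s : par (link1 e u) (wprod r) -> reduced (r ++ (u, z) :: s) ->
    hd u (wprod (r ++ (u, z) :: s)) = z.
  move=> pr /reduced_cat[_] /= /and4P[pz _ /eqP hs _].
  by rewrite wprod_cat hd_link //= hdM // hs mulg1.
set z := hd _ _ => -[r [s [E pr sr]]].
have zn : z != 1 by have := rp1q; rewrite E => /reduced_cat[_] /= /and4P[].
(* The syllable able to merge with [g] lies either in [p1], against the reducedness of [p], or in
   [q], and is then at the left end of [y]. *)
have [[s' p1E]|[r' rE qE]] := cat_eq_cat_cons E.
  by move: hp1 rp1 zn; rewrite p1E => + /(hdE _ _ _ pr) => -> ->; rewrite eqxx.
have [sp1 sr'] : {subset map fst p1 <= link1 e u} /\ {subset map fst r' <= link1 e u}.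
  by split=> t tp; apply: sr; rewrite rE map_cat mem_cat tp ?orbT.
have pr' : par (link1 e u) (wprod r').
  apply: wprod_par => //; move: rq; rewrite qE => /reduced_cat[+ _].
  exact: reduced_syllabic.
have hy : hd u y != 1 by rewrite -yE qE hdE // -qE.
have pp1 : par (link1 e u) (wprod p1).
  by apply: wprod_par => //; apply: reduced_syllabic.
(* As [g] commutes with [wprod p1], it can be moved to the right end of [x]. *)
have xE' : x^-1 = g^-1 * (wprod p0 * wprod p1)^-1.
  rewrite -invgM -xE pE wprod_cat /= -mulgA; congr (_ * _)^-1.
  by apply: par_comm pg pp1 => s1 t /set1P->; rewrite inE.
set y0 := (wprod p0 * wprod p1)^-1 in xE'.
have ny0 : nsyll y0 <= size p0 + size p1.
  rewrite nsyllV -wprod_cat -size_cat; apply: nsyll_wprod.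
  move: (reduced_syllabic rp); rewrite pE !syllabic_cat /= => /andP[-> /andP[_]].
  exact.
have nx : nsyll x^-1 = (size p0 + size p1).+1.
  by rewrite nsyllV -xE nsyll_reduced // pE size_cat /= addnS.
have pgV : par [set u] g^-1 by apply: parVr.
have [_ hy0] : g^-1 != 1 /\ hd u y0 = 1.
  apply: nsyllM_eq => //; have := nsyllM_le y0 pgV; rewrite -xE' nx => le.
  by congr _.+1; apply/eqP; rewrite eqn_leq ny0 andbT.
case: (hxy u) => [|hy1]; last by rewrite hy1 eqxx in hy.
rewrite xE' hdM // hy0 mulg1 => /eqP; rewrite invg_eq1 => g1.
by rewrite g1 in gn.
Qed.

(** The list of [x * a] is computed by acting with [x] on that of [a], which is empty. *)
Lemma syll_mulr u x (a : GP) : par [set~ u] a -> syll u (x * a) = syll u x.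
Proof.
move=> pa; elim/gp_ind: x => [|t g x IHx]; first by rewrite mul1g syll1 syll_par.
rewrite -mulgA; have [tu|tu] := eqVneq t u.
  have pg : par [set u] (gp_inj e g) by apply: par_inj; rewrite inE tu.
  by rewrite !(syllMl _ pg) IHx.
have pg : par [set~ u] (gp_inj e g) by apply: par_inj; rewrite !inE.
by rewrite !(syll_translate _ pg) IHx.
Qed.

(* [rr S x]: no syllable of x can be moved to its right end and belongs to a  *)
(* factor in S, i.e. x is the shortest element of its coset [x * par S].      *)
Definition rr S x := [forall u in S, hd u x^-1 == 1].

Lemma rrP S x : reflect {in S, forall u, hd u x^-1 = 1} (rr S x).
Proof. by apply: (iffP forall_inP) => H u /H /eqP. Qed.

Lemma rr_par_add S t l : rr S t -> par S l -> nsyll (t * l) = nsyll t + nsyll l.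
Proof.
move=> /rrP rt pl; apply: nsyllM_add => u.
have [uS|uS] := boolP (u \in S); [left; exact: rt | right].
apply: hd_par; apply: par_sub pl; apply/fintype.subsetP => s.
by rewrite !inE; apply: contraTneq => ->.
Qed.

Lemma rr1 S : rr S (1 : GP).
Proof. by apply/rrP => u _; rewrite invg1 /hd syll1. Qed.

Lemma rr_exists S x : exists t l, [/\ x = t * l, rr S t & par S l].
Proof.
have [n] := ubnP (nsyll x); elim: n x => // n IHn x lex.
have [rx|] := boolP (rr S x); first by exists x, 1; rewrite mulg1 par1.
rewrite negb_forall_in => /exists_inP[u uS hu].
set b := hd u x^-1 in hu.
have pb : par [set u] b by apply: hd_par_set.
have pbS : par S b by apply: par_sub pb; rewrite finset.sub1set.
have hb : hd u (b^-1 * x^-1) = 1 by rewrite hdM ?parV // mulVg.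
have nb : nsyll x = (nsyll (x * b)).+1.
  by rewrite -nsyllV -[x^-1](mulVKg b) (nsyllM_cons pb hu hb) -invgM nsyllV.
have [|t [l [xbE rt pl]]] := IHn (x * b); first by rewrite -nb.
exists t, (l * b^-1); split=> //; last by rewrite parM ?parV.
by rewrite mulgA -xbE mulgK.
Qed.

(** Each of [t] and [t'] is the other one times an element of [par S]; adding syllables both ways
    forces that element to have none. *)
Lemma rr_uniq S t l t' l' : rr S t -> par S l -> rr S t' -> par S l' ->
  t * l = t' * l' -> t = t' /\ l = l'.
Proof.
move=> rt pl rt' pl' E; suff tt' : t = t'.
  by split=> //; move: E; rewrite tt' => /mulgI.
have tE : t = t' * (l' / l) by rewrite mulgA -E mulgK.
have t'E : t' = t * (l / l') by rewrite mulgA E mulgK.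
have := rr_par_add rt' (parM pl' (parVr pl)).
have := rr_par_add rt (parM pl (parVr pl')); rewrite -tE -t'E => n1 n2.
have /nsyll_eq0 l1 : nsyll (l' / l) = 0 by lia.
by rewrite tE l1 mulg1.
Qed.

Lemma rr_par S t : rr S t -> par S t -> t = 1.
Proof. by move=> rt pt; case: (@rr_uniq S t 1 1 t) => //; rewrite ?par1 ?rr1 ?mulg1 ?mul1g. Qed.

(** What precedes the first [s]-syllable of [y], or all of [y] if there is none, lies outside
    [par (link1 e s)] and blocks the way to the front. Appending [x] can only change that syllable,
    or cancel it when it is the only one. *)
Lemma hd_inv_mul s x y : par [set s] x -> hd s y = 1 -> ~~ par (link1 e s) y ->
  hd s (y * x) = 1.
Proof.
move=> px; have [w rw <-] := exists_reduced y.
have [n] := ubnP (size w); elim: n w rw => // n IHn w rw lew hw.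
have [->|xn] := eqVneq x 1; first by rewrite mulg1.
have sx : syll s x = [:: (base s, x)].
  by rewrite -[x]mulg1 syllM_cons // ?mulg1 ?syll1 // /hd syll1.
case E: (syll s (wprod w)) => [|[c b] t] npw.
  have pw : par [set~ s] (wprod w).
    by rewrite par_supp; apply/fintype.subsetP => u; rewrite !inE; apply: contraNneq => ->; rewrite E.
  by rewrite /hd syll_translate // sx /= translate_base (negPf npw).
have [p [q [wE cE sp]]] := syll_split rw E.
have := rw; rewrite wE => /reduced_cat[rp] /= /and4P[pb bn /eqP hq rq].
have pp : par [set~ s] (wprod p).
  apply: wprod_par (reduced_syllabic rp) _ => u up.
  by rewrite !inE; apply: contraNneq sp => <-.
have npp : ~~ par (link1 e s) (wprod p).
  move: hw; rewrite /hd E; case: eqP => [_ b1|/eqP]; first by rewrite b1 eqxx in bn.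
  by rewrite cE translate_base.
have hdp z r : syll s (b * (wprod q * x)) = (base s, z) :: r \/
    syll s (b * (wprod q * x)) = [::] -> hd s (wprod p * (b * (wprod q * x))) = 1.
  by rewrite /hd (syll_translate _ pp) => -[] -> //=; rewrite translate_base (negPf npp).
rewrite wprod_cat /= -!mulgA.
have [pq|npq] := boolP (par (link1 e s) (wprod q)).
  have bqx : syll s (b * (wprod q * x)) = add_syllable s b [:: (base s, x)].
    rewrite syllMl // syll_translate ?sx /=.
      by congr (add_syllable _ _ [:: (_, _)]); apply/eqP; rewrite translate_base.
    exact: par_sub (link_setC s) pq.
  move: bqx; rewrite /= eqxx; case: eqVneq => _ bqx; last by apply: hdp; left; exact: bqx.
  by apply: (hdp 1 [::]); right.
apply: hdp; left; apply: syllM_cons => //; apply: IHn => //.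
move: lew; rewrite wE size_cat /= addnS ltnS; exact: leq_ltn_trans (leq_addl _ _).
Qed.

(** The analogue of Deodhar's lemma on minimal coset representatives in Coxeter groups: in [x * t]
    only the syllable [x] could newly reach the right end, and for that it would have to commute
    past all of [t]. *)
Lemma rr_dichotomy S s x t : s \in S -> rr S t -> par [set s] x ->
  par (link1 e s) t \/ rr S (x * t).
Proof.
move=> sS /rrP rt px; have [pt|npt] := boolP (par (link1 e s) t); [by left | right].
apply/rrP => u uS; rewrite invgM; have [->|us] := eqVneq u s.
  by apply: hd_inv_mul; rewrite ?parV ?rt.
have px' : par [set~ u] x^-1.
  by rewrite parV; apply: par_setC px; rewrite eq_sym.
by rewrite /hd syll_mulr // -/(hd u t^-1) rt.
Qed.

Lemma par_suppT x : par (supp x) x.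
Proof. by rewrite par_supp. Qed.

Lemma par_link S x : {in S, forall u, par (link1 e u) x} -> par (link e S) x.
Proof.
move=> Sx; rewrite par_supp; apply/finset.bigcapsP => u uS.
by rewrite -par_supp Sx.
Qed.

Lemma par_link1 S u x : u \in S -> par (link e S) x -> par (link1 e u) x.
Proof. by move=> uS; apply: par_sub; apply: finset.bigcap_inf. Qed.

Lemma par_link_comm S x y : par S x -> par (link e S) y -> x * y = y * x.
Proof.
move=> px py; apply: par_comm px py => u t uS /finset.bigcapP/(_ u uS).
by rewrite inE.
Qed.

(** The syllables of [x] meet [t] one by one, the rightmost first. By [rr_dichotomy] each is either
    absorbed into the representative or passes it unchanged; no syllable is lost only if all of them
    commute with [t]. *)
Lemma push S x t : par S x -> rr S t -> exists t' x',
  [/\ x * t = t' * x', rr S t', par S x', nsyll x' <= nsyll x &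
   nsyll x' = nsyll x -> [/\ x' = x, t' = t & par (link e (supp x)) t]].
Proof.
have [w rw <-] := exists_reduced x; elim: w t rw => [|[s y] w IHw] t /=.
  move=> _ _ rt; exists t, 1; split; rewrite ?mul1g ?mulg1 ?par1 //.
  by split=> //; apply: par_link => u; rewrite inE syll1.
case/and4P=> py yn /eqP hw rw pS rt.
have rsw : reduced ((s, y) :: w) by rewrite /= py yn hw eqxx.
have sS : s \in S := reduced_par (a := (s, y)) rsw pS (mem_head _ _).
have pSy : par S y by apply: par_sub py; rewrite finset.sub1set.
have pSw : par S (wprod w) by rewrite -(parMl _ pSy).
have [t1 [x1 [E rt1 px1 le1 eq1]]] := IHw t rw pSw rt.
have nyw : nsyll (y * wprod w) = (nsyll (wprod w)).+1 by apply: nsyllM_cons py _ _.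
have nyx := nsyllM_le x1 py.
have [pt1|ryt1] := rr_dichotomy sS rt1 py; last first.
  exists (y * t1), x1; split=> //; first by rewrite -mulgA E mulgA.
    by rewrite nyw ltnW.
  by rewrite nyw => nE; move: le1; rewrite nE ltnn.
have yt1 : y * t1 = t1 * y.
  by apply: par_comm py pt1 => u u' /set1P->; rewrite inE.
exists t1, (y * x1); split=> //.
- by rewrite -mulgA E !mulgA yt1.
- exact: parM.
- by rewrite nyw (leq_trans nyx).
rewrite nyw => nE; have [|x1E t1E pt] := eq1.
  by apply/eqP; rewrite eqn_leq le1 -ltnS -nE nyx.
split=> //; first by rewrite x1E.
apply: par_link => u; rewrite -[y * _]/(wprod ((s, y) :: w)) supp_wprod //= inE.
case/predU1P=> [->|uw]; first by rewrite -t1E.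
by apply: par_link1 pt; rewrite supp_wprod.
Qed.

Lemma size_syll_subM u x y :
  size (syll u (x * y)) <= size (syll u x) + size (syll u y).
Proof.
have [w rw <-] := exists_reduced x; rewrite (syll_size_reduced u rw).
elim: w {rw}(reduced_syllabic rw) => [|[t b] w IHw] /=; first by rewrite mul1g.
case/andP=> pb /IHw le; rewrite -mulgA; case: eqVneq => [tu|tu].
  by subst t; apply: leq_trans (size_syllM _ pb) _.
by rewrite (size_syll_translate _ (par_setC tu pb)).
Qed.

(** * Normal forms of the amalgam at a vertex *)

Section AlternatingProducts.
Variable v : V.
Local Notation L := (link1 e v).
Local Notation A := [set~ v].
Implicit Types (r s : seq (GP * GP)) (t b : GP).

Let LA : L \subset A. Proof. exact: link_setC. Qed.

Definition altprod s : GP := foldr (fun p x => p.1 * (p.2 * x)) 1 s.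

Lemma altprod_cat r s : altprod (r ++ s) = altprod r * altprod s.
Proof. by elim: r => [|p r IHr] /=; rewrite ?mul1g // IHr !mulgA. Qed.

Definition transv t := rr L t && par A t.

Definition wletter (p : GP * GP) := [&& transv p.1, par [set v] p.2 & p.2 != 1].

Definition letter (p : GP * GP) := wletter p && (p.1 != 1).

(* Every element is [altprod r * a], for a unique alternating r and a unique  *)
(* a in [par A]: this is the normal form for the amalgam over [par L].        *)
Definition alternating r := all wletter r && all letter (behead r).

Lemma letter_w p : letter p -> wletter p. Proof. by case/andP. Qed.

Lemma all_letter_w s : all letter s -> all wletter s.
Proof. by apply: sub_all => p; apply: letter_w. Qed.

Lemma letters_alternating s : all letter s -> alternating s.
Proof.
move=> ls; rewrite /alternating all_letter_w //=.
by case: s ls => //= p s /andP[].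
Qed.

Lemma alternating_cons p s : wletter p -> all letter s -> alternating (p :: s).
Proof. by move=> wp ls; rewrite /alternating /= wp all_letter_w. Qed.

Lemma alternating_cat r s : r != [::] -> alternating r -> all letter s ->
  alternating (r ++ s).
Proof.
case: r => // p r _ /andP[/= /andP[wp _] lr] ls.
by apply: alternating_cons; rewrite // all_cat lr.
Qed.

Lemma alternatingP p r : alternating (p :: r) = wletter p && all letter r.
Proof.
rewrite /alternating /=; case: (wletter p) => //=; case lr: (all letter r); last by rewrite andbF.
by rewrite all_letter_w.
Qed.

Lemma comm_linkv x b : par L x -> par [set v] b -> x * b = b * x.
Proof.
by move=> px pb; apply: par_comm px pb => u t uL /set1P->; move: uL; rewrite inE e_sym.
Qed.

(** Iterates [push]: whatever is left of [x] after a representative still lies in [par L] and so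
    passes the next syllable of [v] freely. *)
Lemma push_letters x s : par L x -> all letter s -> exists s' x',
  [/\ x * altprod s = altprod s' * x', all letter s' /\ size s' = size s,
      par L x', nsyll x' <= nsyll x &
      nsyll x' = nsyll x ->
        [/\ x' = x, s' = s & all (fun p => par (link e (supp x)) p.1) s]].
Proof.
elim: s x => [|[t b] s IHs] x px /=; first by exists [::], x; rewrite mulg1 mul1g.
case/andP=> /andP[/and3P[/= /andP[rt pt] pb bn] tn] ls.
have [t1 [x1 [E1 rt1 px1 le1 eq1]]] := push px rt.
have [s2 [x2 [E2 [ls2 sz2] px2 le2 eq2]]] := IHs x1 px1 ls.
have pAx : par A x := par_sub LA px; have pAx1 : par A x1 := par_sub LA px1.
exists ((t1, b) :: s2), x2; split=> /=.
- by rewrite mulgA E1 -!mulgA -E2 (mulgA x1 b) (comm_linkv px1 pb) -(mulgA b x1).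
- split; last by rewrite sz2.
  rewrite ls2 /letter /wletter /transv /= rt1 pb bn !andbT /=; apply/andP; split.
    by rewrite -(parMr _ pAx1) -E1 parM.
  apply: contraNneq tn => t10; apply/eqP/(rr_par rt).
  by rewrite -(parMl _ px) E1 t10 mul1g.
- by [].
- exact: leq_trans le2 le1.
move=> nE; have nE1 : nsyll x1 = nsyll x by apply/eqP; rewrite eqn_leq le1 -nE le2.
have [x1E t1E plt] := eq1 nE1; have [|x2E s2E pls] := eq2; first by rewrite nE1.
by rewrite x2E s2E t1E x1E plt -[in all _ s]x1E pls.
Qed.

Lemma push_alternating a r : r != [::] -> par A a -> alternating r ->
  exists r' x', [/\ a * altprod r = altprod r' * x', alternating r',
    size r' = size r & par L x'].
Proof.
case: r => // -[t b] s _ pa; rewrite alternatingP => /andP[/and3P[/= /andP[rt pt] pb bn] ls].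
have [t1 [x1 [E1 rt1 px1]]] := rr_exists L (a * t).
have pAx1 : par A x1 := par_sub LA px1.
have [s2 [x2 [E2 [ls2 sz2] px2 _ _]]] := push_letters px1 ls.
exists ((t1, b) :: s2), x2; split=> //=.
- by rewrite mulgA E1 -!mulgA -E2 (mulgA x1 b) (comm_linkv px1 pb) -(mulgA b x1).
- apply: alternating_cons => //; rewrite /wletter /transv /= rt1 pb bn !andbT /=.
  by rewrite -(parMr _ pAx1) -E1 parM.
by rewrite sz2.
Qed.

Lemma transv1 : transv 1. Proof. by rewrite /transv rr1 par1. Qed.

Lemma mul_alternating b r : par [set v] b -> alternating r ->
  exists2 r', alternating r' & b * altprod r = altprod r'.
Proof.
move=> pb; have [->|bn] := eqVneq b 1; first by move=> ar; exists r; rewrite ?mul1g.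
case: r => [|[t b1] s].
  move=> _; exists [:: (1, b)]; rewrite /= ?mul1g //.
  by apply: alternating_cons; rewrite // /wletter /= transv1 pb bn.
have [->|tn] := eqVneq t 1; rewrite alternatingP.
  case/andP=> /and3P[/= _ pb1 _] ls; rewrite /= mul1g.
  have [bb1|bb1] := eqVneq (b * b1) 1.
    by exists s; rewrite ?letters_alternating // mulgA bb1 mul1g.
  exists ((1, b * b1) :: s); rewrite /= ?mul1g ?mulgA //.
  by apply: alternating_cons; rewrite // /wletter /= transv1 parM.
case/andP=> wp ls; exists [:: (1, b), (t, b1) & s]; rewrite /= ?mul1g //.
by apply: alternating_cons; rewrite /= /wletter /= ?transv1 ?pb // ls /letter wp tn.
Qed.

Lemma exists_alternating x :
  exists r a, [/\ x = altprod r * a, alternating r & par A a].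
Proof.
elim/gp_ind: x => [|u g x [r [a [-> ar pa]]]].
  by exists [::], 1; rewrite mulg1 par1.
have [uv|uv] := eqVneq u v.
  have pg : par [set v] (gp_inj e g) by apply: par_inj; rewrite inE uv.
  by have [r' ar' E] := mul_alternating pg ar; exists r', a; rewrite mulgA E.
have pg : par A (gp_inj e g) by apply: par_inj; rewrite !inE.
have [->|rn] := eqVneq r [::].
  by exists [::], (gp_inj e g * a); rewrite /= !mul1g parM.
have [r' [x' [E ar' _ px']]] := push_alternating rn pg ar.
exists r', (x' * a); rewrite mulgA E mulgA; split=> //.
by apply: parM => //; apply: par_sub px'.
Qed.

Lemma hd_letters s x : all letter s -> hd v x = 1 -> hd v (altprod s * x) = 1.
Proof.
elim: s => [|[t b] s IHs] /=; first by rewrite mul1g.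
case/andP=> /andP[/and3P[/= /andP[rt pt] pb bn] tn] ls /(IHs ls) hx.
rewrite -!mulgA /hd syll_translate // syllM_cons //= translate_base.
by case: ifP => // /(rr_par rt) t1; rewrite t1 eqxx in tn.
Qed.

Lemma size_syll_cons p x : wletter p -> hd v x = 1 ->
  size (syll v (p.1 * (p.2 * x))) = (size (syll v x)).+1.
Proof.
case: p => t b /and3P[/= /andP[_ pt] pb bn] hx.
by rewrite size_syll_translate // syllM_cons.
Qed.

Lemma size_syll_alternating r x : alternating r -> hd v x = 1 ->
  size (syll v (altprod r * x)) = size r + size (syll v x).
Proof.
elim: r => [|p r IHr]; first by rewrite /= mul1g.
rewrite alternatingP => /andP[wp lr] hx /=; rewrite -!mulgA size_syll_cons //.
  by rewrite IHr ?letters_alternating // addSn.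
exact: hd_letters.
Qed.

(** The first entry of [syll v] records the coset [t L] and the syllable [b], and a coset has only
    one shortest element. *)
Lemma altprod_peel p q x y : wletter p -> wletter q -> hd v x = 1 -> hd v y = 1 ->
  p.1 * (p.2 * x) = q.1 * (q.2 * y) -> p = q /\ x = y.
Proof.
case: p q => t b [t' b'] /and3P[/= /andP[rt pt] pb bn] /and3P[/= /andP[rt' pt'] pb' bn'].
move=> hx hy /= E; have := congr1 (syll v) E; rewrite (syll_translate _ pt) (syll_translate _ pt').
rewrite (syllM_cons pb bn hx) (syllM_cons pb' bn' hy) /=.
case=> /translate_base_eq ptt' bb' _.
have [tt' _] : t = t' /\ t^-1 * t' = 1.
  by apply: rr_uniq rt ptt' rt' (par1 _ _ _) _; rewrite mulVKg mulg1.
by move: E; rewrite tt' => /mulgI; rewrite bb' => /mulgI ->.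
Qed.

Lemma altprod_uniq r s x y : all letter r -> all letter s -> size r = size s ->
  hd v x = 1 -> hd v y = 1 ->
  altprod r * x = altprod s * y -> r = s /\ x = y.
Proof.
move=> + + + hx hy; elim: r s => [|p r IHr] [|q s] //=.
  by rewrite !mul1g.
case/andP=> lp lr /andP[lq ls] [sz]; rewrite -!mulgA.
case/(altprod_peel (letter_w lp) (letter_w lq)); try exact: hd_letters.
by move=> -> /IHr[] // -> ->.
Qed.

End AlternatingProducts.

(** * Conjugacy *)

Section ConjugacyClasses.
Variable v : V.
Local Notation L := (link1 e v).
Local Notation A := [set~ v].
Implicit Types (r s : seq (GP * GP)) (l : GP).

Let LA : L \subset A. Proof. exact: link_setC. Qed.

(** Stated through the support of [l] rather than as commutation, so that it passes to every element
    of smaller support ([par_linkS]). *)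
Definition strong_comm l s := all (fun p => par (link e (supp l)) p.1) s.

Lemma strong_commP l s : all (letter v) s -> par L l -> strong_comm l s ->
  l * altprod s = altprod s * l.
Proof.
move=> + pl; elim: s => [|[t b] s IHs] /=; first by rewrite mulg1 mul1g.
case/andP=> /andP[/and3P[/= _ pb _] _] ls /andP[plt /IHs-/(_ ls) IH].
rewrite mulgA (par_link_comm (par_suppT l) plt) -(mulgA t l) (mulgA l b).
by rewrite (comm_linkv pl pb) -(mulgA b l) IH !mulgA.
Qed.

Lemma strong_commX l s m : all (letter v) s -> par L l -> strong_comm l s ->
  l * altprod s ^+ m = altprod s ^+ m * l.
Proof.
by move=> ls pl sl; apply: (@commuteX _ l (altprod s) m); apply: strong_commP.
Qed.

(* Pushing x through s can only delete syllables of x, and when none is       *)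
(* deleted all of them commute with s.                                        *)
Lemma stabilize x s : all (letter v) s -> par L x -> exists m s' x',
  [/\ x * altprod s ^+ m = altprod s' * x', all (letter v) s', par L x' &
   strong_comm x' s].
Proof.
move=> ls; have [n] := ubnP (nsyll x); elim: n x => // n IHn x ltn px.
have [s1 [x1 [E1 [ls1 _] px1 le1 eq1]]] := push_letters px ls.
have [nE|nE] := eqVneq (nsyll x1) (nsyll x).
  by exists 0, [::], x; split=> //; [rewrite mulg1 mul1g | case: (eq1 nE)].
have lt1 : nsyll x1 < nsyll x by rewrite ltn_neqAle nE.
have [m [s2 [x2 [E2 ls2 px2 sc]]]] := IHn x1 (leq_trans lt1 ltn) px1.
exists m.+1, (s1 ++ s2), x2; split=> //; last by rewrite all_cat ls1.
by rewrite expgS mulgA E1 -mulgA E2 altprod_cat mulgA.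
Qed.

(** Induction on the letters of [y]: a letter of [v] is multiplied onto the front, any other one is
    pushed through [r], and its remainder runs into further copies of [s] until [stabilize] stops
    it. *)
Lemma absorb y s : s != [::] -> all (letter v) s -> exists m r x,
  [/\ y * altprod s ^+ m = altprod r * x, alternating v r, par L x &
   strong_comm x s].
Proof.
move=> sn ls; elim/gp_ind: y => [|u g y [m [r [x [E ar px sc]]]]].
  exists 0, [::], 1; split; rewrite ?mulg1 ?par1 //.
  by apply/allP => p _; apply: par_link => u; rewrite inE syll1.
have [uv|uv] := eqVneq u v.
  have pg : par [set v] (gp_inj e g) by apply: par_inj; rewrite inE uv.
  have [r' ar' E'] := mul_alternating pg ar.
  by exists m, r', x; rewrite -mulgA E mulgA E'.
have pg : par A (gp_inj e g) by apply: par_inj; rewrite !inE.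
have rsn : r ++ s != [::] by rewrite -size_eq0 size_cat addn_eq0 !size_eq0 negb_and sn orbT.
have ars : alternating v (r ++ s).
  have [->|rn] := eqVneq r [::]; first exact: letters_alternating.
  exact: alternating_cat.
have [r1 [x1 [E1 ar1 sz1 px1]]] := push_alternating rsn pg ars.
have [m' [s' [x' [E' ls' px' sc']]]] := stabilize ls (parM px1 px).
(* The extra copy of [s] makes the alternating word [r ++ s] nonempty, as [push_alternating]
   requires. *)
exists (m.+1 + m'), (r1 ++ s'), x'; split=> //; last first.
  apply: alternating_cat => //; rewrite -size_eq0 sz1 size_eq0 //.
rewrite expgnDr expgSr [LHS](_ : _ = gp_inj e g * ((y * altprod s ^+ m) * altprod s) * altprod s ^+ m'); last first.
  by rewrite !mulgA.
rewrite E -(mulgA _ x) strong_commP // (mulgA _ _ x) -altprod_cat (mulgA _ _ x) E1.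
by rewrite -(mulgA _ x1) -mulgA E' altprod_cat mulgA.
Qed.

Definition normal_elt y :=
  [\/ par A y,
      exists l b, [/\ par L l, par [set v] b, b != 1 & y = l * b] |
      exists s l, [/\ s != [::], all (letter v) s, par L l & y = altprod s * l]].

(** Conjugation brings [a] to the front, where it is pushed through the alternating word. If the
    first representative becomes trivial, the first syllable of [v] is carried around to meet the
    last one: either they merge, or they cancel and the word gets shorter. *)
Lemma conj_normal y : exists z, normal_elt (y ^ z).
Proof.
have [r [a [-> ar pa]]] := exists_alternating v y.
have [n] := ubnP (size r); elim: n r a ar pa => // n IHn r a ar pa ltn.
have step (p w : GP) : (exists z, normal_elt ((p ^ w) ^ z)) -> exists z, normal_elt (p ^ z).
  by case=> z; rewrite -conjgM => ?; exists (w * z).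
have swap (p q : GP) : (p * q) ^ p = q * p by rewrite conjgE -mulgA mulKg.
have [->|rn] := eqVneq r [::]; first by exists 1; rewrite mul1g conjg1; constructor.
apply: (step _ (altprod r)); rewrite swap.
have [r' [x [E ar' sz' px]]] := push_alternating rn pa ar.
rewrite E; case: r' ar' sz' {E} => [_ /esym/eqP|[t b] r1]; first by rewrite size_eq0 (negPf rn).
rewrite alternatingP => /andP[wp lr1] sz.
have [t1|tn] := eqVneq t 1; last first.
  exists 1; rewrite conjg1; apply: Or33; exists ((t, b) :: r1), x; split=> //=.
  by rewrite /letter wp tn.
have [pb bn] : par [set v] b /\ b != 1 by case/and3P: wp.
rewrite {}t1 /= mul1g in wp *.
case: (lastP r1) lr1 sz => [|r2 [t' b']] lr1 sz.
  exists 1; rewrite conjg1 /= mulg1; apply: Or32; exists x, b; split=> //.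
  by rewrite (comm_linkv px pb).
apply: (step _ b); rewrite -mulgA swap -mulgA (comm_linkv px pb).
move: lr1; rewrite -cats1 all_cat altprod_cat /= !andbT mulg1.
case/andP=> lr2 /andP[/and3P[/= /andP[rt' pt'] pb' bn'] tn'].
have pAx : par A x by apply: par_sub px.
have -> : altprod r2 * (t' * b') * (b * x) = altprod r2 * (t' * ((b' * b) * x)).
  by rewrite !mulgA.
have [->|bb] := eqVneq (b' * b) 1.
  rewrite mul1g; apply: IHn; first exact: letters_alternating.
    exact: parM.
  by move: sz ltn => /= <-; rewrite size_rcons !ltnS => /ltnW.
exists 1; rewrite conjg1; apply: Or33; exists (rcons r2 (t', b' * b)), x.
split=> //; first by rewrite -size_eq0 size_rcons.
  by rewrite all_rcons lr2 /letter /wletter /transv /= rt' pt' tn' bb parM.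
by rewrite -cats1 altprod_cat /= mulg1 !mulgA.
Qed.

(* Translation lengths are conjugacy invariants: for large powers, the        *)
(* conjugating element is negligible.                                         *)
Lemma conj_stable_le (f : GP -> nat) a b c g z :
  (forall x y, f (x * y) <= f x + f y) ->
  (forall m, m * a <= f (g ^+ m)) -> (forall m, f ((g ^ z) ^+ m) <= m * b + c) ->
  a <= b.
Proof.
move=> fM fa fb; rewrite leqNgt; apply/negP => ltba.
pose C := f z + c + f z^-1.
have le m : m * a <= m * b + C.
  apply: leq_trans (fa m) _.
  rewrite (_ : g ^+ m = z * ((g ^ z) ^+ m * z^-1)); last first.
    by rewrite -conjXg conjgE !mulgA mulgV mul1g mulgK.
  apply: leq_trans (fM _ _) _.
  have -> : m * b + C = f z + (m * b + c + f z^-1) by rewrite /C; clear; lia.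
  rewrite leq_add2l; exact: leq_trans (fM _ _) (leq_add (fb m) (leqnn _)).
(* If [a >= b + 1], the exponent [C + 1] already outgrows the overhead [C]. *)
have := le C.+1; have := leq_mul (leqnn C.+1) ltba.
by clear; lia.
Qed.

Lemma hd_A (a : GP) : par A a -> hd v a = 1. Proof. exact: hd_par. Qed.

Lemma altprodX s m : altprod s ^+ m = altprod (flatten (nseq m s)).
Proof. by elim: m => [//|m IHm]; rewrite expgS IHm /= altprod_cat. Qed.

Lemma all_flatten_nseq (T : Type) (P : pred T) (s : seq T) m :
  all P s -> all P (flatten (nseq m s)).
Proof. by move=> Ps; elim: m => //= m IHm; rewrite all_cat Ps. Qed.

Lemma size_flatten_nseq (T : Type) (s : seq T) m :
  size (flatten (nseq m s)) = (m * size s)%N.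
Proof. by elim: m => //= m IHm; rewrite size_cat IHm. Qed.

Lemma altprodlX s l m : all (letter v) s -> par L l -> strong_comm l s ->
  (altprod s * l) ^+ m = altprod (flatten (nseq m s)) * l ^+ m.
Proof.
move=> ls pl sc; rewrite expgMn ?altprodX //.
by apply/commute_sym; apply: strong_commP.
Qed.

Lemma parX S x m : par S x -> par S (x ^+ m).
Proof. by move=> px; elim: m => [|m IHm]; rewrite ?par1 // expgS parM. Qed.

Lemma size_syll_letters s x : all (letter v) s -> par A x ->
  size (syll v (altprod s * x)) = size s.
Proof.
move=> ls pa; rewrite size_syll_alternating ?letters_alternating ?hd_A //.
by rewrite syll_par // addn0.
Qed.

Lemma size_syllX s l m : all (letter v) s -> par L l -> strong_comm l s ->
  size (syll v ((altprod s * l) ^+ m)) = (m * size s)%N.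
Proof.
move=> ls pl sc; rewrite altprodlX // size_syll_letters ?size_flatten_nseq //.
  exact: all_flatten_nseq.
by apply: parX; apply: par_sub pl.
Qed.

Lemma conj_size_le s l s' l' z : all (letter v) s -> par L l -> strong_comm l s ->
  all (letter v) s' -> par L l' -> strong_comm l' s' ->
  (altprod s * l) ^ z = altprod s' * l' -> size s <= size s'.
Proof.
move=> ls pl sc ls' pl' sc' E.
apply: (conj_stable_le (f := fun x => size (syll v x)) (c := 0) (g := altprod s * l) (z := z)).
- by move=> x y; apply: size_syll_subM.
- by move=> m; rewrite size_syllX.
by move=> m; rewrite E size_syllX // addn0.
Qed.

(** The first pair of [r] must be that of [s']. Removing it from both sides moves it to the end of
    [s'], so each step of the induction on [r] is one rotation; once [r] is empty the normal forms
    coincide. *)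
Lemma conj_peel r s s' l' l2 : s != [::] -> alternating v r -> all (letter v) s ->
  all (letter v) s' -> size s = size s' -> par L l' -> strong_comm l' s' ->
  par L l2 -> altprod s' * (l' * altprod r) = altprod r * (altprod s * l2) ->
  (exists i, s = rot i s') /\ l2 = l'.
Proof.
move=> sn + ls + + pl' + pl2; have hl2 : hd v l2 = 1 by apply: hd_A; apply: par_sub pl2.
have hl' : hd v l' = 1 by apply: hd_A; apply: par_sub pl'.
elim: r s' => [|[t b] r IHr] s' ar ls' sz sc' /=.
  rewrite mul1g mulg1 => E; have [ss ll] := altprod_uniq ls' ls (esym sz) hl' hl2 E.
  by split=> //; exists 0; rewrite rot0.
case: s' ls' sz sc' => [|[t1 b1] s1] /=.
  by move=> _ /size0nil s0; rewrite s0 in sn.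
case/andP=> l1 ls1 sz /andP[/= sc1 sc']; have w1 := letter_w l1.
move: ar; rewrite alternatingP => /andP[wtb lr].
set Z := altprod s1 * (l' * (t * (b * altprod r))).
have [/andP[_ pt1] pb1 bn1] : [/\ transv v t1, par [set v] b1 & b1 != 1].
  by case/and3P: w1.
have hR : hd v (altprod r * (altprod s * l2)) = 1 by do 2!apply: hd_letters => //.
rewrite -!mulgA -/Z => E.
(* The right side of [E] is an alternating word; counting its [v]-syllables shows that [b1] cannot
   have merged with anything in [Z]. *)
have hZ : hd v Z = 1.
  apply: proj2 (size_syllM_eq (u := v) (b := b1) _ _) => //.
  apply/eqP; rewrite eqn_leq size_syllM //= -(size_syll_translate (b1 * Z) pt1) E.
  rewrite (size_syll_cons wtb hR) ltnS size_syll_alternating ?letters_alternating //; last exact: hd_letters.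
  rewrite size_syll_letters //; last exact: par_sub pl2.
  apply: leq_trans (size_syll_subM _ _ _) _.
  have -> : size (syll v (altprod s1)) = size s1.
    by rewrite -[altprod s1]mulg1 size_syll_letters ?par1.
  rewrite size_syll_translate; last exact: par_sub pl'.
  rewrite -[altprod r]mulg1 (size_syll_cons wtb) ?hd_letters ?hd_A ?par1 //.
  rewrite size_syll_letters ?par1 // sz addnS -addSn addnC; exact: leqnn.
have [[tt bb] ZE] := altprod_peel (p := (t1, b1)) (q := (t, b)) w1 wtb hZ hR E.
subst t1 b1.
have ls1' : all (letter v) (rcons s1 (t, b)) by rewrite all_rcons l1.
have [|||||[i sE] ll] := IHr (rcons s1 (t, b)).
- exact: letters_alternating.
- by [].
- by rewrite size_rcons.
- by rewrite /strong_comm all_rcons sc1.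
- rewrite -ZE /Z -cats1 altprod_cat /= mulg1 -!mulgA; congr (_ * _).
  rewrite (mulgA l') (par_link_comm (par_suppT l') sc1) -mulgA; congr (_ * _).
  by rewrite (mulgA l') (comm_linkv pl' pb1) -mulgA.
split=> //; rewrite sE; have <- : rot 1 ((t, b) :: s1) = rcons s1 (t, b).
  by rewrite rot1_cons.
by exists (rot_add ((t, b) :: s1) 1 i); rewrite rot_rot_add.
Qed.

(** Translation lengths give equal sizes. Then [absorb] replaces [z^-1] by an alternating product
    [altprod r] and some [x] in [par L], which conjugates [l] alone. *)
Lemma conj_letters_uniq s l s' l' z : s != [::] ->
  all (letter v) s -> par L l -> strong_comm l s ->
  all (letter v) s' -> par L l' -> strong_comm l' s' ->
  (altprod s * l) ^ z = altprod s' * l' ->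
  (exists i, s = rot i s') /\ exists x, l ^ x = l'.
Proof.
move=> sn ls pl sc ls' pl' sc' E.
have E' : (altprod s' * l') ^ z^-1 = altprod s * l by rewrite -E conjgK.
have sz : size s = size s'.
  by apply/eqP; rewrite eqn_leq (conj_size_le ls pl sc ls' pl' sc' E) (conj_size_le ls' pl' sc' ls pl sc E').
have [m [r [x [Ey ar px scx]]]] := absorb z^-1 sn ls.
have sl : altprod s * l = l * altprod s by rewrite strong_commP.
have E1 : altprod s' * l' * z^-1 = z^-1 * (altprod s * l).
  by rewrite -E conjgE -!mulgA mulgV mulg1.
have sm : altprod s * l * altprod s ^+ m = altprod s ^+ m * (altprod s * l).
  by rewrite -mulgA strong_commX // !mulgA -expgS expgSr.
(* The power of [altprod s] commutes with [altprod s * l], which lets [altprod r * x] take the place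
   of [z^-1]; and [x] commutes with [altprod s]. *)
have E2 : altprod s' * (l' * altprod r) = altprod r * (altprod s * (x * l * x^-1)).
  apply: (@mulIg _ x); rewrite -!mulgA mulVg mulg1 -Ey.
  rewrite (mulgA l') (mulgA (altprod s')) [altprod s' * (l' * _)]mulgA E1.
  rewrite -mulgA sm (mulgA z^-1) Ey -mulgA; congr (_ * _).
  by rewrite !mulgA strong_commP.
have pxl : par L (x * l * x^-1) by rewrite !parM ?parV.
have [si lE] := conj_peel sn ar ls ls' sz pl' sc' pxl E2.
by split=> //; exists x^-1; rewrite -lE conjgE invgK mulgA.
Qed.

Lemma conj_letters_normal s l : all (letter v) s -> par L l ->
  exists z s' l', [/\ (altprod s * l) ^ z = altprod s' * l', all (letter v) s',
    size s' = size s, par L l' & strong_comm l' s'].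
Proof.
have [n] := ubnP (nsyll l); elim: n s l => // n IHn s l ltn ls pl.
have [s1 [l1 [E1 [ls1 sz1] pl1 le1 eq1]]] := push_letters pl ls.
have [nE|nE] := eqVneq (nsyll l1) (nsyll l).
  by exists 1, s, l; rewrite conjg1; split=> //; case: (eq1 nE).
have lt1 : nsyll l1 < nsyll l by rewrite ltn_neqAle nE.
have [z [s2 [l2 [E2 ls2 sz2 pl2 sc]]]] := IHn _ _ (leq_trans lt1 ltn) ls1 pl1.
exists (l^-1 * z), s2, l2; split=> //; last by rewrite sz2.
by rewrite -E2 -E1 conjgM; congr (_ ^ _); rewrite conjgE invgK mulgK.
Qed.

End ConjugacyClasses.

Lemma par_linkS S T x : S \subset T -> par (link e T) x -> par (link e S) x.
Proof.
move=> ST; apply: par_sub; apply/finset.bigcapsP => u uS.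
by apply: finset.bigcap_inf; apply: (fintype.subsetP ST).
Qed.

(** * Least supports of conjugacy classes *)

Lemma par_conj S x z : par S x -> par S (x ^ z) -> x ^ z = x ^ proj S z.
Proof. by move=> /parP px /parP <-; rewrite projJ px. Qed.

Definition meets x S := `[< exists z, par S (x ^ z) >].

Lemma meetsT x : meets x [set: V].
Proof. by apply/asboolP; exists 1; apply: parT. Qed.

(* By [meetsI], this set of least cardinality is least for the inclusion.     *)
Definition csupp x : {set V} := [arg min_(S < [set: V]%SET | meets x S) #|S|].

Lemma csupp_meets x : meets x (csupp x).
Proof. by rewrite /csupp; case: arg_minnP; first exact: meetsT. Qed.

(** Retracting onto [T] the conjugacy between [x ^ z] and [x ^ w] fixes [x ^ w] and exhibits it as a
    conjugate of [proj T (x ^ z)], which lies in both subgroups. *)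
Lemma meetsI x S T : meets x S -> meets x T -> meets x (S :&: T).
Proof.
move=> /asboolP[z pz] /asboolP[w pw]; apply/asboolP.
have E : x ^ w = (x ^ z) ^ (z^-1 * w) by rewrite -conjgM mulgA mulgV mul1g.
exists (w * (proj T (z^-1 * w))^-1); rewrite conjgM -(parP _ _ pw) E projJ conjgK.
by rewrite finset.setIC; apply: proj_par.
Qed.

Lemma meets_csupp x S : meets x S = (csupp x \subset S).
Proof.
apply/idP/idP => [xS|sub]; last first.
  have /asboolP[z pz] := csupp_meets x; apply/asboolP; exists z.
  exact: par_sub pz.
have xI := meetsI (csupp_meets x) xS.
have : #|csupp x| <= #|csupp x :&: S|.
  by rewrite {1}/csupp; case: arg_minnP => [|T _]; [exact: meetsT | apply].
by move=> le; apply/finset.setIidPl/eqP; rewrite eqEcard finset.subsetIl.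
Qed.

Lemma meetsJ x z S : meets (x ^ z) S = meets x S.
Proof.
apply/asboolP/asboolP => -[w pw]; first by exists (z * w); rewrite conjgM.
by exists (z^-1 * w); rewrite conjgM conjgK.
Qed.

Lemma csuppJ x z : csupp (x ^ z) = csupp x.
Proof.
have le1 : csupp (x ^ z) \subset csupp x by rewrite -meets_csupp meetsJ csupp_meets.
have le2 : csupp x \subset csupp (x ^ z).
  by rewrite -meets_csupp -(meetsJ x z) csupp_meets.
apply/finset.setP => u; apply/idP/idP.
  exact: (fintype.subsetP le1).
exact: (fintype.subsetP le2).
Qed.

Lemma par_csupp S x : par S x -> csupp x \subset S.
Proof. by move=> px; rewrite -meets_csupp; apply/asboolP; exists 1; rewrite conjg1. Qed.

(** The conjugator is kept in the support of [x], so that in [conj_hyperbolic] it commutes with the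
    letters. *)
Lemma exists_proj_csupp x : exists2 z, par (supp x) z & x ^ z = proj (csupp x) x.
Proof.
have /asboolP[z pz] := csupp_meets x; set S := csupp x in pz *.
have SS : S \subset supp x by apply: par_csupp; apply: par_suppT.
have E : x ^ (z * (proj S z)^-1) = proj S x.
  by rewrite conjgM -(parP _ _ pz) projJ conjgK.
exists (proj (supp x) (z * (proj S z)^-1)); first exact: par_proj.
rewrite -par_conj ?E ?par_suppT //.
exact: par_sub SS (par_proj _ _).
Qed.

Section HyperbolicClasses.
Variable v : V.
Local Notation L := (link1 e v).
Implicit Types (s : seq (GP * GP)) (l : GP).

(* The letters counted by the argument of the operator N in the summand of S. *)
Definition letter_in S (p : GP * GP) := letter v p && par (link e S) p.1.

Lemma letters_in_strong S l s : all (letter_in S) s -> par S l ->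
  all (letter v) s /\ strong_comm l s.
Proof.
move=> ls pl; split; apply/allP => p ps; case/andP: (allP ls p ps) => // lp.
by apply: par_linkS; rewrite -par_supp.
Qed.

Lemma conj_hyperbolic s l : all (letter v) s -> par L l ->
  exists z s' l', [/\ (altprod s * l) ^ z = altprod s' * l', size s' = size s,
    all (letter_in (csupp l')) s', par (csupp l') l' & csupp l' \subset L].
Proof.
move=> ls pl; have [z [s' [l1 [E ls' sz pl1 sc]]]] := conj_letters_normal ls pl.
have [w pw Ew] := exists_proj_csupp l1.
have pSl := par_proj (csupp l1) l1; rewrite -Ew in pSl.
exists (z * w), s', (l1 ^ w); rewrite csuppJ; split=> //.
- rewrite conjgM E conjMg; congr (_ * _).
  rewrite conjgE mulgA -[LHS]mulgA (_ : altprod s' * w = w * altprod s') ?mulKg //.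
  have pLw : par L w by apply: par_sub pw; rewrite -par_supp.
  apply/esym/(strong_commP ls' pLw); apply/allP => p /(allP sc).
  by apply: par_linkS; rewrite -par_supp.
- apply/allP => p ps; rewrite /letter_in (allP ls' p ps) /=.
  by apply: par_linkS (allP sc p ps); apply: par_csupp; apply: par_suppT.
- exact: par_csupp.
Qed.

End HyperbolicClasses.

(** * Lengths *)

Variable X : forall u, set (G u).
Hypothesis X_finite : forall u, finite_set (@X u).
Hypothesis X_inv : forall u (x : G u), @X u x -> @X u x^-1.
Hypothesis X_gen : forall u, generated (@X u) = [set: G u]%classic.

Lemma word_for_cat (H : groupType) (Y : set H) (p q : seq H) (x y : H) :
  word_for Y p x -> word_for Y q y -> word_for Y (p ++ q) (x * y).
Proof.
case=> Yp <- [Yq <-]; split; last by rewrite big_cat.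
by move=> z; rewrite mem_cat => /orP[/Yp|/Yq].
Qed.

Lemma word_for_nil (H : groupType) (Y : set H) : word_for Y [::] 1.
Proof. by split=> //; rewrite big_nil. Qed.

Lemma word_for1 (H : groupType) (Y : set H) (x : H) : Y x -> word_for Y [:: x] x.
Proof. by move=> Yx; split=> [y|]; rewrite ?big_seq1 // inE => /eqP->. Qed.

Local Notation gens S := (gp_gens e X S).

Lemma gens_inj S u (g : G u) : u \in S -> X g -> gens S (gp_inj e g).
Proof. by move=> uS Xg; exists u => //; exists g. Qed.

Lemma gensV S x : gens S x -> gens S x^-1.
Proof.
by case=> u uS [g Xg <-]; rewrite -gp_injV; apply: gens_inj => //; apply: X_inv.
Qed.

Lemma word_forV S w x : word_for (gens S) w x ->
  exists w', word_for (gens S) w' x^-1.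
Proof.
elim: w x => [|y w IHw] x [wS wx].
  by exists [::]; rewrite -wx big_nil invg1; apply: word_for_nil.
have [|w' w'E] := IHw (\prod_(z <- w) z).
  by split=> // z zw; apply: wS; rewrite inE zw orbT.
exists (w' ++ [:: y^-1]); rewrite -wx big_cons invgM; apply: word_for_cat => //.
by apply/word_for1/gensV/wS; rewrite inE eqxx.
Qed.

Lemma exists_word x : exists w, word_for (gens [set: V]) w x.
Proof.
elim/gp_ind: x => [|u g x [w wx]]; first by exists [::]; apply: word_for_nil.
suff [p pg] : exists w, word_for (gens [set: V]) w (gp_inj e g).
  by exists (p ++ w); apply: word_for_cat.
have Xg : generated (X (u := u)) g by rewrite X_gen.
apply: (Xg [set h | exists w, word_for (gens [set: V]) w (gp_inj e h)]%classic).
split=> [|h Xh]; last first.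
  by exists [:: gp_inj e h]; apply/word_for1/gens_inj; rewrite ?inE.
split=> [|h1 h2 [w1 w1E] [w2 w2E]].
  by exists [::]; rewrite gp_inj1; apply: word_for_nil.
rewrite /= gp_injM gp_injV; have [w2' w2'E] := word_forV w2E.
by exists (w1 ++ w2'); apply: word_for_cat.
Qed.

Let ex_len x : exists n, `[< exists2 w, word_for (gens [set: V]) w x & size w = n >].
Proof. by have [w wx] := exists_word x; exists (size w); apply/asboolP; exists w. Qed.

Definition len x : nat := ex_minn (ex_len x).

Lemma len_word x : exists2 w, word_for (gens [set: V]) w x & size w = len x.
Proof. by rewrite /len; case: ex_minnP => n /asboolP. Qed.

Lemma len_le w x : word_for (gens [set: V]) w x -> len x <= size w.
Proof.
rewrite /len; case: ex_minnP => n _ min_n wx; apply: min_n.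
by apply/asboolP; exists w.
Qed.

Lemma len1 : len 1 = 0.
Proof. by apply/eqP; rewrite -leqn0; apply: (len_le (word_for_nil _)). Qed.

Lemma lenM x y : len (x * y) <= len x + len y.
Proof.
have [p px <-] := len_word x; have [q qy <-] := len_word y.
by rewrite -size_cat; apply: len_le; apply: word_for_cat.
Qed.

Lemma len_eq0 x : len x = 0 -> x = 1.
Proof.
have [w [_ <-] <-] := len_word x.
by move/size0nil->; rewrite big_nil.
Qed.

(** A generator survives in at most one of the two retractions. *)
Lemma word_proj S T w x : [disjoint S & T] -> word_for (gens [set: V]) w x ->
  exists w1 w2, [/\ word_for (gens S) w1 (proj S x), word_for (gens T) w2 (proj T x) &
    size w1 + size w2 <= size w].
Proof.
move=> dST; elim: w x => [|y w IHw] x [wS wx].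
  by exists [::], [::]; rewrite -wx big_nil !proj1; split=> //; apply: word_for_nil.
have [|w1 [w2 [w1E w2E sz]]] := IHw (\prod_(z <- w) z).
  by split=> // z zw; apply: wS; rewrite inE zw orbT.
rewrite -{x}wx big_cons; set x := \big[_/_]_(_ <- _) _ in w1E w2E *.
have [|u _ [g Xg yE]] := wS y; first by rewrite inE eqxx.
rewrite !projM -{y}yE in wS *; rewrite !proj_inj.
have [uS|uS] := boolP (u \in S).
  rewrite (disjointFr dST uS) mul1g; exists (gp_inj e g :: w1), w2; split=> //.
  by apply: (word_for_cat (word_for1 _)) => //; apply: gens_inj.
have [uT|uT] := boolP (u \in T); rewrite !mul1g.
  exists w1, (gp_inj e g :: w2); split=> //=; last by rewrite addnS.
  by apply: (word_for_cat (word_for1 _)) => //; apply: gens_inj.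
by exists w1, w2; split=> //; apply: leqW.
Qed.

Lemma gens_sub S T x : S \subset T -> gens S x -> gens T x.
Proof. by move=> /fintype.subsetP ST [u /ST uT [g Xg <-]]; apply: gens_inj. Qed.

Lemma word_for_sub S T w x : S \subset T -> word_for (gens S) w x -> word_for (gens T) w x.
Proof. by move=> ST [wS <-]; split=> // y /wS; apply: gens_sub. Qed.

Lemma len_proj2 S T x : [disjoint S & T] -> len (proj S x) + len (proj T x) <= len x.
Proof.
move=> dST; have [w wx <-] := len_word x.
have [w1 [w2 [w1E w2E]]] := word_proj dST wx; apply: leq_trans.
by apply: leq_add; apply: len_le; apply: word_for_sub; rewrite ?finset.subsetT //; eassumption.
Qed.

Lemma len_proj S x : len (proj S x) <= len x.
Proof.
apply: leq_trans (len_proj2 (T := finset.set0) x _); first exact: leq_addr.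
by rewrite disjoint_sym -finset.setI_eq0 finset.set0I.
Qed.

Lemma has_lengthE S x n : par S x -> has_length (gens S) x n <-> len x = n.
Proof.
move=> px; have dS : [disjoint S & finset.set0].
  by rewrite -finset.setI_eq0 finset.setI0.
have min w : word_for (gens S) w x -> len x <= size w.
  by move=> wx; apply: len_le; apply: word_for_sub wx; apply: finset.subsetT.
have [w1 w1E sz] : exists2 w, word_for (gens S) w x & size w = len x.
  have [w wx sw] := len_word x.
  have [w1 [w2 [w1E _ sz]]] := word_proj dS wx; rewrite (parP _ _ px) in w1E.
  exists w1 => //; apply/eqP; rewrite eqn_leq min // andbT -sw.
  exact: leq_trans (leq_addr _ _) sz.
split=> [[[w wx <-] minw]|<-]; last by split; [exists w1|].
by apply/eqP; rewrite eqn_leq min // -sz minw.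
Qed.

Definition beta u x : nat := \sum_(p <- syll u x) len p.2.

Lemma beta_translate u (a : GP) x : par [set~ u] a -> beta u (a * x) = beta u x.
Proof. by move=> pa; rewrite /beta syll_translate // big_map. Qed.

Lemma beta_le u b x : par [set u] b -> beta u (b * x) <= len b + beta u x.
Proof.
move=> pb; rewrite /beta syllMl //; case: (syll u x) => [|[c b'] s] /=.
  by case: ifP => _; rewrite ?big_seq1 !big_nil ?addn0.
case: ifP => _; case: ifP => _.
- by rewrite big_cons; apply: leq_trans (leq_addl _ _) (leq_addl _ _).
- by rewrite !big_cons /= addnA leq_add2r lenM.
- exact: leq_addl.
by rewrite !big_cons.
Qed.

(* A lower bound for the length, since a generator of the factor u changes    *)
(* only [beta u], and by at most one; it is attained by the reduced words.    *)
Definition blen x : nat := \sum_u beta u x.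

Lemma blen_exchange u b x : par [set u] b ->
  blen (b * x) + beta u x = blen x + beta u (b * x).
Proof.
move=> pb; rewrite /blen (bigD1 u) //= [in RHS](bigD1 u) //=.
under eq_bigr => t tu do rewrite beta_translate ?(par_setC _ pb) 1?eq_sym //.
by rewrite addnAC addnC addnA addnAC [X in _ = X + _]addnC -!addnA; congr (_ + _); rewrite addnC.
Qed.

Lemma blen_le u b x : par [set u] b -> blen (b * x) <= len b + blen x.
Proof.
move=> pb; rewrite -(leq_add2r (beta u x)) blen_exchange // addnAC addnC leq_add2r.
exact: beta_le.
Qed.

Lemma blen_cons u b x : par [set u] b -> b != 1 -> hd u x = 1 ->
  blen (b * x) = len b + blen x.
Proof.
move=> pb bn hx; apply: (@addIn (beta u x)); rewrite blen_exchange //.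
have -> : beta u (b * x) = len b + beta u x by rewrite /beta syllM_cons // big_cons.
by rewrite addnA [blen x + _]addnC.
Qed.

Lemma blen1 : blen 1 = 0.
Proof. by apply: big1 => u _; rewrite /beta syll1 big_nil. Qed.

Lemma blen_word w x : word_for (gens [set: V]) w x -> blen x <= size w.
Proof.
elim: w x => [|y w IHw] x [wS <-]; first by rewrite big_nil blen1.
have [|u _ [g Xg yE]] := wS y; first by rewrite inE eqxx.
have pg : par [set u] (gp_inj e g) by apply: par_inj; rewrite inE.
rewrite big_cons -yE; apply: leq_trans (blen_le _ pg) _.
rewrite /= -add1n; apply: leq_add.
  by apply: (len_le (word_for1 _)); apply: gens_inj; rewrite ?inE.
by apply: IHw; split=> // z zw; apply: wS; rewrite inE zw orbT.
Qed.

Lemma len_reduced w : reduced w -> len (wprod w) = \sum_(a <- w) len a.2.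
Proof.
move=> rw; apply/eqP; rewrite eqn_leq; apply/andP; split.
  elim: w {rw} => [|a w IHw] /=; first by rewrite len1.
  rewrite big_cons; apply: leq_trans (lenM _ _) _; rewrite leq_add2l; exact: IHw.
have [p px <-] := len_word (wprod w); apply: leq_trans (blen_word px).
elim: w rw {p px} => [|[u b] w IHw] /=; first by rewrite big_nil.
case/and4P=> pb bn /eqP hw rw; rewrite big_cons (blen_cons pb bn hw) leq_add2l.
exact: IHw.
Qed.

Lemma len_add x y : nsyll (x * y) = nsyll x + nsyll y -> len (x * y) = len x + len y.
Proof.
have [p rp <-] := exists_reduced x; have [q rq <-] := exists_reduced y.
rewrite (nsyll_reduced rp) (nsyll_reduced rq) -wprod_cat => E.
have rpq : reduced (p ++ q).
  apply: reduced_nsyll; last by rewrite E size_cat.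
  by rewrite syllabic_cat !reduced_syllabic.
by rewrite !len_reduced // big_cat.
Qed.

Lemma len_rr S t l : rr S t -> par S l -> len (t * l) = len t + len l.
Proof. by move=> rt pl; apply/len_add/(rr_par_add rt pl). Qed.

Section FixedVertex.
Variable v : V.

(** Nothing merges between [t] and [b * x]: [t] has no syllable of [v], none of a neighbour of [v]
    at its right end, and [b] blocks all other factors. *)
Lemma len_letter p x : letter v p -> hd v x = 1 ->
  len (p.1 * (p.2 * x)) = len p.1 + len p.2 + len x.
Proof.
case: p => t b /andP[/and3P[/= /andP[rt pt] pb bn] tn] hx.
have rb u : u != v -> hd u b^-1 = 1.
  by move=> uv; apply: hd_par; rewrite parV; apply: par_setC pb; rewrite eq_sym.
rewrite len_add; last first.
  apply: nsyllM_add => u; have [uv|uv] := eqVneq u v.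
    by left; subst u; apply: hd_par; rewrite parV.
  have [vu|nvu] := boolP (e v u).
    by left; apply: (rrP _ _ rt); rewrite inE.
  by right; apply: hdM_nonadj pb bn hx; rewrite // 1?eq_sym // e_sym.
rewrite (@len_add b) ?addnA //; apply: nsyllM_add => u.
by have [->|uv] := eqVneq u v; [right | left; apply: rb].
Qed.

Definition wlen (s : seq (GP * GP)) : nat := \sum_(p <- s) (len p.1 + len p.2).

Lemma len_altprod s : all (letter v) s -> len (altprod s) = wlen s.
Proof.
rewrite /wlen; elim: s => [|p s IHs] /=; first by rewrite big_nil len1.
case/andP=> lp ls; rewrite big_cons -IHs // len_letter // -[altprod s]mulg1.
by apply: hd_letters => //; apply: hd_A; apply: par1.
Qed.

Lemma wlen_flatten s m : wlen (flatten (nseq m s)) = (m * wlen s)%N.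
Proof.
elim: m => [|m IHm]; first by rewrite /wlen big_nil.
by rewrite /= /wlen big_cat -!/(wlen _) IHm.
Qed.

Lemma len_altprod_conj s z : all (letter v) s -> wlen s <= len (altprod s ^ z).
Proof.
move=> ls; apply: (conj_stable_le (f := len) (c := 0) (g := altprod s) (z := z)) => [|m|m].
- exact: lenM.
- by rewrite altprodX len_altprod ?wlen_flatten // all_flatten_nseq.
rewrite addn0; elim: m => [|m IHm]; first by rewrite len1.
by rewrite expgS; apply: leq_trans (lenM _ _) _; rewrite mulSn leq_add2l.
Qed.

End FixedVertex.

Section Finiteness.
Local Open Scope classical_set_scope.

Lemma finite_gens : finite_set (gens [set: V]).
Proof.
rewrite /gp_gens; apply: bigcup_finite => [|u _]; first exact: finite_finset.
exact: finite_image.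
Qed.

Lemma finite_len n : finite_set [set x | len x = n].
Proof.
elim: n => [|n IHn].
  by apply: (@sub_finite_set _ _ [set 1%g]) => // x /len_eq0.
have fin2 := finite_image2 (fun x y : GP => (x * y)%g) finite_gens IHn.
apply: sub_finite_set fin2 => x /= lx.
have [[|y w] [wS wx] sw] := len_word x; first by rewrite lx in sw.
move: wx; rewrite big_cons => wx.
exists y; first by apply: wS; rewrite inE eqxx.
exists (\prod_(z <- w) z)%g => //=; apply/eqP; rewrite eqn_leq; apply/andP; split.
  rewrite lx in sw; case: sw => <-; apply: len_le.
  by split=> // z zw; apply: wS; rewrite inE zw orbT.
rewrite -ltnS -lx -wx -add1n; apply: leq_trans (lenM _ _) (leq_add _ (leqnn _)).
by apply: (len_le (word_for1 _)); apply: wS; rewrite inE eqxx.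
Qed.

End Finiteness.

(** * Growth series *)

Lemma growthE S : gp_growth e X S = gseries [set x : GP | par S x]%classic len.
Proof.
apply: fpsP => n /=; congr (cnt _)%:R%R; rewrite subgraph_productE.
by apply/seteqP; split=> x /= [px /(has_lengthE n px)].
Qed.

Lemma locally_finite_len (A : set GP) : locally_finite A len.
Proof. by move=> n; apply: sub_finite_set (finite_len n) => x []. Qed.

Definition ccl x : set GP := [set y | exists z, x ^ z = y]%classic.

Lemma ccl_refl x : ccl x x. Proof. by exists 1; rewrite conjg1. Qed.

Lemma ccl_J x z : ccl (x ^ z) = ccl x.
Proof.
apply/seteqP; split=> y [w <-]; first by exists (z * w); rewrite conjgM.
by exists (z^-1 * w); rewrite conjgM conjgK.
Qed.

Lemma cclP x y : ccl x = ccl y <-> exists z, x ^ z = y.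
Proof.
by split=> [E|[z <-]]; [have := ccl_refl y; rewrite -E | rewrite ccl_J].
Qed.

Lemma ccl_in x y : ccl x y -> ccl y = ccl x.
Proof. by case=> z <-; rewrite ccl_J. Qed.

Lemma ccl_proj S x y : ccl x y -> ccl (proj S x) (proj S y).
Proof. by case=> z <-; exists (proj S z); rewrite projJ. Qed.

(* Minimal length on C; meaningful only when C is non-empty. *)
Definition clen (C : set GP) : nat :=
  xget 0 [set n | (exists2 x, C x & len x = n) /\ forall x, C x -> n <= len x]%classic.

Lemma clenP x : (exists2 y, ccl x y & len y = clen (ccl x)) /\
  forall y, ccl x y -> clen (ccl x) <= len y.
Proof.
apply: (@xgetPex _ 0 [set n | (exists2 y, ccl x y & len y = n) /\ forall y, ccl x y -> n <= len y]%classic).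
have ex : exists n, `[< exists2 y, ccl x y & len y = n >].
  by exists (len x); apply/asboolP; exists x => //; apply: ccl_refl.
case: (ex_minnP ex) => n /asboolP H min_n; exists n; split=> // y xy.
by apply: min_n; apply/asboolP; exists y.
Qed.

Lemma clen_par S x : par S x -> exists y, [/\ ccl x y, par S y & len y = clen (ccl x)].
Proof.
move=> px; have [[y xy ly] min] := clenP x; exists (proj S y).
have xpy : ccl x (proj S y) by have := ccl_proj S xy; rewrite (parP _ _ px).
split=> //; first exact: par_proj.
by apply/eqP; rewrite eqn_leq min // andbT -ly len_proj.
Qed.

(** Classes of the whole group, so that different S can be compared; [conj_growthE] matches them
    with those of the subgraph product by intersecting with [par S]. *)
Definition classes S : set (set GP) := [set C | exists2 x, par S x & C = ccl x]%classic.

Lemma locally_finite_classes S : locally_finite (classes S) clen.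
Proof.
move=> n; have := finite_image ccl (finite_len n).
apply: sub_finite_set => _ [[x px ->] cn]; have [[y xy ly] _] := clenP x.
by exists y; rewrite /= ?ly // (ccl_in xy).
Qed.

Lemma conj_classE S x : par S x ->
  conj_class [set` par S]%classic x = (ccl x `&` [set` par S])%classic.
Proof.
move=> px; apply/seteqP; split=> y /=.
  case=> z pz <-; split; first by exists z.
  by have : par S (x ^ z) by rewrite conjgE !parM ?parV.
case=> -[z <-] pxz; exists (proj S z); first exact: par_proj.
by rewrite /= -par_conj.
Qed.

Lemma has_class_lengthE S x n : par S x ->
  has_class_length (gp_gens e X S) (ccl x `&` [set` par S])%classic n <->
  clen (ccl x) = n.
Proof.
move=> px; have [y [xy py ly]] := clen_par px; have [_ min] := clenP x.
split=> [[[z [xz pz] lz] minz]|<-].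
  apply/eqP; rewrite eqn_leq; apply/andP; split.
    by have /(has_lengthE n pz) <- := lz; apply: min.
  by rewrite -ly; apply: (minz y (len y) (conj xy py)); apply/(has_lengthE _ py).
split; first by exists y; [split | apply/(has_lengthE _ py)].
by move=> z m [xz pz] /(has_lengthE m pz) <-; apply: min.
Qed.

Lemma conj_growthE S : gp_conj_growth e X S = gseries (classes S) clen.
Proof.
apply/esym/fpsP => n /=; congr (_%:R)%R.
apply: (@cnt_bij _ _ (fun C => C `&` [set` par S])%classic).
- exact: locally_finite_classes.
- move=> C [[x px ->] cn]; rewrite subgraph_productE; split.
    by exists x => //; rewrite conj_classE.
  by apply/has_class_lengthE.
- move=> C D [[x px ->] _] [[y py ->] _] E.
  have : (ccl x `&` [set` par S])%classic x by split=> //; apply: ccl_refl.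
  by rewrite E => -[/ccl_in ->].
rewrite subgraph_productE => D [[x /= px <-]]; rewrite conj_classE // => cn.
by exists (ccl x) => //; split; [exists x | apply/(has_class_lengthE n px)].
Qed.

Definition class_supp (C : set GP) : {set V} := csupp (xget 1 C).

Lemma class_suppE x : class_supp (ccl x) = csupp x.
Proof.
have [z E] : ccl x (xget 1 (ccl x)) by apply: (@xgetPex _ 1); exists x; apply: ccl_refl.
by rewrite /class_supp -E csuppJ.
Qed.

Lemma classesE S x : classes S (ccl x) <-> csupp x \subset S.
Proof.
rewrite -meets_csupp; split=> [[y py /cclP[z xzy]]|/asboolP[z pz]].
  by apply/asboolP; exists z; rewrite xzy.
by exists (x ^ z); rewrite ?ccl_J.
Qed.

Definition full_classes S : set (set GP) :=
  [set C | exists2 x, csupp x = S & C = ccl x]%classic.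

Lemma full_classes_sub S : (full_classes S `<=` classes S)%classic.
Proof. by move=> _ [x xS ->]; apply/classesE; rewrite xS. Qed.

Lemma classes_full S : gseries (classes S) clen =
  (\sum_(T : {set V} | T \subset S) gseries (full_classes T) clen)%R.
Proof.
rewrite (gseries_fibers class_supp (locally_finite_classes S)) [RHS]big_mkcond.
apply: eq_bigr => T _; case: ifP => TS.
  congr (gseries _ _); apply/seteqP; split=> C /=.
    by case=> -[x _ ->]; rewrite class_suppE => xT; exists x.
  case=> x xT ->; rewrite class_suppE; split=> //.
  by apply/classesE; rewrite xT.
rewrite (_ : mkset _ = set0)%classic ?gseries0 //; apply/seteqP; split=> C //=.
case=> -[x px ->]; rewrite class_suppE => xT.
by have := par_csupp px; rewrite xT TS.
Qed.

(** Adding or removing a vertex [a] of S outside T pairs off terms of opposite sign. *)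
Lemma sum_sign_interval (R : pzRingType) (S T : {set V}) : T \subset S ->
  (\sum_(U : {set V} | (T \subset U) && (U \subset S)) (-1) ^+ (#|S| - #|U|)%N =
   (T == S)%:R :> R)%R.
Proof.
move=> TS; have [->|TnS] := eqVneq T S.
  rewrite (big_pred1 S) ?subnn ?GRing.expr0 // => U.
  by rewrite andbC -finset.eqEsubset.
have [a aS aT] : exists2 a, a \in S & a \notin T.
  apply/subsetPn; apply: contra TnS => ST; by rewrite finset.eqEsubset TS.
rewrite (bigID (fun U : {set V} => a \in U)) /=.
rewrite (reindex_onto (fun U : {set V} => a |: U)%SET (fun U : {set V} => U :\ a)%SET) /=.
  rewrite [X in (X + _ = _)%R](_ : _ = - \sum_(U : {set V} | ((T \subset U) &&
      (U \subset S)) && (a \notin U)) (-1) ^+ (#|S| - #|U|)%N)%R ?GRing.addNr //.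
  rewrite -GRing.sumrN; apply: eq_big => [U|U /andP[/andP[/andP[_ aUS] _] /eqP Ua]].
    have [aU|aU] := boolP (a \in U).
      rewrite !andbF; apply/negbTE; apply: contraL aU => /andP[_ /eqP <-].
      by rewrite !inE eqxx.
    rewrite setU1K // eqxx !inE eqxx !andbT finset.subUset finset.sub1set aS /=.
    congr (_ && _); apply/fintype.subsetP/fintype.subsetP => TU u uT.
      by have := TU u uT; rewrite !inE; case: eqP uT aT => // -> ->.
    by rewrite !inE TU ?orbT.
  have aU : a \notin U by rewrite -Ua !inE eqxx.
  have := subset_leq_card aUS; rewrite cardsU1 aU add1n => lt.
  by rewrite -(subnSK lt) GRing.exprS GRing.mulN1r GRing.opprK.
by move=> U /andP[_ aU]; rewrite finset.setD1K.
Qed.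

(** Moebius inversion of [classes_full], which sorts classes by least support. *)
Lemma conj_growthME S : gp_conj_growthM e X S = gseries (full_classes S) clen.
Proof.
rewrite /gp_conj_growthM.
under eq_bigr => T TS do rewrite conj_growthE classes_full GRing.mulr_sumr.
rewrite (exchange_big_dep (fun U : {set V} => U \subset S)) /=; last first.
  by move=> T U TS UT; apply: fintype.subset_trans UT TS.
rewrite (bigD1 S) //= [X in (_ + X)%R]big1 ?GRing.addr0 => [|U /andP[US UnS]].
  rewrite (eq_bigl (fun T : {set V} => (S \subset T) && (T \subset S))) => [|T]; last first.
    by rewrite andbC.
  by rewrite -GRing.mulr_suml sum_sign_interval // eqxx GRing.mul1r.
rewrite (eq_bigl (fun T : {set V} => (U \subset T) && (T \subset S))) => [|T]; last first.
  by rewrite andbC.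
by rewrite -GRing.mulr_suml sum_sign_interval // (negPf UnS) GRing.mul0r.
Qed.

Lemma locally_finite_full S : locally_finite (full_classes S) clen.
Proof. exact: locally_finite_sub (@full_classes_sub S) (@locally_finite_classes S). Qed.

Definition class_rep S (C : set GP) : GP :=
  xget 1 [set x | [/\ C x, par S x & len x = clen C]]%classic.

Lemma class_repP S x : par S x ->
  [/\ ccl x (class_rep S (ccl x)), par S (class_rep S (ccl x)) &
      len (class_rep S (ccl x)) = clen (ccl x)].
Proof.
move=> px; have [y Hy] := clen_par px.
by apply: (@xgetPex _ 1 [set z | [/\ ccl x z, par S z & len z = clen (ccl x)]]%classic); exists y.
Qed.

Lemma class_rep_conj S x : par S x ->
  exists2 z, par S z & x ^ z = class_rep S (ccl x).
Proof.
move=> px; have [[z zE] pr _] := class_repP px; exists (proj S z); first exact: par_proj.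
by rewrite -par_conj ?zE.
Qed.

Lemma ccl1 x : ccl x = ccl 1 -> x = 1.
Proof. by move=> /esym/cclP[z <-]; rewrite conj1g. Qed.

Lemma clen1 : clen (ccl 1) = 0.
Proof.
have [_ min] := clenP 1; apply/eqP; rewrite -leqn0 -len1; apply: min; exact: ccl_refl.
Qed.

(** * Decomposition of the conjugacy growth series at a vertex *)

Section Vertex.
Variable v : V.
Local Notation L := (link1 e v).
Local Notation A := [set~ v]%SET.
Implicit Types l b z w : GP.

Let disjLv : [disjoint L & [set v]%SET].
Proof.
rewrite -finset.setI_eq0; apply/eqP/finset.setP => u; rewrite !inE.
by case: eqP => [->|]; rewrite ?e_irr ?andbF.
Qed.

Definition product_classes : set (set GP) :=
  [set C | exists l b : GP, [/\ par L l, par [set v] b, b != 1 & C = ccl (l * b)]]%classic.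

Lemma proj_product l b z : par L l -> par [set v] b ->
  proj L ((l * b) ^ z) = l ^ proj L z /\ proj [set v] ((l * b) ^ z) = b ^ proj [set v] z.
Proof.
move=> pl pb; rewrite !projJ !projM (parP _ _ pl) (parP _ _ pb).
rewrite (proj_disjoint disjLv pb) mulg1 (proj_disjoint _ pl) ?mul1g //.
by rewrite disjoint_sym.
Qed.

(** For the lower bound, a conjugate is retracted onto the disjoint sets [L] and [[set v]], giving
    conjugates of [l] and of [b] whose lengths add up by [len_proj2]. *)
Lemma clen_product l b : par L l -> par [set v] b -> len l = clen (ccl l) ->
  len b = clen (ccl b) -> clen (ccl (l * b)) = len l + len b.
Proof.
move=> pl pb ll lb; have [[y [z <-] ly] min] := clenP (l * b).
apply/eqP; rewrite eqn_leq; apply/andP; split.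
  by apply: leq_trans (min _ (ccl_refl _)) (lenM _ _).
rewrite -ly; apply: leq_trans (len_proj2 _ disjLv).
have [-> ->] := proj_product z pl pb; have [_ minl] := clenP l; have [_ minb] := clenP b.
by rewrite ll lb; apply: leq_add; [apply: minl; exists (proj L z) | apply: minb; exists (proj [set v] z)].
Qed.

Lemma conj_product l b z w : par L l -> par L z -> par [set v] b -> par [set v] w ->
  (l * b) ^ (z * w) = l ^ z * b ^ w.
Proof.
move=> pl pz pb pw; rewrite conjMg !conjgM; congr (_ * _).
  have p : par L (l ^ z) by rewrite conjgE !parM ?parV.
  by rewrite [LHS]conjgE (comm_linkv p pw) mulKg.
by rewrite [b ^ z]conjgE -(comm_linkv pz pb) mulKg.
Qed.

Lemma product_gseries : gseries product_classes clen =
  (gseries (classes L) clen *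
   gseries (classes [set v] `\ ccl 1%g)%classic clen)%R.
Proof.
set D := (_ `\ _)%classic.
have finD : locally_finite D clen.
  by apply: locally_finite_sub (@locally_finite_classes [set v]%SET) => C [].
rewrite -(gseries_setX (@locally_finite_classes L) finD); apply/esym.
apply: (@gseries_bij _ _ (fun p => ccl (class_rep L p.1 * class_rep [set v] p.2))).
- exact: locally_finite_setX (@locally_finite_classes L) finD.
- move=> [_ _] [/= [l pl ->] [[b pb ->] bn]].
  have [_ pl' _] := class_repP pl; have [cb pb' _] := class_repP pb.
  exists (class_rep L (ccl l)), (class_rep [set v] (ccl b)); split=> //.
  by apply/eqP => b1; apply: bn; rewrite -(ccl_in cb) b1.
- move=> [_ _] [/= [l pl ->] [[b pb ->] bn]].
  have [cl pl' ll] := class_repP pl; have [cb pb' lb] := class_repP pb.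
  by rewrite clen_product ?(ccl_in cl) ?(ccl_in cb) ?ll ?lb.
- move=> [_ _] [_ _] [/= [l pl ->] [[b pb ->] bn]] [/= [l' pl' ->] [[b' pb' ->] bn']].
  have [cl pl1 ll] := class_repP pl; have [cb pb1 lb] := class_repP pb.
  have [cl' pl1' ll'] := class_repP pl'; have [cb' pb1' lb'] := class_repP pb'.
  case/cclP=> z zE; have [El Eb] := proj_product z pl1 pb1.
  rewrite -(ccl_in cl) -(ccl_in cb) -(ccl_in cl') -(ccl_in cb').
  have := proj_product 1 pl1' pb1'; rewrite !conjg1 !proj1 !conjg1 -zE El Eb => -[<- <-].
  by rewrite !ccl_J.
move=> _ [l [b [pl pb bn ->]]]; exists (ccl l, ccl b) => /=.
  split; first by exists l.
  by split; [exists b | move/ccl1/eqP; rewrite (negPf bn)].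
have [z pz <-] := class_rep_conj pl; have [w pw <-] := class_rep_conj pb.
by rewrite -conj_product // ccl_J.
Qed.

Definition letters S : set (GP * GP) := [set p | letter_in v S p]%classic.

Definition letter_len (p : GP * GP) : nat := len p.1 + len p.2.

(** As S lies in the link of [v], conversely [v] lies in [link e S], so the syllables [b] belong
    there along with the [t]. *)
Lemma letters_par S (s : seq (GP * GP)) : S \subset L -> all (letter_in v S) s ->
  par (link e S) (altprod s).
Proof.
move=> SL; elim: s => [|[t b] s IHs] /=; first by rewrite par1.
case/andP=> /andP[/andP[/and3P[_ /= pb _] _] /= pt] /IHs ps.
apply: parM => //; apply: parM => //; apply: par_sub pb.
rewrite finset.sub1set; apply/finset.bigcapP => u uS.
by have := fintype.subsetP SL u uS; rewrite !inE e_sym.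
Qed.

Let disj_link S : [disjoint S & link e S].
Proof.
rewrite -finset.setI_eq0; apply/eqP/finset.setP => u; rewrite !inE.
apply/negP => /andP[uS /finset.bigcapP/(_ u uS)].
by rewrite inE e_irr.
Qed.

Definition hyperbolic_classes S : set (set GP) :=
  [set C | exists s l, [/\ s != [::], all (letter_in v S) s, par S l, csupp l = S &
     C = ccl (altprod s * l)]]%classic.

(** The retractions onto S and [link e S] separate a conjugate into one of [l] and one of
    [altprod s]; the latter is bounded below by its translation length. *)
Lemma clen_hyperbolic S s l : S \subset L -> all (letter_in v S) s -> par S l ->
  len l = clen (ccl l) -> clen (ccl (altprod s * l)) = wlen s + len l.
Proof.
move=> SL ls pl ll; have [[y [z <-] ly] min] := clenP (altprod s * l).
have lv : all (letter v) s by apply: sub_all ls => p /andP[].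
have pP := letters_par SL ls.
apply/eqP; rewrite eqn_leq; apply/andP; split.
  rewrite -(len_altprod lv).
  by apply: leq_trans (min _ (ccl_refl _)) (lenM _ _).
rewrite -ly addnC; apply: leq_trans (len_proj2 _ (disj_link S)).
rewrite !projJ !projM (parP _ _ pl) (parP _ _ pP) (proj_disjoint (disj_link S) pP).
rewrite mul1g (proj_disjoint _ pl) ?mulg1; last by rewrite disjoint_sym disj_link.
have [_ minl] := clenP l; apply: leq_add; last exact: (len_altprod_conj _ lv).
by rewrite ll; apply: minl; exists (proj S z).
Qed.

Lemma conj_rot S s l i : all (letter_in v S) s -> S \subset L -> par S l ->
  ccl (altprod (rot i s) * l) = ccl (altprod s * l).
Proof.
move=> ls SL pl; rewrite -{2}(cat_take_drop i s) /rot !altprod_cat.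
set p := altprod (take i s); set q := altprod (drop i s).
have pp : par (link e S) p.
  by move: ls; rewrite -(cat_take_drop i s) all_cat => /andP[lt _]; apply: letters_par.
apply/esym/cclP; exists p; rewrite conjgE -!mulgA mulKg; congr (_ * _).
exact: par_link_comm pl pp.
Qed.

Lemma conj_hyperbolic_rep S s l w : all (letter_in v S) s -> S \subset L ->
  par S w -> ccl (altprod s * l ^ w) = ccl (altprod s * l).
Proof.
move=> ls SL pw; apply/esym/cclP; exists w; rewrite conjMg; congr (_ * _).
by rewrite conjgE -(par_link_comm pw (letters_par SL ls)) mulKg.
Qed.

Lemma hyperbolic_uniq S S' s l s' l' : s != [::] -> S \subset L -> S' \subset L ->
  all (letter_in v S) s -> par S l -> all (letter_in v S') s' -> par S' l' ->
  ccl (altprod s * l) = ccl (altprod s' * l') ->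
  rotations s = rotations s' /\ ccl l = ccl l'.
Proof.
move=> sn SL SL' ls pl ls' pl' /cclP[z E].
have [lv sc] := letters_in_strong ls pl; have [lv' sc'] := letters_in_strong ls' pl'.
have [[i si] [x lx]] := conj_letters_uniq sn lv (par_sub SL pl) sc lv' (par_sub SL' pl') sc' E.
by split; [rewrite si rotations_rot | rewrite -lx ccl_J].
Qed.

Lemma locally_finite_letters S : locally_finite (letters S) letter_len.
Proof.
apply: (@locally_finite_sub _ _ (setT `*` setT)%classic) => //.
by apply: locally_finite_setX; apply: locally_finite_len.
Qed.

Lemma letter_len_gt0 S p : letters S p -> 0 < letter_len p.
Proof.
case: p => t b /andP[/andP[/and3P[_ _ /= bn] _] _]; rewrite /letter_len addn_gt0 /= orbC.
by rewrite lt0n; case: eqP => // /len_eq0 b1; rewrite b1 eqxx in bn.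
Qed.

(** A class and a necklace are sent to the class of a word times a shortest representative. Choices
    do not matter by [conj_rot] and [conj_hyperbolic_rep]; injectivity is [hyperbolic_uniq]. *)
Lemma hyperbolic_gseries S : S \subset L ->
  gseries (hyperbolic_classes S) clen =
  (gseries (full_classes S) clen * fps_N (gseries (letters S) letter_len))%R.
Proof.
move=> SL.
have wt0 := @letter_len_gt0 S; have finY := @locally_finite_letters S.
have finN := locally_finite_necklaces wt0 finY.
have fullP C : full_classes S C -> exists2 x, par S x & C = ccl x /\ csupp x = S.
  move=> fC; have [x px CE] := full_classes_sub fC; exists x => //; split=> //.
  by case: fC => y yS; rewrite CE => /cclP[z E]; rewrite -(csuppJ x z) E.
have allY (s : seq (GP * GP)) : {in s, forall p, letters S p} <-> all (letter_in v S) s.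
  by split=> [Ys|/allP Ys p ps]; [apply/allP => p /Ys | apply: Ys].
rewrite -(necklaces_gseries wt0 finY) -(gseries_setX (@locally_finite_full S) finN).
apply/esym; apply: (@gseries_bij _ _ (fun p => ccl (altprod (xget [::] p.2) * class_rep S p.1))).
- exact: locally_finite_setX (@locally_finite_full S) finN.
- move=> [C _] [/= /fullP[l pl [-> lS]] [s [sn /allY ls] ->]].
  have [cl pl' _] := class_repP pl; have [i ->] := xget_rotations s.
  exists (rot i s), (class_rep S (ccl l)); split; last by [].
  - by rewrite -size_eq0 size_rot size_eq0.
  - by rewrite /rot all_cat andbC -all_cat cat_take_drop.
  - exact: pl'.
  by rewrite -(class_suppE (class_rep S (ccl l))) (ccl_in cl) class_suppE.
- move=> [C _] [/= /fullP[l pl [-> lS]] [s [sn /allY ls] ->]].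
  have [cl pl' ll] := class_repP pl; have [i ->] := xget_rotations s.
  rewrite /= necklace_weightE (conj_rot i ls SL pl') (clen_hyperbolic SL ls pl').
    by rewrite ll addnC.
  by rewrite (ccl_in cl).
- move=> [C K] [C' K'] [/= /fullP[l pl [-> lS]] [s [sn /allY ls] ->]].
  case=> /= /fullP[l' pl' [-> lS']] [s' [sn' /allY ls'] ->].
  have [cl pl1 _] := class_repP pl; have [cl' pl1' _] := class_repP pl'.
  have [i ->] := xget_rotations s; have [i' ->] := xget_rotations s'.
  rewrite /= (conj_rot i ls SL pl1) (conj_rot i' ls' SL pl1') => /(hyperbolic_uniq sn SL SL ls pl1 ls' pl1')[-> E].
  by congr (_, _); rewrite -(ccl_in cl) E (ccl_in cl').
move=> _ [s [l [sn ls pl lS ->]]]; exists (ccl l, rotations s) => /=.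
  by split; [exists l | exists s => //; split=> //; apply/allY].
have [i ->] := xget_rotations s; have [w pw <-] := class_rep_conj pl.
rewrite (conj_rot i ls SL) ?(conj_hyperbolic_rep _ ls SL pw) //.
by rewrite conjgE !parM ?parV.
Qed.

Local Notation U S := (link e S :\ v)%SET.

Lemma growth_unit S : (gp_growth e X S \is a GRing.unit)%R.
Proof.
suff E : gp_growth e X S 0%N = 1%R by rewrite unfold_in /= /fps_unit E GRing.oner_neq0.
rewrite growthE /= (_ : level _ _ _ = [set 1%g])%classic ?cnt1 //.
apply/seteqP; split=> x /= [].
  by move=> _ /len_eq0.
by move=> ->; split; [apply: par1 | apply: len1].
Qed.

Definition transversal S : set GP := [set t | transv v t /\ par (link e S) t]%classic.

(** Factoring through shortest coset representatives is unique and adds lengths. *)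
Lemma growth_transversal S :
  gp_growth e X (U S) = (gseries (transversal S) len * gp_growth e X (L :&: link e S)%SET)%R.
Proof.
rewrite !growthE -gseries_setX; try exact: locally_finite_len.
have UE x : par (U S) x = par A x && par (link e S) x.
  by rewrite -parI; congr (par _ x); apply/finset.setP => u; rewrite !inE.
have LA : L \subset A := link_setC v.
apply/esym; apply: (@gseries_bij _ _ (fun p => p.1 * p.2)).
- by apply: locally_finite_setX; apply: locally_finite_len.
- move=> [t l] [/= [/andP[rt pt] plt]]; rewrite parI => /andP[pl1 pl2].
  by rewrite /= UE !parM //; apply: par_sub pl1.
- move=> [t l] [/= [/andP[rt pt] plt]]; rewrite parI => /andP[pl1 pl2].
  exact: len_rr rt pl1.
- move=> [t l] [t' l'] [/= [/andP[rt _] _]]; rewrite parI => /andP[pl _].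
  case=> /= -[/andP[rt' _] _]; rewrite parI => /andP[pl' _] E.
  by have [-> ->] := rr_uniq rt pl rt' pl' E.
move=> x /= pU; have [t [l [xE rt pl]]] := rr_exists (L :&: link e S)%SET x.
move: (pU); rewrite UE => /andP[pA pS]; move: (pl); rewrite parI => /andP[plL plS].
exists (t, l) => //; split=> //=.
have ptS : par (link e S) t by rewrite -(parMr _ plS) -xE.
split=> //; apply/andP; split; last by rewrite -(parMr _ (par_sub LA plL)) -xE.
(* Being shortest for [L :&: link e S] suffices for [L], since [t] has no syllable outside
   [link e S]. *)
apply/rrP => u uL; have [uS|uS] := boolP (u \in link e S).
  by apply: (rrP _ _ rt); rewrite inE uL.
apply: hd_par; rewrite parV; apply: par_sub ptS.
by apply/fintype.subsetP => w wS; rewrite !inE; apply: contraNneq uS => <-.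
Qed.

(** The quotient counts the possible [t]; the two subtractions exclude [t = 1] and [b = 1]. *)
Lemma letters_gseries S :
  gseries (letters S) letter_len =
  ((gp_growth e X (U S) / gp_growth e X (L :&: link e S)%SET - 1) *
   (gp_growth e X [set v]%SET - 1))%R.
Proof.
have E : letters S = ((transversal S `\ 1%g) `*` ([set x : GP | par [set v] x] `\ 1%g))%classic.
  apply/seteqP; split=> -[t b] /=.
    by case/andP=> /andP[/and3P[/= tt pb /eqP bn] /eqP tn] pt.
  case=> /= -[[tt pt] /eqP tn] [pb /eqP bn].
  by rewrite /letters /= /letter_in /letter /wletter /= tt pb bn tn pt.
rewrite E (gseries_setX (@locally_finite_len _) (@locally_finite_len _)).
rewrite !(gseries_setD1 _ len1); try exact: locally_finite_len; last 2 first.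
- exact: par1.
- by split; [apply: transv1 | apply: par1].
by rewrite growth_transversal GRing.mulrK ?growth_unit // -growthE.
Qed.

(** The number of [v]-syllables grows linearly along the powers. It stays 0 for elements of [par A]
    and at most 1 for products [l * b], which separates the kinds of classes. *)
Lemma hyperbolic_syll (s : seq (GP * GP)) l z c : s != [::] -> all (letter v) s -> par L l ->
  strong_comm l s -> ~ (forall m, size (syll v (((altprod s * l) ^ z) ^+ m)) <= c).
Proof.
move=> sn ls pl sc le.
suff: size s <= 0 by rewrite leqn0 size_eq0 (negPf sn).
apply: (conj_stable_le (f := fun x => size (syll v x)) (c := c) (g := altprod s * l) (z := z)).
- by move=> x y; apply: size_syll_subM.
- by move=> m; rewrite size_syllX.
by move=> m; rewrite muln0.
Qed.

Lemma hyperbolic_classes_disjoint S C : S \subset L -> hyperbolic_classes S C ->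
  ~ classes A C /\ ~ product_classes C.
Proof.
move=> SL [s [l [sn ls pl _ ->]]]; have [lv sc] := letters_in_strong ls pl.
have pLl := par_sub SL pl; split=> [[y py]|[l' [b [pl' pb _]]]] /cclP[z E].
  apply: (hyperbolic_syll sn lv pLl sc (z := z) (c := 0)) => m.
  by rewrite E syll_par //; apply: parX.
apply: (hyperbolic_syll sn lv pLl sc (z := z) (c := 1)) => m.
rewrite E expgMn; last exact: (comm_linkv pl' pb).
rewrite size_syll_translate; last by apply: parX; apply: par_sub pl'; apply: link_setC.
have := size_syllM 1 (parX m pb); rewrite mulg1 syll1 /=; exact.
Qed.

(** The retraction onto the factor [v] kills [par A] but sends [l * b] to [b]. *)
Lemma classes_product_disjoint C : classes A C -> ~ product_classes C.
Proof.
case=> y py ->{C} [l [b [pl pb /eqP bn]]] /esym/cclP[z E]; apply: bn.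
have [_ Eb] := proj_product z pl pb; move: Eb; rewrite E.
rewrite (proj_disjoint _ py) => [/esym/eqP|]; first by rewrite conjg_eq1 => /eqP.
by rewrite -finset.setI_eq0; apply/eqP/finset.setP => u; rewrite !inE; case: eqP.
Qed.

Lemma classes_decomposition :
  classes [set: V] = (classes A `|` product_classes `|`
    \bigcup_(S in [set S : {set V} | S \subset L]) hyperbolic_classes S)%classic.
Proof.
apply/seteqP; split=> C; last first.
  have all_cl x : classes [set: V] (ccl x) by exists x => //; apply: parT.
  by case=> [[[x _ ->]|[l [b [_ _ _ ->]]]]|[S _ [s [l [_ _ _ _ ->]]]]].
case=> x _ ->{C}; have [z Hz] := conj_normal v x; rewrite -(ccl_J x z).
case: Hz => [pA|[l [b [pl pb bn ->]]]|[s [l [sn ls pl ->]]]].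
- by left; left; exists (x ^ z).
- by left; right; exists l, b.
right; have [w [s' [l' [E sz ls' pl' SL]]]] := conj_hyperbolic ls pl.
exists (csupp l') => //; exists s', l'; split=> //; last by rewrite -E ccl_J.
by rewrite -size_eq0 sz size_eq0.
Qed.

Lemma conj_growth_decomposition :
  gp_conj_growth e X [set: V] =
  (gp_conj_growth e X A + gp_conj_growth e X L * (gp_conj_growth e X [set v]%SET - 1)
   + \sum_(S : {set V} | S \subset L) gp_conj_growthM e X S *
     fps_N ((gp_growth e X (U S) / gp_growth e X (L :&: link e S)%SET - 1)
            * (gp_growth e X [set v]%SET - 1)))%R.
Proof.
have fin := @locally_finite_classes [set: V]; rewrite conj_growthE.
rewrite classes_decomposition in fin *.
rewrite gseries_setU //; last first.
  move=> C [clA|clp] [S SL] /(hyperbolic_classes_disjoint SL)[]; by [].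
congr (_ + _)%R.
  rewrite gseries_setU; last first.
  - by apply: locally_finite_sub fin => C; left.
  - exact: classes_product_disjoint.
  rewrite product_gseries gseries_setD1; last first.
  - exact: locally_finite_classes.
  - exact: clen1.
  - by exists 1 => //; apply: par1.
  by rewrite !conj_growthE.
rewrite gseries_bigcup.
- apply: eq_bigr => S SL.
  by rewrite hyperbolic_gseries // letters_gseries conj_growthME.
- move=> S S' C SL SL' [s [l [sn ls pl lS ->]]] [s' [l' [_ ls' pl' lS']]] E.
  have [_ /cclP[z lz]] := hyperbolic_uniq sn SL SL' ls pl ls' pl' E.
  by rewrite -lS -lS' -lz csuppJ.
by apply: locally_finite_sub fin => C; right.
Qed.

End Vertex.

End GraphProductGroup.

Local Open Scope ring_scope.

Theorem theorem1 (V : finType) (e : rel V)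
    (e_sym : symmetric e) (e_irr : irreflexive e)
    (G : V -> groupType)
    (G_nontrivial : forall u, exists g : G u, g <> 1%g)
    (X : forall u, set (G u))
    (X_finite : forall u, finite_set (X u))
    (X_inv : forall u (x : G u), X u x -> X u (x^-1)%g)
    (X_gen : forall u, generated (X u) = [set: G u]%classic)
    (v : V) :
  let sigma := gp_growth e X in
  let csigma := gp_conj_growth e X in
  let csigmaM := gp_conj_growthM e X in
  let Lk1 := link1 e in
  let Lk := link e in
  csigma [set: V]%SET =
      csigma ([set: V] :\ v)%SET + csigma (Lk1 v) * (csigma [set v]%SET - 1)
    + \sum_(S : {set V} | S \subset Lk1 v)
        csigmaM S *
        fps_N ((sigma (Lk S :\ v)%SET / sigma (Lk1 v :&: Lk S)%SET - 1)
               * (sigma [set v]%SET - 1))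
  /\
  ((v |: Lk1 v)%SET = [set: V]%SET ->
     csigma [set: V]%SET = csigma (Lk1 v) * csigma [set v]%SET).
Proof.
move=> sigma csigma csigmaM Lk1 Lk; rewrite finset.setTD.
have main := conj_growth_decomposition e_irr e_sym X_finite X_inv X_gen v.
split=> [|starV]; first exact: main.
rewrite -/csigma in main; rewrite main.
have vL : v \notin Lk1 v by rewrite inE e_irr.
have AL : ([set~ v] = Lk1 v)%SET.
  apply/finset.setP => u; have := finset.in_setT u; rewrite -starV !inE.
  by case: eqP => [->|_] /=; [rewrite e_irr | move=> ->].
(* When [v] is adjacent to all other vertices, [[set~ v]] is [Lk1 v]: both series in each quotient
   agree, and N is applied to 0. *)
rewrite [X in (_ + X)%R]big1 => [|S _]; last first.
  have -> : (Lk S :\ v = Lk1 v :&: Lk S)%SET by rewrite finset.setDE AL finset.setIC.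
  rewrite GRing.divrr ?(growth_unit _ X_inv X_gen) // GRing.subrr GRing.mul0r.
  rewrite (_ : fps_N 0 = 0)%R ?GRing.mulr0 //; apply: fpsP => n /=.
  rewrite big_nat big1 // => k /andP[k0 _]; rewrite big_nat big1 // => l /andP[l0 _].
  have -> : (fps_subX k 0 = 0)%R by apply: fpsP => i /=; case: ifP.
  by rewrite GRing.expr0n eqn0Ngt l0 /= GRing.mulr0.
by rewrite GRing.addr0 AL GRing.mulrBr GRing.mulr1 GRing.addrC GRing.subrK.
Qed.
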